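(* Let $d$ be a prime number and let $g\ge 0$ be an integer with $g>\frac{d^2-4d+3}{3}$. Let $(\mathcal{C},\sigma)$ be any real algebraic curve of genus $g$. Then the space of meromorphic functions of degree $d$ on $(\mathcal{C},\sigma)$ has the total reality property. That is, if $f:\mathcal{C}\to\mathbb{CP}^1$ is a meromorphic function of degree $d$ such that (i) all its critical points and critical values are distinct, and (ii) all its critical points belong to $\mathcal{C}_\sigma$, then there exists a real structure $\tau'$ on $\mathbb{CP}^1$ such that $\tau'\circ f\circ\sigma=f$.
   Context: A real algebraic curve $(\mathcal{C},\sigma)$ is a compact (connected) Riemann surface $\mathcal{C}$ together with an antiholomorphic involution $\sigma:\mathcal{C}\to\mathcal{C}$; its real part $\mathcal{C}_\sigma$ is the set of fixed points of $\sigma$. A real structure on $\mathbb{CP}^1$ is an antiholomorphic involution of $\mathbb{CP}^1$. A meromorphic function of degree $d$ on $\mathcal{C}$ is a holomorphic map $f:\mathcal{C}\to\mathbb{CP}^1$ of degree $d$; a generic such function has $2d-2+2g$ critical points counted with multiplicity. Condition (i) means that there are $2d-2+2g$ distinct critical points and that their images (critical values) are pairwise distinct. *)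

(* Defs.v *)
From HB Require Import structures.
From mathcomp Require Import all_boot all_order all_algebra.
From mathcomp Require Import complex.
From mathcomp Require Import all_classical all_reals all_analysis.
Set Implicit Arguments.
Unset Strict Implicit.
Unset Printing Implicit Defensive.
Import Order.TTheory GRing.Theory Num.Theory.
Import numFieldNormedType.Exports.
Local Open Scope classical_set_scope.
Local Open Scope ring_scope.

(* The regular module R[i]^o makes derivable and derive1 below take limits of
   complex difference quotients.  On R[i] itself the canonical scaling is by R. *)
Notation Cplx R := ((R[i])^o).

(* The atlas need not be maximal: the notions below do not depend on the choice
   of an atlas within its equivalence class.  chart_inv i is only meaningful on
   chart i @` chart_dom i. *)
Record riemannSurface (R : realType) := RiemannSurface {
  rs_space :> topologicalType;
  rs_hausdorff : hausdorff_space rs_space;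
  rs_connected : connected [set: rs_space];
  rs_nonempty : [set: rs_space] !=set0;
  chart_index : Type;
  chart_dom : chart_index -> set rs_space;
  chart : chart_index -> rs_space -> Cplx R;
  chart_inv : chart_index -> Cplx R -> rs_space;
  chart_dom_open : forall i, open (chart_dom i);
  chart_codom_open : forall i, open (chart i @` chart_dom i);
  chart_cover : forall p, exists i, chart_dom i p;
  chartK : forall i p, chart_dom i p -> chart_inv i (chart i p) = p;
  chart_continuous : forall i p, chart_dom i p -> {for p, continuous (chart i)};
  chart_inv_continuous : forall i p, chart_dom i p ->
    {for chart i p, continuous (chart_inv i)};
  chart_transition : forall i j p, chart_dom i p -> chart_dom j p ->
    derivable (chart j \o chart_inv i) (chart i p) 1 }.

Section Notions.
Context {R : realType}.
Implicit Types X Y : riemannSurface R.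

Definition local_expr X Y (f : X -> Y) (i : chart_index X) (j : chart_index Y) :
  Cplx R -> Cplx R := chart j \o f \o chart_inv i.

(* Continuity makes the points where local_expr f i j represents f an open set,
   so that complex differentiability at each of them is holomorphy. *)
Definition holomorphic X Y (f : X -> Y) := continuous f /\
  forall i j p, chart_dom i p -> chart_dom j (f p) ->
    derivable (local_expr f i j) (chart i p) 1.

Definition antiholomorphic X Y (f : X -> Y) := continuous f /\
  forall i j p, chart_dom i p -> chart_dom j (f p) ->
    derivable ((@conjc R : Cplx R -> Cplx R) \o local_expr f i j) (chart i p) 1.

Definition antiholomorphic_involution X (s : X -> X) :=
  antiholomorphic s /\ involutive s.

Definition real_part X (s : X -> X) : set X := [set p | s p = p].

Definition critical X Y (f : X -> Y) : set X := [set p | forall i j,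
  chart_dom i p -> chart_dom j (f p) ->
    derive1 (local_expr f i j) (chart i p) = 0].

(* The multiplicity of f at p: the order of vanishing at chart i p of
   local_expr f i j minus its value there.  It is 0 when there is no such m, i.e.
   when f is constant near p. *)
Definition local_mult X Y (f : X -> Y) (p : X) : nat := xget 0%N [set m |
  (0 < m)%N /\ forall i j, chart_dom i p -> chart_dom j (f p) ->
    (forall k, (0 < k < m)%N ->
      derive1n k (local_expr f i j) (chart i p) = 0) /\
    derive1n m (local_expr f i j) (chart i p) != 0].

(* Finiteness is required because \sum_(p \in A) is 0 when its support is
   infinite. *)
Definition has_degree X Y (f : X -> Y) (d : nat) := forall q : Y,
  finite_set (f @^-1` [set q]) /\
  \sum_(p \in f @^-1` [set q]) local_mult f p = d.

(* A holomorphic 1-form is given by its coefficients: w i z dz on the image of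
   chart i, subject to the change of variable rule.  The values of w i outside
   the image of chart i are irrelevant. *)
Definition holomorphic_form X (w : chart_index X -> Cplx R -> Cplx R) :=
  (forall i p, chart_dom i p -> derivable (w i) (chart i p) 1) /\
  (forall i j p, chart_dom i p -> chart_dom j p ->
    w i (chart i p) =
      w j (chart j p) * derive1 (chart j \o chart_inv i) (chart i p)).

(* For compact X, the genus is the dimension of the space of holomorphic
   1-forms: has_genus X g says that this space has a basis of g elements. *)
Definition has_genus X (g : nat) :=
  exists w : 'I_g -> chart_index X -> Cplx R -> Cplx R,
    (forall k, holomorphic_form (w k)) /\
    forall u, holomorphic_form u -> exists! c : 'rV[R[i]]_g,
      forall i p, chart_dom i p ->
        u i (chart i p) = \sum_(k < g) c ord0 k * w k i (chart i p).

End Notions.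

Section RiemannSphere.
Variable R : realType.
Local Notation C := (Cplx R).
Local Notation opc := (one_point_compactification C).

(* The two charts of C with a point at infinity (None): false is the coordinate z
   on C, true is the coordinate 1/z around infinity. *)
Definition sphere_dom (b : bool) : set opc :=
  if b then [set p | p <> Some 0] else [set p | p <> None].

Definition sphere_chart (b : bool) (p : opc) : C :=
  if p is Some z then (if b then z^-1 else z) else 0.

Definition sphere_chart_inv (b : bool) (z : C) : opc :=
  if b then (if z == 0 then None else Some z^-1) else Some z.

Let ofR (r : R) : C := real_complex R r.

Let gt0_ofR (e : C) : 0 < e -> exists2 r, 0 < r & e = ofR r.
Proof.
move=> e0; have eR : ofR (complex.Re e) = e by apply/RRe_real/gtr0_real.
by exists (complex.Re e); rewrite -?ltcR -?[X in _ < X]/(ofR _) eR.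
Qed.

Let norm_le (a b : R) : `|Complex a b : C| <= ofR (`|a| + `|b|).
Proof.
have -> : Complex a b = ofR a + Complex 0 b :> C.
  by apply/eqP; rewrite eq_complex /= addr0 add0r !eqxx.
rewrite /ofR rmorphD /=; apply: le_trans (ler_normD _ _) _.
rewrite !normc_def /= !(expr0n, addr0, add0r) !sqrtr_sqr.
by rewrite lerD.
Qed.

Let complex_continuous : continuous (fun x : R * R => Complex x.1 x.2 : C).
Proof.
move=> [a b]; apply/cvgrPdist_lt => _ /gt0_ofR[e e0 ->].
near=> x; have -> : Complex a b - Complex x.1 x.2 = Complex (a - x.1) (b - x.2) by [].
apply: le_lt_trans (norm_le _ _) _; rewrite /ofR ltcR.
rewrite [ltRHS](splitr e) ltrD//.
- near: x; apply: cvgr_dist_lt; last exact: divr_gt0.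
  exact: cvg_fst.
- near: x; apply: cvgr_dist_lt; last exact: divr_gt0.
  exact: cvg_snd.
Unshelve. all: by end_near. Qed.

Let box (M : R) : set C :=
  [set z | `|complex.Re z| <= M /\ `|complex.Im z| <= M].

Let box_compact M : compact (box M).
Proof.
have -> : box M = (fun x : R * R => Complex x.1 x.2 : C) @`
    (`[- M, M] `*` `[- M, M])%classic.
  apply/seteqP; split=> [[a b] [/= aM bM]|_ [[a b] [/= aM bM] <-]].
    by exists (a, b); rewrite //= !in_itv /= -!ler_norml.
  by rewrite /box /=; move: aM bM; rewrite /= !in_itv /= -!ler_norml.
apply: continuous_compact; first exact/continuous_subspaceT/complex_continuous.
by apply: compact_setX; exact: segment_compact.
Qed.

Let Im_le (z : C) : ofR `|complex.Im z| <= `|z|.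
Proof.
case: z => a b; rewrite normc_def lecR /= -sqrtr_sqr.
by rewrite ler_sqrt ?sqr_ge0 ?addr_ge0 ?sqr_ge0 // lerDr sqr_ge0.
Qed.

Let norm_box (M : R) (z : C) : `|z| <= ofR M -> box M z.
Proof.
move=> zM; split; rewrite -lecR.
  exact: le_trans (normc_ge_Re _) zM.
exact: le_trans (Im_le _) zM.
Qed.

Let box_norm (M : R) (z : C) : ~ box M z -> ofR M < `|z|.
Proof.
move=> nz; rewrite /ofR real_ltNge ?complex_real ?normr_real //.
  by apply/negP => /norm_box.
Qed.

Let complex_open_neq (y : C) : open [set x : C | x != y].
Proof.
have -> : [set x : C | x != y] = ~` [set y].
  by apply/seteqP; split=> x /= /eqP.
apply/closed_openC/accessible_closed_set1/hausdorff_accessible.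
exact: norm_hausdorff.
Qed.

Let complex_locally_compact : locally_compact [set: C].
Proof.
move=> z _; rewrite withinET.
case: z => a b; have [r _ zr] : exists2 r, 0 < r & `|Complex a b : C| + 1 = ofR r.
  by apply: gt0_ofR; rewrite ltr_wpDl.
exists (box r); last first.
  split; first exact: box_compact.
  by apply: compact_closed; [exact: norm_hausdorff | exact: box_compact].
apply: (@filterS _ _ _ [set z : C | `|z| < `|Complex a b : C| + 1]).
  by move=> z /= /ltW; rewrite zr => /norm_box.
have /cvgr_norm_lt : @id C @ (Complex a b : C) --> (Complex a b : C) by exact: cvg_id.
by apply; rewrite ltrDl.
Qed.

Lemma sphere_hausdorff : hausdorff_space opc.
Proof.
apply: one_point_compactification_hausdorff complex_locally_compact _.
exact: norm_hausdorff.
Qed.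

Let ofR_continuous : continuous (ofR : R -> C).
Proof.
move=> t; apply/cvgrPdist_lt => _ /gt0_ofR[e e0 ->].
near=> x; rewrite /ofR -rmorphB normc_def /= expr0n addr0 sqrtr_sqr ltcR.
by near: x; apply: cvgr_dist_lt => //; exact: cvg_id.
Unshelve. all: by end_near. Qed.

Let complex_connected : connected [set: C].
Proof.
have -> : [set: C] = \bigcup_(z in [set: C])
   ((fun t : R => ofR t * z : C) @` `[0, 1]%classic).
  apply/seteqP; split=> // z _; exists z => //; exists 1; rewrite ?mul1r //=.
  by rewrite in_itv /= ler01 lexx.
apply: bigcup_connected.
  exists 0 => z _; exists 0; rewrite ?mul0r //=.
  by rewrite in_itv /= ler01 lexx.
move=> z _; apply: connected_continuous_connected; first exact: segment_connected.
apply/continuous_subspaceT => t.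
apply: cvgM; last exact: cvg_cst.
exact: ofR_continuous.
Qed.

Let compact_inv (K : set C) : compact K ->
  \forall w \near (0 : C), forall z, K z -> w * z != 1.
Proof.
move=> /compact_near_coveringP cK; apply: (cK C (nbhs (0 : C)) (fun w z => w * z != 1)).
move=> z _.
have : (fun p : C * C => p.2 * p.1) @ (z, 0 : C) --> (0 : C).
  rewrite -[X in _ --> X](mul0r z).
  by apply: cvgM; [exact: cvg_snd | exact: cvg_fst].
move=> /(_ [set y | y != 1]); apply.
apply: open_nbhs_nbhs; split; last by rewrite /= eq_sym oner_neq0.
exact: complex_open_neq.
Qed.

Let complex_not_compact (K : set C) : compact K -> exists z, ~ K z.
Proof.
move=> cK; suff [w w0 wK] : exists2 w : C, w != 0 & forall z, K z -> w * z != 1.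
  by exists w^-1 => /wK; rewrite divff ?eqxx.
have : \forall w \near (0 : C)^', w != 0 /\ forall z, K z -> w * z != 1.
  apply: filterI; first exact: withinT.
  exact: cvg_within (compact_inv cK).
have PF : ProperFilter (0 : C)^' by exact: Proper_dnbhs_numFieldType.
by move=> /(@filter_ex _ _ PF)[w [w0 wK]]; exists w.
Qed.

Lemma sphere_connected : connected [set: opc].
Proof.
have -> : [set: opc] = closure ((Some : C -> opc) @` [set: C]).
  apply/seteqP; split=> // -[z|] _; first by apply: subset_closure; exists z.
  move=> U [K [/complex_not_compact [z Kz] _]] KU; exists (Some z); split.
    by exists z.
  by apply: KU; left; exists z.
apply: connected_closure; apply: connected_continuous_connected.
  exact: complex_connected.
apply: continuous_subspaceT.
exact: one_point_compactification_some_continuous.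
Qed.

Lemma sphere_nonempty : [set: opc] !=set0. Proof. by exists None. Qed.

Lemma sphere_dom_open b : open (sphere_dom b).
Proof.
by case: b; apply/closed_openC/accessible_closed_set1/hausdorff_accessible;
  exact: sphere_hausdorff.
Qed.

Lemma sphere_codom_open b : open (sphere_chart b @` sphere_dom b).
Proof.
suff -> : sphere_chart b @` sphere_dom b = setT by exact: openT.
apply/seteqP; split=> // z _; case: b; last by exists (Some z).
have [->|z0] := eqVneq z 0; first by exists None.
exists (Some z^-1); rewrite /= ?invrK // => -[] /eqP.
by rewrite invr_eq0 (negbTE z0).
Qed.

Lemma sphere_cover p : exists b, sphere_dom b p.
Proof. by case: p => [z|]; [exists false|exists true]. Qed.
Lemma sphere_chartK b p : sphere_dom b p ->
  sphere_chart_inv b (sphere_chart b p) = p.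
Proof.
case: b p => [] [z|] //= zN; rewrite /sphere_chart_inv ?eqxx //.
by rewrite invr_eq0 invrK; case: eqP zN => // -> /(_ erefl).
Qed.
Lemma sphere_chart_continuous b p : sphere_dom b p ->
  {for p, continuous (sphere_chart b)}.
Proof.
case: b p => [] [z|] //= z0.
- have {}z0 : z != 0 by apply: contra_notN z0 => /eqP ->.
  exact: (inv_continuous z0).
- move=> U /nbhs_ballP[e /= /gt0_ofR[r r0 ->{e}]] rU.
  exists (box r^-1).
    split; first exact: box_compact.
    by apply: compact_closed; [exact: norm_hausdorff | exact: box_compact].
  move=> _ [[z /box_norm rz <-]|->] /=; apply: rU; last first.
    by apply: ballxx; rewrite /ofR ltcR.
  have rV0 : 0 < ofR r^-1 by rewrite /ofR ltcR invr_gt0.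
  have z0' : 0 < `|z| := lt_trans rV0 rz.
  rewrite -ball_normE /= sub0r normrN normrV ?unitfE -?normr_gt0 //.
  rewrite -[r]invrK /ofR fmorphV ltf_pV2 ?posrE //.
- by move=> U zU; exact: zU.
Qed.

Lemma sphere_chart_inv_continuous b p : sphere_dom b p ->
  {for sphere_chart b p, continuous (sphere_chart_inv b)}.
Proof.
case: b p => [] [z|] //= z0.
- have {}z0 : z != 0 by apply: contra_notN z0 => /eqP ->.
  have zV0 : z^-1 != 0 by rewrite invr_eq0.
  move=> U; rewrite /sphere_chart_inv (negbTE zV0) => UV.
  have UV' : nbhs (z^-1 : C) [set w : C | U (Some w^-1)].
    exact: (@inv_continuous R[i] _ zV0 _ UV).
  have zN : nbhs z^-1 [set w : C | w != 0].
    by apply: open_nbhs_nbhs; split=> //; exact: complex_open_neq.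
  rewrite nbhs_simpl /=; apply: filterS (@filterI C (nbhs (z^-1 : C)) _ _ _ zN UV') => w [/= w0].
  by rewrite (negbTE w0).
- move=> U; rewrite /sphere_chart_inv eqxx => -[K [cK _] KU].
  apply: filterS (compact_inv cK) => w wK; apply: KU => /=.
  have [w0|w0] := eqVneq w 0; first by right.
  by left; exists w^-1 => // /wK; rewrite divff ?eqxx.
- exact: one_point_compactification_some_continuous.
Qed.

Let inv_derivable (z : C) : z != 0 -> derivable (@GRing.inv C : C -> C) z 1.
Proof.
move=> z0; apply: (@derivableV C C id z 1 z0); exact: derivable_id.
Qed.

Lemma sphere_transition b c p : sphere_dom b p -> sphere_dom c p ->
  derivable (sphere_chart c \o sphere_chart_inv b) (sphere_chart b p) 1.
Proof.
have invE : sphere_chart true \o sphere_chart_inv false = @GRing.inv C by [].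
have invE' : sphere_chart false \o sphere_chart_inv true = @GRing.inv C.
  apply/funext => z; rewrite /= /sphere_chart_inv.
  by case: eqP => //= ->; rewrite invr0.
have idE d : sphere_chart d \o sphere_chart_inv d = @id C.
  apply/funext => z; case: d; rewrite //= /sphere_chart_inv.
  by case: eqP => [->|_] //=; rewrite invrK.
case: b; case: c; rewrite ?idE ?invE ?invE' => pb pc.
- exact: derivable_id.
- case: p pb pc => [z|//] z0 _ /=; apply: inv_derivable.
  by rewrite /= invr_eq0; apply: contra_notN z0 => /eqP ->.
- case: p pb pc => [z|//] _ z0 /=; apply: inv_derivable.
  by apply: contra_notN z0 => /eqP ->.
- exact: derivable_id.
Qed.

Definition CP1 : riemannSurface R :=
  RiemannSurface sphere_hausdorff sphere_connected sphere_nonempty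
    sphere_dom_open sphere_codom_open sphere_cover sphere_chartK
    sphere_chart_continuous sphere_chart_inv_continuous sphere_transition.

Lemma CP1_compact : compact [set: CP1].
Proof. exact: one_point_compactification_compact. Qed.

End RiemannSphere.

(* Main.v *)
(** Let h be the conjugate of f o sigma, again a meromorphic function of degree d.
    After generic changes of coordinate on the sphere, put F = 1 / (f - a) and
    H = conj (1 / (f o sigma - b)), and consider the discriminant
    D(x) = prod over q <> q' in the fibre F^-1(x) of (H q - H q').
    It is holomorphic away from the critical values of F and from the images of the
    poles of H, and a meromorphic function with at most 2 d (d - 1) poles.
    The critical points of f are fixed by sigma, so at each of them, say p, F and H
    have the same order, and H q - H p - c (F q - F p) = o(F q - F p) for some c.
    Two sheets meet at p, so with x0 = F p we get D = o((x - x0)^2) and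
    hence D = O((x - x0)^3) at each of the 2 d - 2 + 2 g critical values.  The bound on
    g says exactly that 3 (2 d - 2 + 2 g) > 2 d (d - 1), so D = 0.
    Thus H takes each of its values k >= 2 times on the generic fibre of F, where k does
    not depend on the fibre because the curve is connected.  As k divides the prime d,
    k = d: H is constant on the fibres of F, and sigma descends to the sphere. *)
Require Import Defs.
From mathcomp Require Import all_boot all_order all_algebra.
From mathcomp Require Import complex ring lra zify.
From mathcomp Require Import all_classical all_reals all_analysis.
Set Implicit Arguments.
Unset Strict Implicit.
Unset Printing Implicit Defensive.
Import Order.TTheory GRing.Theory Num.Theory.
Import numFieldNormedType.Exports.
Local Open Scope classical_set_scope.
Local Open Scope ring_scope.

(** * Complex analysis *)

(** The conjugation makes [H] holomorphic where it is finite, so [D] depends on one complex variable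
    only. Generic a and b separate the difficulties: critical points have finite values of F, while
    the poles of H are simple and lie neither over critical values nor over infinity. Each of the d
    poles of H enters 2 (d - 1) factors of D, whence 2 d (d - 1). Reality raises the order of
    vanishing from one to three. At a point where x - x0 = t^2, the sheets are t and -t, and a
    general H would differ by O(t) between them; equal orders force O(t^3), and the pair counts in
    both orders. Instead of fractional power series, the proof bounds D by o((x - x0)^2) and gains
    the last order from a removable singularity, whatever the order of the critical point. That D =
    0 only says that some two points of a fibre collide. Coincidences are therefore counted from a
    point of the curve: constancy of that count along the connected curve makes all classes of equal
    values in a fibre equally large, which is where primality of d can act. *)

Section Modulus.
Context {R : realType}.
Local Notation C := (Cplx R).
Implicit Types z w : C.

(** Norms in [R[i]] are themselves elements of [R[i]]; a real-valued modulus lets [lra] and [nra]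
    handle the estimates. *)
Definition nm (z : C) : R := complex.Re `|z|.

Lemma nmE z : `|z| = (nm z)%:C%C.
Proof. by apply/esym/RRe_real; rewrite realE normr_ge0. Qed.

Lemma nm_ge0 z : 0 <= nm z.
Proof. by rewrite -lecR -nmE normr_ge0. Qed.

Lemma nmM z w : nm (z * w) = nm z * nm w.
Proof. by apply: complexI; rewrite /= rmorphM /= -!nmE normrM. Qed.

Lemma nmD z w : nm (z + w) <= nm z + nm w.
Proof. by rewrite -lecR rmorphD /= -!nmE ler_normD. Qed.

Lemma nmN z : nm (- z) = nm z.
Proof. by rewrite /nm normrN. Qed.

Lemma nmC z w : nm (z - w) = nm (w - z).
Proof. by rewrite -nmN opprB. Qed.

Lemma nmB z w : nm (z - w) <= nm z + nm w.
Proof. by rewrite -[nm w]nmN nmD. Qed.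

Lemma nm0 : nm 0 = 0. Proof. by rewrite /nm normr0. Qed.
Lemma nm1 : nm 1 = 1. Proof. by rewrite /nm normr1. Qed.

Lemma nm_eq0 z : (nm z == 0) = (z == 0).
Proof.
by rewrite -[RHS]normr_eq0 nmE -(inj_eq (@complexI R)).
Qed.

Lemma nm_gt0 z : (0 < nm z) = (z != 0).
Proof. by rewrite lt_def nm_ge0 andbT nm_eq0. Qed.

Lemma nmV z : nm z^-1 = (nm z)^-1.
Proof. by apply: complexI; rewrite fmorphV -!nmE normfV. Qed.

Lemma nmX z n : nm (z ^+ n) = nm z ^+ n.
Proof. by elim: n => [|n IH]; rewrite ?expr0 ?nm1 // !exprS nmM IH. Qed.

Lemma nm_real (x : R) : nm x%:C%C = `|x|.
Proof. by rewrite /nm normc_def /= expr0n addr0 sqrtr_sqr. Qed.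

Lemma nm_def z : nm z = Num.sqrt (complex.Re z ^+ 2 + complex.Im z ^+ 2).
Proof. by rewrite /nm normc_def. Qed.

Lemma ler_Re_nm z : `|complex.Re z| <= nm z.
Proof.
by rewrite nm_def -sqrtr_sqr ler_sqrt ?addr_ge0 ?sqr_ge0 // lerDl sqr_ge0.
Qed.

Lemma ler_Im_nm z : `|complex.Im z| <= nm z.
Proof.
by rewrite nm_def -sqrtr_sqr ler_sqrt ?addr_ge0 ?sqr_ge0 // lerDr sqr_ge0.
Qed.

Lemma nm_le_ReIm z : nm z <= `|complex.Re z| + `|complex.Im z|.
Proof.
rewrite nm_def -[leRHS]ger0_norm ?addr_ge0 // -sqrtr_sqr ler_sqrt ?sqr_ge0 //.
rewrite sqrrD !real_normK ?num_real // -addrA lerD2l lerDr.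
by rewrite mulrn_wge0 // mulr_ge0.
Qed.

Lemma nm_triangle w z t : nm (z - t) <= nm (z - w) + nm (w - t).
Proof. by apply: le_trans (nmD _ _); rewrite addrA subrK. Qed.

Lemma nm_lb z w : nm z - nm w <= nm (z - w).
Proof. by rewrite lerBlDr; apply: le_trans (nmD _ _); rewrite subrK. Qed.

Lemma nm_prod I (r : seq I) (P : pred I) (F : I -> C) :
  nm (\prod_(i <- r | P i) F i) = \prod_(i <- r | P i) nm (F i).
Proof. by apply: big_morph; [exact: nmM | exact: nm1]. Qed.

Lemma gt0_nm (e : C) : 0 < e -> exists2 r : R, 0 < r & e = r%:C%C.
Proof.
move=> e0; exists (nm e); first by rewrite nm_gt0 gt_eqF.
by rewrite -nmE ger0_norm // ltW.
Qed.

(* Filters and limits of the plane are wrapped, because unification through the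
   several canonical structures on R[i] is expensive. *)
Definition cnbhs (z : C) : set_system C := nbhs z.

Global Instance cnbhs_filter z : Filter (cnbhs z).
Proof. exact: (@nbhs_filter C). Qed.

Lemma cnbhsP z (A : set C) :
  cnbhs z A <-> exists2 e : R, 0 < e & forall w, nm (w - z) < e -> A w.
Proof.
split=> [/nbhs_ballP[_ /= /gt0_nm[e e0 ->]] zA|[e e0 eA]].
  exists e => // w wz; apply: zA; rewrite -ball_normE /= nmE ltcR.
  by rewrite nmC.
apply/nbhs_ballP; exists e%:C%C; first by rewrite /= ltcR.
by move=> w; rewrite -ball_normE /= nmE ltcR nmC; exact: eA.
Qed.

Definition tends {T} (F : set_system T) (u : T -> C) (a : C) :=
  forall e : R, 0 < e -> \forall x \near F, nm (u x - a) < e.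

Lemma tendsP {T} (F : set_system T) {FF : Filter F} (u : T -> C) (a : C) :
  tends F u a <-> u @ F --> a.
Proof.
split=> [fl|/cvgrPdist_lt fl e e0].
  apply/cvgrPdist_lt => _ /gt0_nm[e e0 ->].
  by move: (fl e e0); apply: filterS => x; rewrite nmE ltcR nmC.
have := fl e%:C%C; rewrite ltcR => /(_ e0).
by apply: filterS => x; rewrite nmE ltcR nmC.
Qed.

Lemma near_nm z (e : R) : 0 < e -> \forall w \near cnbhs z, nm (w - z) < e.
Proof. by move=> e0; apply/cnbhsP; exists e. Qed.

Lemma near_neq z w : z != w -> \forall x \near cnbhs z, x != w.
Proof.
move=> zw; apply/cnbhsP; exists (nm (z - w)); first by rewrite nm_gt0 subr_eq0.
by move=> x; apply: contraTneq => ->; rewrite nmC ltxx.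
Qed.

Lemma cnbhs_singleton z (A : set C) : cnbhs z A -> A z.
Proof. by move=> /cnbhsP[e e0]; apply; rewrite subrr nm0. Qed.

Lemma cnbhs_nbhs z (A : set C) : cnbhs z A -> \forall w \near cnbhs z, cnbhs w A.
Proof. exact: (@nbhs_interior C). Qed.

Section Limits.
Context {T : Type} (F : set_system T) {FF : Filter F}.
Implicit Types (u v : T -> C) (a b : C).

Lemma tends_cst a : tends F (fun=> a) a.
Proof. by move=> e e0; apply: nearW => x; rewrite subrr nm0. Qed.

Lemma tendsD u v a b : tends F u a -> tends F v b ->
  tends F (fun x => u x + v x) (a + b).
Proof.
move=> ua vb e e0; have e2 : 0 < e / 2 by rewrite divr_gt0.
apply: filterS2 (ua _ e2) (vb _ e2) => x xa xb.
by rewrite opprD addrACA [e]splitr; apply: le_lt_trans (nmD _ _) (ltrD xa xb).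
Qed.

Lemma tendsN u a : tends F u a -> tends F (fun x => - u x) (- a).
Proof.
by move=> ua e /ua; apply: filterS => x; rewrite -opprD nmN.
Qed.

Lemma tendsB u v a b : tends F u a -> tends F v b ->
  tends F (fun x => u x - v x) (a - b).
Proof. by move=> ua /tendsN; exact: tendsD. Qed.

Lemma tendsM u v a b : tends F u a -> tends F v b ->
  tends F (fun x => u x * v x) (a * b).
Proof.
move=> ua vb e e0; pose k := 1 + nm a + nm b.
have k0 : 0 < k by rewrite /k; have := nm_ge0 a; have := nm_ge0 b; lra.
pose d := Num.min 1 (e / k).
have d0 : 0 < d by rewrite lt_min ltr01 divr_gt0.
have d1 : d <= 1 by rewrite ge_min lexx.
have dk : d * k <= e by rewrite -ler_pdivlMr // ge_min lexx orbT.
apply: filterS2 (ua _ d0) (vb _ d0) => x xa xb.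
have -> : u x * v x - a * b = (u x - a) * (v x - b) + (u x - a) * b + a * (v x - b).
  by ring.
apply: le_lt_trans (nmD _ _) _; apply: le_lt_trans (lerD (nmD _ _) (lexx _)) _.
rewrite !nmM; move: (nm_ge0 (u x - a)) (nm_ge0 (v x - b)) (nm_ge0 a) (nm_ge0 b).
move: xa xb dk; rewrite /k.
move: (nm (u x - a)) (nm (v x - b)) (nm a) (nm b) => s t p q; nra.
Qed.

Lemma tendsV u a : a != 0 -> tends F u a -> tends F (fun x => (u x)^-1) a^-1.
Proof.
move=> a0 /tendsP ua; apply/tendsP.
exact: (@cvgV R[i] T F FF u a).
Qed.

Lemma tends_neq u a b : a != b -> tends F u a -> \forall x \near F, u x != b.
Proof.
move=> ab /(_ (nm (a - b))); rewrite nm_gt0 subr_eq0 => /(_ ab).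
by apply: filterS => x; apply: contraTneq => ->; rewrite nmC ltxx.
Qed.

Lemma tends_near_eq u v a : (\forall x \near F, u x = v x) ->
  tends F u a -> tends F v a.
Proof. by move=> uv ua e e0; apply: filterS2 uv (ua e e0) => x ->. Qed.

Lemma tends_comp (f : C -> C) u a b : tends (cnbhs a) f b -> tends F u a ->
  tends F (f \o u) b.
Proof.
move=> fb ua e e0; have /cnbhsP[d d0 dP] := fb e e0.
by apply: filterS (ua d d0) => x; exact: dP.
Qed.

End Limits.

Lemma tends_uniq {T} (F : set_system T) {FF : ProperFilter F} (u : T -> C) (a b : C) :
  tends F u a -> tends F u b -> a = b.
Proof.
move=> /tendsP ua /tendsP ub.
exact: (@cvg_unique C (@norm_hausdorff _ C) _ _ _ _ ua ub).
Qed.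

Lemma tends_id z : tends (cnbhs z) id z.
Proof. by move=> e e0; exact: near_nm. Qed.

Definition pnbhs (z : C) : set_system C := (z : C)^'.

Global Instance pnbhs_filter z : ProperFilter (pnbhs z).
Proof. exact: Proper_dnbhs_numFieldType. Qed.

Lemma pnbhsP z (A : set C) :
  pnbhs z A <-> exists2 e : R, 0 < e & forall w, nm (w - z) < e -> w != z -> A w.
Proof.
have -> : pnbhs z A = cnbhs z (fun w => w != z -> A w).
  by rewrite /pnbhs /dnbhs /within.
exact: cnbhsP.
Qed.

Lemma cnbhsI z (A B : set C) : cnbhs z A -> cnbhs z B -> cnbhs z (A `&` B).
Proof. exact: filterI. Qed.

Lemma pnbhsI z (A B : set C) : pnbhs z A -> pnbhs z B -> pnbhs z (A `&` B).
Proof. exact: filterI. Qed.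

Lemma pnbhs_cnbhs z (A : set C) : cnbhs z A -> pnbhs z A.
Proof. by move=> /cnbhsP[e e0 eA]; apply/pnbhsP; exists e => // w /eA. Qed.

Lemma tends_pnbhs z (u : C -> C) a : tends (cnbhs z) u a -> tends (pnbhs z) u a.
Proof. by move=> ua e /ua /pnbhs_cnbhs. Qed.

End Modulus.

(** * Complex derivatives and conjugation *)

Section ComplexDerivative.
Context {R : realType}.
Local Notation C := (Cplx R).
Implicit Types (z w l : C) (f g : C -> C).

(** Caratheodory's form of the derivative: the slope [phi] is defined at [z] too and continuous
    there. The chain, product and quotient rules become identities between slopes. *)
Definition cder f z l := exists phi : C -> C,
  [/\ tends (cnbhs z) phi (phi z), phi z = l &
    forall w, f w = f z + phi w * (w - z)].

Lemma cder_continuous f z l : cder f z l -> tends (cnbhs z) f (f z).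
Proof.
move=> [phi [cphi _ fE]].
have : tends (cnbhs z) (fun w => f z + phi w * (w - z)) (f z + phi z * (z - z)).
  apply: tendsD; first exact: tends_cst.
  apply: tendsM; first exact: cphi.
  by apply: tendsB; [exact: tends_id | exact: tends_cst].
rewrite subrr mulr0 addr0; apply: tends_near_eq.
by apply: nearW => w; rewrite -fE.
Qed.

Lemma cder_near f g z l : (\forall w \near cnbhs z, f w = g w) ->
  cder f z l -> cder g z l.
Proof.
move=> fg [phi [cphi <- fE]].
have fgz := cnbhs_singleton fg.
exists (fun w => if w == z then phi z else (g w - g z) / (w - z)); split.
- rewrite eqxx; apply: tends_near_eq cphi; apply: filterS fg => w fgw.
  case: eqP => [->//|/eqP wz].
  by rewrite -fgw -fgz fE addrAC subrr add0r mulfK // subr_eq0.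
- by rewrite eqxx.
- move=> w; case: eqP => [->|/eqP wz]; first by rewrite subrr mulr0 addr0.
  by rewrite divfK ?subr_eq0 // addrCA subrr addr0.
Qed.

Lemma cder_id z : cder id z 1.
Proof.
exists (fun=> 1); split.
- exact: tends_cst.
- by [].
- by move=> w; rewrite mul1r addrCA subrr addr0.
Qed.

Lemma cder_cst (c : C) z : cder (fun=> c) z 0.
Proof.
exists (fun=> 0); split.
- exact: tends_cst.
- by [].
- by move=> w; rewrite mul0r addr0.
Qed.

Lemma cderD f g z l m : cder f z l -> cder g z m ->
  cder (fun w => f w + g w) z (l + m).
Proof.
move=> [p [cp <- fE]] [q [cq <- gE]]; exists (fun w => p w + q w); split.
- exact: tendsD.
- by [].
- by move=> w; rewrite fE gE mulrDl addrACA.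
Qed.

Lemma cderM f g z l m : cder f z l -> cder g z m ->
  cder (fun w => f w * g w) z (l * g z + f z * m).
Proof.
move=> df [q [cq <- gE]]; have cf := cder_continuous df.
case: df => [p [cp <- fE]].
exists (fun w => p w * g z + f w * q w); split.
- by apply: tendsD; apply: tendsM => //; exact: tends_cst.
- by [].
- move=> w; rewrite {1}gE mulrDr {1}fE; ring.
Qed.

Lemma cderN f z l : cder f z l -> cder (fun w => - f w) z (- l).
Proof.
move=> [p [cp <- fE]]; exists (fun w => - p w); split.
- exact: tendsN.
- by [].
- by move=> w; rewrite fE mulNr opprD.
Qed.

Lemma cderB f g z l m : cder f z l -> cder g z m ->
  cder (fun w => f w - g w) z (l - m).
Proof. by move=> df /cderN; exact: cderD. Qed.

Lemma cderV f z l : f z != 0 -> cder f z l ->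
  cder (fun w => (f w)^-1) z (- l / f z ^+ 2).
Proof.
move=> fz0 df; have cf := cder_continuous df.
have nf : \forall w \near cnbhs z, f w != 0 by exact: tends_neq cf.
case: df => [p [cp <- fE]].
pose g w := (f z)^-1 - p w / (f w * f z) * (w - z).
apply: (@cder_near g).
  apply: filterS nf => w fw0.
  have e : p w * (w - z) = f w - f z by rewrite [f w]fE addrAC subrr add0r.
  rewrite /g mulrAC e; field; rewrite fz0 fw0 //.
exists (fun w => - p w / (f w * f z)); split.
- apply: tendsM; first exact: tendsN.
  apply: tendsV; first by rewrite mulf_neq0.
  by apply: tendsM; [exact: cf | exact: tends_cst].
- by rewrite expr2.
- by move=> w; rewrite /g subrr mulr0 subr0 !mulNr.
Qed.

Lemma cder_comp f g z l m : cder g z m -> cder f (g z) l ->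
  cder (f \o g) z (l * m).
Proof.
move=> dg [p [cp <- fE]]; have cg := cder_continuous dg.
case: dg => [q [cq <- gE]].
exists (fun w => p (g w) * q w); split.
- by apply: tendsM; [exact: (tends_comp cp) | exact: cq].
- by [].
- move=> w; have e : g w - g z = q w * (w - z) by rewrite gE addrAC subrr add0r.
  by rewrite /= fE e mulrA.
Qed.

Lemma cderX f z l n : cder f z l ->
  cder (fun w => f w ^+ n) z (n%:R * f z ^+ n.-1 * l).
Proof.
move=> df; elim: n => [|n IH].
  by rewrite !mul0r; exact: cder_cst.
have := cderM df IH; have -> : n.+1%:R * f z ^+ n.+1.-1 * l =
    l * f z ^+ n + f z * (n%:R * f z ^+ n.-1 * l).
  case: n {IH} => [|n] /=; first by rewrite expr0; ring.
  rewrite [f z ^+ n.+1]exprS -[n.+2]addn1 natrD; ring.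
by apply: cder_near; apply: nearW => w; rewrite exprS.
Qed.

Lemma cderZ c f z l : cder f z l -> cder (fun w => c * f w) z (c * l).
Proof. by move=> /(cderM (cder_cst c z)); rewrite mul0r add0r. Qed.

Definition cj (z : C) : C := (z^*)%C.

Lemma cjK : involutive cj. Proof. exact: conjcK. Qed.
Lemma cjD z w : cj (z + w) = cj z + cj w. Proof. exact: rmorphD. Qed.
Lemma cjB z w : cj (z - w) = cj z - cj w. Proof. exact: rmorphB. Qed.
Lemma cjM z w : cj (z * w) = cj z * cj w. Proof. exact: rmorphM. Qed.

Lemma cjX z n : cj (z ^+ n) = cj z ^+ n. Proof. exact: rmorphXn. Qed.

Lemma nm_cj z : nm (cj z) = nm z.
Proof. by rewrite !nm_def; case: z => a b /=; rewrite sqrrN. Qed.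

Lemma cj_eq0 z : (cj z == 0) = (z == 0).
Proof. by rewrite -nm_eq0 nm_cj nm_eq0. Qed.

Lemma tends_cj {T} (F : set_system T) {FF : Filter F} (f : T -> C) l :
  tends F f l -> tends F (cj \o f) (cj l).
Proof.
by move=> fl e /fl; apply: filterS => x; rewrite /= -cjB nm_cj.
Qed.

Lemma cder_conj f z l : cder f (cj z) l -> cder (cj \o f \o cj) z (cj l).
Proof.
move=> [p [cp <- fE]]; exists (cj \o p \o cj); split.
- apply: (@tends_cj _ _ _ (p \o cj)); apply: tends_comp cp _.
  by apply: (@tends_cj _ _ _ id); exact: tends_id.
- by [].
- by move=> w /=; rewrite fE cjD cjM cjB !cjK.
Qed.

Lemma cder_uniq f z l m : cder f z l -> cder f z m -> l = m.
Proof.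
move=> [p [cp <- fE]] [q [cq <- gE]].
apply: (tends_uniq (tends_pnbhs cp)).
apply: tends_near_eq (tends_pnbhs cq).
apply/pnbhsP; exists 1 => // w _ wz.
apply: (mulIf (_ : w - z != 0)); first by rewrite subr_eq0.
by apply: (addrI (f z)); rewrite -gE -fE.
Qed.

Lemma cder_derivable f z l : cder f z l -> derivable f z 1 /\ derive1 f z = l.
Proof.
move=> [p [cp pz fE]].
have /tendsP lim : tends (pnbhs 0) (fun h => h^-1 *: ((f \o shift z) (h *: 1) - f z)) (p z).
  move=> e e0; have /cnbhsP[r r0 rP] := cp e e0.
  apply/pnbhsP; exists r => // h hr h0.
  rewrite /= /GRing.scale /= mulr1 fE addrK addrAC subrr add0r mulrC mulfK //.
  by apply: rP; rewrite addrK -[h]subr0.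
split; first by apply/cvg_ex; exists (p z).
rewrite derive1E -pz; apply: (@cvg_lim C (@norm_hausdorff _ C)); exact: lim.
Qed.

Lemma derivable_cder f z : derivable f z 1 -> cder f z (derive1 f z).
Proof.
move=> df; exists (fun w => if w == z then derive1 f z else (f w - f z) / (w - z)); split.
+ rewrite eqxx => e e0; have /tendsP := df => /(_ e e0) /pnbhsP[r r0 rP].
  apply/cnbhsP; exists r => //.
  move=> w wz; case: eqP => [_|/eqP wz0]; first by rewrite subrr nm0.
  have := rP (w - z); rewrite subr0 => /(_ wz); rewrite subr_eq0 => /(_ wz0).
  by rewrite /= /GRing.scale /= mulr1 subrK mulrC derive1E.
+ by rewrite eqxx.
+ move=> w; case: eqP => [->|/eqP wz]; first by rewrite subrr mulr0 addr0.
  by rewrite divfK ?subr_eq0 // addrCA subrr addr0.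
Qed.

End ComplexDerivative.

(** * Derivatives and primitives along a real parameter *)

Section RealParameter.
Context {R : realType}.
Local Notation C := (Cplx R).
Implicit Types (F G U : R -> C) (x y a b : R) (l m : C).

Lemma rnbhsP x (A : set R) :
  nbhs x A <-> exists2 e : R, 0 < e & forall y, `|y - x| < e -> A y.
Proof.
split=> [/nbhs_ballP[e /= e0 eA]|[e e0 eA]].
  by exists e => // y yx; apply: eA; rewrite -ball_normE /= distrC.
by apply/nbhs_ballP; exists e => // y; rewrite -ball_normE /= distrC; exact: eA.
Qed.

Lemma is_deriveP (g : R -> R) x (l : R) : is_derive x 1 g l <->
  forall e, 0 < e -> \forall y \near x, `|g y - g x - l * (y - x)| <= e * `|y - x|.
Proof.
have key h y : h = y - x -> h != 0 ->
    `|h^-1 *: ((g \o shift x) (h *: 1) - g x) - l| * `|y - x| =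
    `|g y - g x - l * (y - x)|.
  move=> hE h0; rewrite -normrM /= /GRing.scale /= mulr1 hE subrK mulrBl.
  by rewrite mulrAC mulVf -?hE // mul1r.
split=> [dg e e0|H].
- have [dv dE] := dg; rewrite /derivable in dv; rewrite /derive in dE.
  move: dv => /cvg_ex[l' dl].
  have ll : l' = l by rewrite -dE; apply/esym/cvg_lim; [exact: norm_hausdorff|].
  move: dl; rewrite ll => /cvgrPdist_lt /(_ e e0); rewrite near_withinE => /rnbhsP[r r0 rP].
  apply/rnbhsP; exists r => // y yx.
  have [->|yx0] := eqVneq y x; first by rewrite !subrr mulr0 subr0 normr0 mulr0.
  have h0 : y - x != 0 by rewrite subr_eq0.
  rewrite -(key (y - x)) // ler_wpM2r // distrC ltW //.
  by apply: rP; rewrite ?subr0.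
- suff L : h^-1 *: ((g \o shift x) (h *: 1) - g x) @[h --> 0^'] --> l.
    by split; [apply/cvg_ex; exists l | apply: cvg_lim L; exact: norm_hausdorff].
  apply/cvgrPdist_lt => e e0.
  have e2 : 0 < e / 2 by rewrite divr_gt0.
  have /rnbhsP[r r0 rP] := H _ e2.
  rewrite near_withinE; apply/rnbhsP; exists r => // h; rewrite subr0 => hr h0.
  have := rP (h + x); rewrite addrK => /(_ hr).
  have := key h (h + x); rewrite addrK => /(_ erefl h0) <-.
  rewrite ler_pM2r ?normr_gt0 // distrC => le; apply: le_lt_trans le _.
  by rewrite gtr_pMr // invf_lt1 // ltr1n.
Qed.

(** The analogue of [cder] for a curve in the plane with a real parameter. *)
Definition rder F x l := exists phi : R -> C,
  [/\ tends (nbhs x) phi (phi x), phi x = l &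
    forall y, F y = F x + phi y * (y - x)%:C%C].

Lemma rderP F x l : rder F x l <->
  forall e : R, 0 < e -> \forall y \near x,
    nm (F y - F x - l * (y - x)%:C%C) <= e * `|y - x|.
Proof.
split=> [[phi [cphi <- FE]] e e0|H].
  apply: filterS (cphi e e0) => y ye.
  rewrite [F y]FE [_ - F x]addrAC subrr add0r -mulrBl nmM nm_real.
  by rewrite ler_wpM2r // ltW.
exists (fun y => if y == x then l else (F y - F x) / (y - x)%:C%C); split.
- rewrite eqxx => e e0; have e2 : 0 < e / 2 by rewrite divr_gt0.
  apply: filterS (H _ e2) => y yP; case: eqP => [_|/eqP yx].
    by rewrite subrr nm0.
  have yx0 : 0 < `|y - x| by rewrite normr_gt0 subr_eq0.
  have yxC : (y - x)%:C%C != 0 :> C by rewrite -nm_gt0 nm_real.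
  rewrite -(ltr_pM2r yx0) -[`|y - x| in ltLHS]nm_real -nmM mulrBl divfK //.
  by apply: le_lt_trans yP _; rewrite ltr_pM2r // ltr_pdivrMr // ltr_pMr // ltr1n.
- by rewrite eqxx.
- move=> y; case: eqP => [->|/eqP yx]; first by rewrite subrr mulr0 addr0.
  have yxC : (y - x)%:C%C != 0 :> C by rewrite -nm_gt0 nm_real normr_gt0 subr_eq0.
  by rewrite divfK // addrCA subrr addr0.
Qed.

Lemma rder_continuous F x l : rder F x l -> tends (nbhs x) F (F x).
Proof.
move=> [phi [cphi _ FE]].
have : tends (nbhs x) (fun y => F x + phi y * (y - x)%:C%C) (F x + phi x * (x - x)%:C%C).
  apply: tendsD; first exact: tends_cst.
  apply: tendsM; first exact: cphi.
  move=> e e0; apply/rnbhsP; exists e => // y yx.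
  by rewrite subrr subr0 nm_real.
rewrite subrr mulr0 addr0; apply: tends_near_eq.
by apply: nearW => y; rewrite -FE.
Qed.

Lemma rder_cst (c : C) x : rder (fun=> c) x 0.
Proof.
exists (fun=> 0); split.
- exact: tends_cst.
- by [].
- by move=> y; rewrite mul0r addr0.
Qed.

Lemma rder_real x : rder (fun y => y%:C%C) x 1.
Proof.
exists (fun=> 1); split.
- exact: tends_cst.
- by [].
- by move=> y; rewrite mul1r rmorphB /= addrCA subrr addr0.
Qed.

Lemma rderD F G x l m : rder F x l -> rder G x m ->
  rder (fun y => F y + G y) x (l + m).
Proof.
move=> [p [cp <- fE]] [q [cq <- gE]]; exists (fun w => p w + q w); split.
- exact: tendsD.
- by [].
- by move=> w; rewrite fE gE mulrDl addrACA.
Qed.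

Lemma rderM F G x l m : rder F x l -> rder G x m ->
  rder (fun y => F y * G y) x (l * G x + F x * m).
Proof.
move=> df [q [cq <- gE]]; have cf := rder_continuous df.
case: df => [p [cp <- fE]].
exists (fun w => p w * G x + F w * q w); split.
- by apply: tendsD; apply: tendsM => //; exact: tends_cst.
- by [].
- move=> w; rewrite {1}gE mulrDr {1}fE; ring.
Qed.

Lemma rderZ c F x l : rder F x l -> rder (fun y => c * F y) x (c * l).
Proof. by move=> /(rderM (rder_cst c x)); rewrite mul0r add0r. Qed.

Lemma rder_comp f F x l m : rder F x l -> cder f (F x) m ->
  rder (f \o F) x (m * l).
Proof.
move=> dF [p [cp <- fE]]; have cF := rder_continuous dF.
case: dF => [q [cq <- FE]].
exists (fun w => p (F w) * q w); split.
- by apply: tendsM; [exact: (tends_comp cp) | exact: cq].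
- by [].
- move=> y; have e : F y - F x = q y * (y - x)%:C%C by rewrite FE addrAC subrr add0r.
  by rewrite /= fE e mulrA.
Qed.

Lemma rder_Re F x l : rder F x l ->
  is_derive x 1 (fun y => complex.Re (F y)) (complex.Re l).
Proof.
move=> /rderP dF; apply/is_deriveP => e e0; apply: filterS (dF e e0) => y.
apply: le_trans; apply: le_trans (ler_Re_nm _).
case: (F y) (F x) l {dF} => [a b] [a' b'] [c d] /=.
by rewrite mulr0 subr0.
Qed.

Lemma rder_Im F x l : rder F x l ->
  is_derive x 1 (fun y => complex.Im (F y)) (complex.Im l).
Proof.
move=> /rderP dF; apply/is_deriveP => e e0; apply: filterS (dF e e0) => y.
apply: le_trans; apply: le_trans (ler_Im_nm _).
case: (F y) (F x) l {dF} => [a b] [a' b'] [c d] /=.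
by rewrite mulr0 add0r.
Qed.

Lemma rder_Complex (u v : R -> R) x (l m : R) :
  is_derive x 1 u l -> is_derive x 1 v m ->
  rder (fun y => Complex (u y) (v y) : C) x (Complex l m).
Proof.
move=> /is_deriveP du /is_deriveP dv; apply/rderP => e e0.
have e2 : 0 < e / 2 by rewrite divr_gt0.
apply: filterS2 (du _ e2) (dv _ e2) => y yu yv.
apply: le_trans (nm_le_ReIm _) _ => /=.
rewrite !mulr0 subr0 add0r [e]splitr mulrDl.
exact: lerD.
Qed.

Lemma is_derive_bound (g dg : R -> R) a b (M : R) : a <= b ->
  (forall x, a <= x <= b -> is_derive x 1 g (dg x)) ->
  (forall x, a <= x <= b -> `|dg x| <= M) -> `|g b - g a| <= M * (b - a).
Proof.
rewrite le_eqVlt => /predU1P[<- _ _|ab dgP MP]; first by rewrite !subrr normr0 mulr0.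
have [||c] := @MVT R g dg a b ab.
- move=> x; rewrite in_itv /= => /andP[ax xb]; apply: dgP.
  by rewrite !ltW.
- apply: derivable_within_continuous => x; rewrite in_itv /= => xab.
  by have [] := dgP x xab.
rewrite in_itv /= => /andP[ac cb] ->.
have ba : 0 <= b - a by rewrite subr_ge0 ltW.
rewrite normrM (ger0_norm ba).
apply: ler_wpM2r => //.
by apply: MP; rewrite !ltW.
Qed.

(* The constant 2 instead of 1 comes from treating real and imaginary parts
   separately. *)
Lemma rder_bound F (dF : R -> C) a b (M : R) : a <= b ->
  (forall x, a <= x <= b -> rder F x (dF x)) ->
  (forall x, a <= x <= b -> nm (dF x) <= M) -> nm (F b - F a) <= 2 * M * (b - a).
Proof.
move=> ab dFP MP; apply: le_trans (nm_le_ReIm _) _.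
rewrite (_ : 2 * M = M + M); last by ring.
rewrite mulrDl; apply: lerD.
- rewrite (_ : complex.Re (F b - F a) = complex.Re (F b) - complex.Re (F a)); last first.
    by case: (F b) (F a) => [? ?] [? ?].
  apply: (@is_derive_bound (fun x => complex.Re (F x)) (fun x => complex.Re (dF x))) => //.
    by move=> x /dFP /rder_Re.
  by move=> x /MP; apply: le_trans; exact: ler_Re_nm.
- rewrite (_ : complex.Im (F b - F a) = complex.Im (F b) - complex.Im (F a)); last first.
    by case: (F b) (F a) => [? ?] [? ?].
  apply: (@is_derive_bound (fun x => complex.Im (F x)) (fun x => complex.Im (dF x))) => //.
    by move=> x /dFP /rder_Im.
  by move=> x /MP; apply: le_trans; exact: ler_Im_nm.
Qed.

(** Clamping the argument to [a, b] extends [g] continuously to the whole line; integrating from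
    [a - 1] makes every point of [a, b] interior, so the derivative is two-sided at the endpoints as
    well. *)
Lemma primitive_real (g : R -> R) a b : a <= b ->
  (forall x, a <= x <= b -> {for x, continuous g}) ->
  exists G : R -> R, forall x, a <= x <= b -> is_derive x 1 G (g x).
Proof.
move=> ab cg; pose cl y := Num.max a (Num.min b y).
have cl_id x : a <= x <= b -> cl x = x.
  by move=> /andP[ax xb]; rewrite /cl min_r // max_r.
have cl_in y : a <= cl y <= b.
  by rewrite /cl; case: (ltP b y) => ?; case: (ltP a) => ?; lra.
have cl_lip y x : `|cl y - cl x| <= `|y - x|.
  rewrite /cl ler_norml; have := ler_norm (y - x); have := ler_norm (x - y).
  rewrite (distrC x y); case: (ltP b y) => ?; case: (ltP b x) => ?;
  do ?case: (ltP a) => ?; lra.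
have cgc : continuous (g \o cl).
  move=> x; rewrite /continuous_at; apply/cvgrPdist_lt => e e0.
  have /cvgrPdist_lt/(_ e e0)/rnbhsP[r r0 rP] := cg _ (cl_in x).
  apply/rnbhsP; exists r => // y yx; apply: rP.
  exact: le_lt_trans (cl_lip _ _) yx.
exists (fun x => \int[lebesgue_measure]_(t in `[a - 1, x]) (g \o cl) t) => x xab.
have [] := @continuous_FTC1_closed R (g \o cl) (a - 1) x (b + 1).
- lra.
- apply: continuous_compact_integrable; first exact: segment_compact.
  exact: continuous_subspaceT.
- lra.
- exact: cgc.
- move=> dv dE; split => //.
  by rewrite -derive1E dE /= cl_id.
Qed.

Lemma primitive F a b : a <= b ->
  (forall x, a <= x <= b -> tends (nbhs x) F (F x)) ->
  exists G : R -> C, forall x, a <= x <= b -> rder G x (F x).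
Proof.
move=> ab cF.
have [u du] : exists u : R -> R, forall x, a <= x <= b ->
    is_derive x 1 u (complex.Re (F x)).
  apply: (@primitive_real (fun x => complex.Re (F x))) => // x /cF cFx.
  apply/cvgrPdist_lt => e /cFx; apply: filterS => y.
  apply: le_lt_trans; rewrite distrC; apply: le_trans (ler_Re_nm _).
  by case: (F y) (F x) => [? ?] [? ?].
have [v dv] : exists v : R -> R, forall x, a <= x <= b ->
    is_derive x 1 v (complex.Im (F x)).
  apply: (@primitive_real (fun x => complex.Im (F x))) => // x /cF cFx.
  apply/cvgrPdist_lt => e /cFx; apply: filterS => y.
  apply: le_lt_trans; rewrite distrC; apply: le_trans (ler_Im_nm _).
  by case: (F y) (F x) => [? ?] [? ?].
exists (fun x => Complex (u x) (v x)) => x xab.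
have := rder_Complex (du x xab) (dv x xab).
by case: (F x).
Qed.

End RealParameter.

(** * Integrals of complex functions over an interval *)

Section Integral.
Context {R : realType}.
Local Notation C := (Cplx R).
Implicit Types (u v U : R -> C) (a b c : R).

Definition is_primitive u a b U := forall x, a <= x <= b -> rder U x (u x).

(** The integral is the increment of a primitive; [cint_prim] shows that the choice of the primitive
    does not matter. The default is 0 when there is no primitive. *)
Definition cint a b u : C :=
  xget 0 [set z | exists U, is_primitive u a b U /\ z = U b - U a].

Definition integrand a b u := forall x, a <= x <= b -> tends (nbhs x) u (u x).

(** The difference of two primitives has derivative 0, so [rder_bound] with bound 0 makes it
    constant. *)
Lemma cint_prim a b u U : a <= b -> is_primitive u a b U -> cint a b u = U b - U a.
Proof.
move=> ab uU; rewrite /cint; case: xgetP => [z _ [V [uV ->]]|/(_ (U b - U a))]; last first.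
  by case; exists U.
have dW x : a <= x <= b -> rder (fun y => V y + (-1) * U y) x (u x + (-1) * u x).
  by move=> xab; apply: rderD; [exact: uV | apply: rderZ; exact: uU].
have := @rder_bound _ (fun y => V y + (-1) * U y) _ a b 0 ab dW.
have z0 x : a <= x <= b -> nm (u x + -1 * u x) <= 0 by rewrite mulN1r subrr nm0.
move=> /(_ z0); rewrite mulr0 mul0r => le0.
have /eqP := le_anti (introT andP (conj le0 (nm_ge0 _))).
rewrite nm_eq0 => /eqP e0.
by apply/eqP; rewrite -subr_eq0 -e0; apply/eqP; ring.
Qed.

Lemma integrand_prim a b u : a <= b -> integrand a b u -> exists U, is_primitive u a b U.
Proof. exact: primitive. Qed.

Lemma cintZ a b c u : a <= b -> integrand a b u ->
  forall k : C, cint a b (fun x => k * u x) = k * cint a b u.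
Proof.
move=> ab cu k; have [U uU] := integrand_prim ab cu.
rewrite (cint_prim ab uU) (@cint_prim _ _ _ (fun x => k * U x) ab); first by ring.
by move=> x xab; apply: rderZ; exact: uU.
Qed.

Lemma integrandM a b u v : integrand a b u -> integrand a b v ->
  integrand a b (fun x => u x * v x).
Proof. by move=> cu cv x xab; apply: tendsM; [exact: cu | exact: cv]. Qed.

Lemma cintB a b u v : a <= b -> integrand a b u -> integrand a b v ->
  cint a b (fun x => u x - v x) = cint a b u - cint a b v.
Proof.
move=> ab cu cv.
have [U uU] := integrand_prim ab cu; have [V vV] := integrand_prim ab cv.
rewrite (cint_prim ab uU) (cint_prim ab vV).
rewrite (@cint_prim _ _ _ (fun x => U x + (-1) * V x) ab); first by ring.
move=> x xab; rewrite -[- v x]mulN1r; apply: rderD; first exact: uU.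
by apply: rderZ; exact: vV.
Qed.

Lemma cint_bound a b u (M : R) : a <= b -> integrand a b u ->
  (forall x, a <= x <= b -> nm (u x) <= M) -> nm (cint a b u) <= 2 * M * (b - a).
Proof.
move=> ab cu uM; have [U uU] := integrand_prim ab cu.
by rewrite (cint_prim ab uU); apply: (@rder_bound _ _ u).
Qed.

Lemma cint_split a c b u : a <= c <= b -> integrand a b u ->
  cint a b u = cint a c u + cint c b u.
Proof.
move=> /andP[ac cb] cu; have ab := le_trans ac cb.
have [U uU] := integrand_prim ab cu.
rewrite (cint_prim ab uU) (@cint_prim a c u U ac) ?(@cint_prim c b u U cb).
- by ring.
- by move=> x /andP[cx xb]; apply: uU; rewrite xb (le_trans ac).
- by move=> x /andP[ax xc]; apply: uU; rewrite ax (le_trans xc).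
Qed.

End Integral.

(** * Additive functions of rectangles *)

Section Subdivision.
Context {R : realType}.
Local Notation C := (Cplx R).

(* Goursat's bisection: keep at each step a quarter of the rectangle carrying at
   least a quarter of the value. *)
Variable Phi : R -> R -> R -> R -> C.
Variables a b c d : R.
Hypothesis ab : a <= b.
Hypothesis cd : c <= d.
Hypothesis splitl : forall s m t p q, a <= s -> s <= m -> m <= t -> t <= b ->
  c <= p -> p <= q -> q <= d -> Phi s t p q = Phi s m p q + Phi m t p q.
Hypothesis splitr' : forall s t p m q, a <= s -> s <= t -> t <= b ->
  c <= p -> p <= m -> m <= q -> q <= d -> Phi s t p q = Phi s t p m + Phi s t m q.
Hypothesis small : forall x y, a <= x <= b -> c <= y <= d -> forall e : R, 0 < e ->
  exists2 r : R, 0 < r & forall s t p q, a <= s -> s <= x -> x <= t -> t <= b ->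
    c <= p -> p <= y -> y <= q -> q <= d -> t - s < r -> q - p < r ->
    nm (Phi s t p q) <= e * ((t - s) + (q - p)) ^+ 2.

Local Notation st := (R * R * R * R)%type.
Let P4 (z : st) := nm (Phi z.1.1.1 z.1.1.2 z.1.2 z.2).
Let step (z : st) : st :=
  let: (s, t, p, q) := z in
  let m := (s + t) / 2 in let n := (p + q) / 2 in
  if P4 z / 4 <= P4 (s, m, p, n) then (s, m, p, n) else
  if P4 z / 4 <= P4 (m, t, p, n) then (m, t, p, n) else
  if P4 z / 4 <= P4 (s, m, n, q) then (s, m, n, q) else (m, t, n, q).

Let ok (z : st) := [/\ a <= z.1.1.1, z.1.1.1 <= z.1.1.2 & z.1.1.2 <= b] /\
  [/\ c <= z.1.2, z.1.2 <= z.2 & z.2 <= d].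

Let stepP z : ok z -> [/\ ok (step z), P4 z / 4 <= P4 (step z),
  z.1.1.1 <= (step z).1.1.1 /\ (step z).1.1.2 <= z.1.1.2,
  z.1.2 <= (step z).1.2 /\ (step z).2 <= z.2 &
  (step z).1.1.2 - (step z).1.1.1 = (z.1.1.2 - z.1.1.1) / 2 /\
  (step z).2 - (step z).1.2 = (z.2 - z.1.2) / 2].
Proof.
case: z => [[[s t] p] q]; rewrite /ok /= => -[[? ? ?] [? ? ?]].
set m := (s + t) / 2; set n := (p + q) / 2.
have [sm mt] : s <= m /\ m <= t by rewrite /m; lra.
have [pn nq] : p <= n /\ n <= q by rewrite /n; lra.
have [mE nE] : m - s = (t - s) / 2 /\ n - p = (q - p) / 2 by rewrite /m /n; lra.
have [mE' nE'] : t - m = (t - s) / 2 /\ q - n = (q - p) / 2 by rewrite /m /n; lra.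
have [am mb] : a <= m /\ m <= b by split; lra.
have [cn nd] : c <= n /\ n <= d by split; lra.
have S4 : P4 (s, t, p, q) <= P4 (s, m, p, n) + P4 (m, t, p, n) +
    P4 (s, m, n, q) + P4 (m, t, n, q).
  rewrite /P4 /= (@splitl s m t) // (@splitr' s m p n) // (@splitr' m t p n) //.
  apply: le_trans (nmD _ _) _; apply: le_trans (lerD (nmD _ _) (nmD _ _)) _; lra.
case: ifPn => [h1|]; first by do !split => //=; rewrite ?lexx.
rewrite -ltNge => h1.
case: ifPn => [h2|]; first by do !split => //=; rewrite ?lexx.
rewrite -ltNge => h2.
case: ifPn => [h3|]; first by do !split => //=; rewrite ?lexx.
rewrite -ltNge => h3.
by do !split => //=; rewrite ?lexx //; lra.
Qed.

(** The nested rectangles carry at least [4 ^- n] of the initial value; suprema of their left and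
    lower ends give a common point (x, y). There [small] bounds the value by an arbitrarily small
    multiple of the squared size, which also scales like [4 ^- n]. *)
Lemma additive_rectangle_eq0 : Phi a b c d = 0.
Proof.
pose Z n := iter n step (a, b, c, d).
have okZ n : ok (Z n).
  by elim: n => [|n IH]; [do !split => /=; rewrite ?lexx | have [] := stepP IH].
have ZP n : P4 (a, b, c, d) / 4 ^+ n <= P4 (Z n).
  elim: n => [|n IH]; first by rewrite expr0 divr1.
  have [_ h _ _ _] := stepP (okZ n); apply: le_trans h.
  by rewrite exprSr invfM mulrA ler_pM2r.
have Zl n : (Z n).1.1.2 - (Z n).1.1.1 = (b - a) / 2 ^+ n /\
    (Z n).2 - (Z n).1.2 = (d - c) / 2 ^+ n.
  elim: n => [|n [IH1 IH2]]; first by rewrite expr0 !divr1.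
  have [_ _ _ _ [h1 h2]] := stepP (okZ n).
  by rewrite exprSr !invfM !mulrA -IH1 -IH2.
have Zmono n k : [/\ (Z n).1.1.1 <= (Z (n + k)%N).1.1.1,
    (Z (n + k)%N).1.1.2 <= (Z n).1.1.2, (Z n).1.2 <= (Z (n + k)%N).1.2 &
    (Z (n + k)%N).2 <= (Z n).2].
  elim: k => [|k [h1 h2 h3 h4]]; first by rewrite addn0 !lexx.
  have [_ _ [g1 g2] [g3 g4] _] := stepP (okZ (n + k)%N).
  by rewrite addnS /=; split; lra.
have Zle n k : (Z n).1.1.1 <= (Z k).1.1.2 /\ (Z n).1.2 <= (Z k).2.
  have [h1 h2 h3 h4] := Zmono n k; have [g1 g2 g3 g4] := Zmono k n.
  rewrite addnC in g1 g2 g3 g4.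
  by have [[? ? ?] [? ? ?]] := okZ (n + k)%N; split; lra.
pose A := [set (Z n).1.1.1 | n in [set: nat]]; pose B := [set (Z n).1.2 | n in [set: nat]].
have supA : has_sup A.
  by split; [exists a; exists 0%N | exists b => _ [n _ <-]; have [[? ? ?] [? ? ?]] := okZ n; lra].
have supB : has_sup B.
  by split; [exists c; exists 0%N | exists d => _ [n _ <-]; have [[? ? ?] [? ? ?]] := okZ n; lra].
pose x := sup A; pose y := sup B.
have xZ n : (Z n).1.1.1 <= x <= (Z n).1.1.2.
  apply/andP; split; first by apply: ub_le_sup; [case: supA | exists n].
  apply: ge_sup; first by case: supA.
  by move=> _ [k _ <-]; have [] := Zle k n.
have yZ n : (Z n).1.2 <= y <= (Z n).2.
  apply/andP; split; first by apply: ub_le_sup; [case: supB | exists n].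
  apply: ge_sup; first by case: supB.
  by move=> _ [k _ <-]; have [] := Zle k n.
have [->//|P0] := eqVneq (Phi a b c d) 0.
have {}P0 : 0 < P4 (a, b, c, d) by rewrite /P4 /= nm_gt0.
pose L := (b - a) + (d - c) + 1.
have L0 : 0 < L by rewrite /L ltr_wpDl // addr_ge0 // subr_ge0.
(* With this [e] the factors [4 ^+ n] cancel and the initial value is at most half of itself. The 1
   in [L] keeps the quotient meaningful for a degenerate rectangle. *)
pose e := P4 (a, b, c, d) / L ^+ 2 / 2.
have e0 : 0 < e by rewrite !divr_gt0 // exprn_gt0.
have [r r0 rP] := small (xZ 0%N) (yZ 0%N) e0.
pose n := Num.bound (L / r).
have nP : L / 2 ^+ n < r.
  rewrite ltr_pdivrMr ?exprn_gt0 // mulrC -ltr_pdivrMr //.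
  exact: upper_nthrootP.
have p2 : 0 < 2 ^+ n :> R by rewrite exprn_gt0.
have [lE mE] := Zl n.
have [[? ? ?] [? ? ?]] := okZ n.
have [/andP[? ?] /andP[? ?]] := (xZ n, yZ n).
have lt1 : (b - a) / 2 ^+ n < r.
  by apply: le_lt_trans nP; rewrite ler_pM2r ?invr_gt0 // /L; lra.
have lt2 : (d - c) / 2 ^+ n < r.
  by apply: le_lt_trans nP; rewrite ler_pM2r ?invr_gt0 // /L; lra.
have := rP (Z n).1.1.1 (Z n).1.1.2 (Z n).1.2 (Z n).2.
rewrite lE mE => /(_ _ _ _ _ _ _ _ _ lt1 lt2) => up.
have {}up : P4 (Z n) <= e * (((b - a) / 2 ^+ n) + ((d - c) / 2 ^+ n)) ^+ 2.
  by apply: up.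
have : P4 (a, b, c, d) / 4 ^+ n <= e * (L / 2 ^+ n) ^+ 2.
  apply: le_trans (ZP n) _; apply: le_trans up _.
  have s0 : 0 <= (b - a) + (d - c) by rewrite addr_ge0 // subr_ge0.
  have sL : (b - a) + (d - c) <= L by rewrite /L lerDl.
  apply: ler_wpM2l; first exact: ltW.
  rewrite -mulrDl; apply: lerXn2r; rewrite ?nnegrE.
  - by apply: divr_ge0; [exact: s0 | exact: ltW].
  - by apply: divr_ge0; exact: ltW.
  - by apply: ler_wpM2r; [rewrite invr_ge0 ltW | exact: sL].
rewrite expr_div_n mulrA -exprM mulnC exprM (_ : 2 ^+ 2 = 4); last by ring.
rewrite ler_pM2r ?invr_gt0 ?exprn_gt0 // /e mulrAC divfK ?gt_eqF ?exprn_gt0 //.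
by rewrite leNgt ltr_pdivrMr // ltr_pMr ?ltr1n.
Qed.

End Subdivision.

(** * Deformation of circles *)

Section Homotopy.
Context {R : realType}.
Local Notation C := (Cplx R).
Implicit Types (g Q dQ : C -> C) (x y s t l th : R).

(** The estimate behind [near] in [Phi_small]: [q0], [r0], [k0] stand for the moduli of [q], [rho],
    [kap], [l1] for the change of the parameter [l], [e1] for the displacement on the unit
    circle. *)
Lemma displacement_bound (r1 e1 q0 r0 k0 l1 S : R) :
  0 <= r1 -> l1 <= S -> e1 <= 2 * S -> r1 <= r0 + k0 -> 0 <= S ->
  0 <= q0 -> 0 <= r0 -> 0 <= k0 -> 0 <= e1 -> 0 <= l1 ->
  l1 * q0 + r1 * e1 + l1 * k0 <= 2 * (q0 + r0 + 2 * k0 + 1) * S.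
Proof.
move=> *; have : l1 * q0 <= S * q0 by apply: ler_wpM2r.
have : l1 * k0 <= S * k0 by apply: ler_wpM2r.
have : r1 * e1 <= (r0 + k0) * (2 * S) by apply: ler_pM.
nra.
Qed.

Lemma integrand_path g (gam dgam : R -> C) a b : a <= b ->
  (forall x, a <= x <= b -> rder gam x (dgam x)) ->
  (forall x, a <= x <= b -> tends (cnbhs (gam x)) g (g (gam x))) ->
  integrand a b (g \o gam).
Proof.
move=> ab dg cg x xab; apply: tends_comp; first exact: cg.
exact: rder_continuous (dg x xab).
Qed.

(** The integral of [dQ] along the path is exactly the increment of [Q], so only the error [g - dQ]
    has to be estimated. *)
Lemma path_integral_approx g Q dQ (gam dgam : R -> C) a b (M K : R) : a <= b ->
  (forall x, a <= x <= b -> rder gam x (dgam x)) ->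
  integrand a b dgam ->
  (forall x, a <= x <= b -> tends (cnbhs (gam x)) g (g (gam x))) ->
  (forall z, cder Q z (dQ z)) -> (forall z, tends (cnbhs z) dQ (dQ z)) ->
  (forall x, a <= x <= b -> nm (g (gam x) - dQ (gam x)) <= M) ->
  (forall x, a <= x <= b -> nm (dgam x) <= K) ->
  nm (cint a b (fun x => g (gam x) * dgam x) - (Q (gam b) - Q (gam a)))
    <= 2 * (M * K) * (b - a).
Proof.
move=> ab dg cdg cg QdQ cdQ MP KP.
have i1 : integrand a b (fun x => g (gam x) * dgam x).
  by apply: integrandM => //; apply: integrand_path dg cg.
have i2 : integrand a b (fun x => dQ (gam x) * dgam x).
  by apply: integrandM => //; apply: (@integrand_path dQ) dg _ => // x _; exact: cdQ.
have <- : cint a b (fun x => dQ (gam x) * dgam x) = Q (gam b) - Q (gam a).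
  apply: (@cint_prim _ _ _ _ (Q \o gam)) => // x xab.
  by apply: rder_comp; [exact: dg | exact: QdQ].
rewrite -cintB //; apply: cint_bound => // [x xab|x xab].
  by apply: tendsB; [exact: i1 | exact: i2].
rewrite -mulrBl nmM; apply: ler_pM; rewrite ?nm_ge0 //.
- exact: MP.
- exact: KP.
Qed.

Definition ce th : C := Complex (cos th) (sin th).

Lemma rder_ce th : rder ce th ('i%C * ce th).
Proof.
have -> : 'i%C * ce th = Complex (- sin th) (cos th) :> C.
  by rewrite /ce; apply/eqP; rewrite eq_complex /=; apply/andP; split; apply/eqP; ring.
by apply: rder_Complex.
Qed.

Lemma nm_i : nm ('i%C : C) = 1.
Proof. by rewrite nm_def /= expr0n expr1n add0r sqrtr1. Qed.

Lemma nm_ce th : nm (ce th) = 1.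
Proof. by rewrite nm_def /= cos2Dsin2 sqrtr1. Qed.

Lemma nm_ceB x y : nm (ce x - ce y) <= 2 * `|x - y|.
Proof.
wlog xy : x y / y <= x.
  move=> H; case/orP: (le_total y x) => /H //.
  by rewrite nmC distrC.
rewrite (ger0_norm (_ : 0 <= x - y)) ?subr_ge0 // -[2]mulr1.
apply: (@rder_bound _ _ (fun th => 'i%C * ce th)) => // th _; first exact: rder_ce.
by rewrite nmM nm_i nm_ce mulr1.
Qed.

Lemma ce_2pi : ce (2 * pi) = ce 0.
Proof. by rewrite /ce mulr_natl cos2pi sin2pi cos0 sin0. Qed.

Variables (p q rho kap : C) (g : C -> C).

(* For Cauchy's formula: moves a small circle around w to the circle around the centre
   of the disc, staying in the domain of f z / (z - w). *)
Definition gam l th : C := (p + l%:C%C * q) + (rho + l%:C%C * kap) * ce th.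

Let gam_l l th := q + kap * ce th.
Let gam_th l th := (rho + l%:C%C * kap) * ('i%C * ce th).

Let rder_gam_l th l : rder (gam^~ th) l (gam_l l th).
Proof.
rewrite /gam /gam_l.
have -> : q + kap * ce th = (0 + (1 * q + l%:C%C * 0)) +
    ((0 + (1 * kap + l%:C%C * 0)) * ce th + (rho + l%:C%C * kap) * 0) by ring.
apply: rderD; first apply: rderD; first exact: rder_cst.
  by apply: rderM; [exact: rder_real | exact: rder_cst].
apply: rderM; last exact: rder_cst.
apply: rderD; first exact: rder_cst.
by apply: rderM; [exact: rder_real | exact: rder_cst].
Qed.

Let rder_gam_th l th : rder (gam l) th (gam_th l th).
Proof.
rewrite /gam /gam_th -[X in rder _ _ X]add0r.
apply: rderD; first exact: rder_cst.
by apply: rderZ; exact: rder_ce.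
Qed.

Let A l s t := cint s t (fun th => g (gam l th) * gam_th l th).
Let B th s t := cint s t (fun l => g (gam l th) * gam_l l th).
(** The integral of g dz along the boundary of the rectangle [s, t] x [u, v] transported by [gam];
    [A] runs along the edges in [th], [B] along those in [l]. *)
Let Phi s t u v := B u s t + A t u v - B v s t - A s u v.

Let int_gam_th l s t : integrand s t (gam_th l).
Proof.
move=> th _; apply: tendsM; first exact: tends_cst.
by apply: tendsM; [exact: tends_cst | exact: rder_continuous (rder_ce th)].
Qed.

Let int_gam_l th s t : integrand s t (gam_l^~ th).
Proof. move=> l _; exact: tends_cst. Qed.

Hypothesis g_cder : forall l th, 0 <= l <= 1 -> 0 <= th <= 2 * pi ->
  exists m, cder g (gam l th) m.

Let g_cont l th : 0 <= l <= 1 -> 0 <= th <= 2 * pi ->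
  tends (cnbhs (gam l th)) g (g (gam l th)).
Proof. by move=> l1 t1; have [m /cder_continuous] := g_cder l1 t1. Qed.

Let int_A l s t : 0 <= l <= 1 -> 0 <= s -> s <= t -> t <= 2 * pi ->
  integrand s t (fun th => g (gam l th) * gam_th l th).
Proof.
move=> l1 s0 st t1; apply: integrandM; last exact: int_gam_th.
apply: (@integrand_path g (gam l)) => // x /andP[sx xt].
by apply: g_cont; rewrite // (le_trans s0) // (le_trans xt).
Qed.

Let int_B th s t : 0 <= th <= 2 * pi -> 0 <= s -> s <= t -> t <= 1 ->
  integrand s t (fun l => g (gam l th) * gam_l l th).
Proof.
move=> l1 s0 st t1; apply: integrandM; last exact: int_gam_l.
apply: (@integrand_path g (gam^~ th) (gam_l^~ th)) => // x /andP[sx xt].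
by apply: g_cont; rewrite // (le_trans s0) // (le_trans xt).
Qed.

(** Near [gam x y] the function [g] is affine up to [eta] times the distance. The affine part has
    the primitive [Q], whose increments cancel around the boundary. What remains is an error
    proportional to [S], integrated over a path of length proportional to [S]. *)
Let Phi_small x y : 0 <= x <= 1 -> 0 <= y <= 2 * pi -> forall e : R, 0 < e ->
  exists2 r : R, 0 < r & forall s t u v, 0 <= s -> s <= x -> x <= t -> t <= 1 ->
    0 <= u -> u <= y -> y <= v -> v <= 2 * pi -> t - s < r -> v - u < r ->
    nm (Phi s t u v) <= e * ((t - s) + (v - u)) ^+ 2.
Proof.
move=> x01 y01 e e0; have [m dg] := g_cder x01 y01.
set z0 := gam x y in dg.
pose Q z := g z0 * z + m / 2 * (z - z0) ^+ 2.
pose dQ z := g z0 + m * (z - z0).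
have QdQ z : cder Q z (dQ z).
  have -> : dQ z = g z0 * 1 + m / 2 * (2%:R * (z - z0) ^+ 1 * (1 - 0)).
    by rewrite /dQ subr0 expr1; field.
  apply: cderD; first by apply: cderZ; exact: cder_id.
  apply: cderZ; apply: (@cderX _ (fun z => z - z0) z (1 - 0) 2).
  by apply: cderB; [exact: cder_id | exact: cder_cst].
have cdQ z : tends (cnbhs z) dQ (dQ z).
  apply: tendsD; first exact: tends_cst.
  apply: tendsM; first exact: tends_cst.
  by apply: tendsB; [exact: tends_id | exact: tends_cst].
pose K := nm q + nm rho + 2 * nm kap + 1.
have K0 : 0 < K by rewrite /K; have := nm_ge0 q; have := nm_ge0 rho; have := nm_ge0 kap; lra.
(* 8 is the product of three factors 2: one from [path_integral_approx], one from the distance bound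
   [2 * K * S], one because the four sides have total length [2 * S]. One [K] bounds the distance,
   the other the speed. *)
pose eta := e / (8 * K ^+ 2).
have eta0 : 0 < eta by rewrite divr_gt0 // mulr_gt0 // exprn_gt0.
have [d d0 dP] : exists2 d : R, 0 < d & forall z, nm (z - z0) < d ->
    nm (g z - dQ z) <= eta * nm (z - z0).
  case: (dg) => phi [cphi phiz gE]; have /cnbhsP[d d0 dP] := cphi _ eta0.
  exists d => // z /dP /ltW zd; rewrite /dQ [g z]gE.
  rewrite -phiz (_ : _ - _ = (phi z - phi z0) * (z - z0)); last by ring.
  by rewrite nmM ler_wpM2r // nm_ge0.
exists (d / (4 * K)); first by rewrite divr_gt0 // mulr_gt0.
move=> s t u v s0 sx xt t1 u0 uy yv v1 tsr vur.
pose S := (t - s) + (v - u).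
have S0 : 0 <= S by rewrite /S; lra.
have Sd : 2 * K * S < d.
  have -> : d = 2 * K * (d / (4 * K) + d / (4 * K)) by field; rewrite gt_eqF.
  by rewrite ltr_pM2l ?mulr_gt0 // /S; apply: ltrD.
have near l th : s <= l <= t -> u <= th <= v -> nm (gam l th - z0) <= 2 * K * S.
  move=> /andP[sl lt] /andP[uth thv].
  have -> : gam l th - z0 = (l - x)%:C%C * q + (rho + l%:C%C * kap) * (ce th - ce y) +
      (l - x)%:C%C * (kap * ce y).
    by rewrite /z0 /gam rmorphB /=; ring.
  apply: le_trans (nmD _ _) _; apply: le_trans (lerD (nmD _ _) (lexx _)) _.
  rewrite !nmM !nm_real nm_ce mulr1.
  have h1 : `|l - x| <= S by rewrite ler_norml /S; lra.
  have h2 : nm (ce th - ce y) <= 2 * S.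
    apply: le_trans (nm_ceB _ _) _; rewrite ler_pM2l // ler_norml /S; lra.
  have h3 : nm (rho + l%:C%C * kap) <= nm rho + nm kap.
    apply: le_trans (nmD _ _) _; rewrite lerD2l nmM nm_real.
    by rewrite ler_piMl ?nm_ge0 // ler_norml; lra.
  move: (nm_ge0 q) (nm_ge0 rho) (nm_ge0 kap) (nm_ge0 (ce th - ce y)) (normr_ge0 (l - x)).
  move: (nm_ge0 (rho + l%:C%C * kap)) h1 h2 h3 S0.
  by rewrite /K; apply: displacement_bound.
have rem l th : s <= l <= t -> u <= th <= v ->
    nm (g (gam l th) - dQ (gam l th)) <= eta * (2 * K * S).
  move=> l1 th1; have nn := near _ _ l1 th1.
  apply: le_trans (dP _ (le_lt_trans nn Sd)) _.
  by rewrite ler_pM2l.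
have bl l th : nm (gam_l l th) <= K.
  apply: le_trans (nmD _ _) _; rewrite nmM nm_ce mulr1 /K.
  by have := nm_ge0 rho; have := nm_ge0 kap; lra.
have bth l th : 0 <= l <= 1 -> nm (gam_th l th) <= K.
  move=> l1; rewrite !nmM nm_i nm_ce !mulr1; apply: le_trans (nmD _ _) _.
  rewrite nmM nm_real /K; have := nm_ge0 q; have := nm_ge0 kap.
  have : `|l| <= 1 by rewrite ler_norml; lra.
  by have := normr_ge0 l; nra.
have sideA l : s <= l <= t -> nm (A l u v - (Q (gam l v) - Q (gam l u)))
    <= 2 * (eta * (2 * K * S) * K) * (v - u).
  move=> l1; have l01 : 0 <= l <= 1 by lra.
  apply: (@path_integral_approx g Q dQ (gam l) (gam_th l)) => //.
  - by lra.
  - by move=> th th1; apply: g_cont => //; lra.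
  - by move=> th th1; apply: rem.
  - by move=> th th1; apply: bth.
have sideB th : u <= th <= v -> nm (B th s t - (Q (gam t th) - Q (gam s th)))
    <= 2 * (eta * (2 * K * S) * K) * (t - s).
  move=> l1; have l01 : 0 <= th <= 2 * pi by lra.
  apply: (@path_integral_approx g Q dQ (gam^~ th) (gam_l^~ th)) => //.
  - by lra.
  - by move=> l l2; apply: g_cont => //; lra.
  - by move=> l l2; apply: rem.
have -> : Phi s t u v = (B u s t - (Q (gam t u) - Q (gam s u))) +
    (A t u v - (Q (gam t v) - Q (gam t u))) -
    (B v s t - (Q (gam t v) - Q (gam s v))) - (A s u v - (Q (gam s v) - Q (gam s u))).
  by rewrite /Phi; ring.
apply: le_trans (nmB _ _) _; apply: le_trans (lerD (nmB _ _) (lexx _)) _.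
apply: le_trans (lerD (lerD (nmD _ _) (lexx _)) (lexx _)) _.
have uv : u <= v by lra.
have st : s <= t by lra.
have := sideA t; rewrite lexx st => /(_ isT) h1.
have := sideA s; rewrite lexx st => /(_ isT) h2.
have := sideB u; rewrite lexx uv => /(_ isT) h3.
have := sideB v; rewrite lexx uv => /(_ isT) h4.
apply: le_trans (lerD (lerD (lerD h3 h1) h4) h2) _.
have -> : e = eta * (8 * K ^+ 2).
  by rewrite /eta divfK // gt_eqF // mulr_gt0 // exprn_gt0.
rewrite -/S le_eqVlt; apply/orP; left; apply/eqP; rewrite /S; ring.
Qed.

(** By periodicity of [ce] the edges th = 0 and th = 2 pi cancel, which leaves the two closed curves
    l = 0 and l = 1. *)
Lemma homotopy_integral :
  cint 0 (2 * pi) (fun th => g (gam 1 th) * gam_th 1 th) =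
  cint 0 (2 * pi) (fun th => g (gam 0 th) * gam_th 0 th).
Proof.
have pi2 : 0 <= 2 * pi :> R by rewrite mulr_ge0 // pi_ge0.
have := @additive_rectangle_eq0 _ Phi 0 1 0 (2 * pi) ler01 pi2 _ _ Phi_small.
have -> : Phi 0 1 0 (2 * pi) = A 1 0 (2 * pi) - A 0 0 (2 * pi).
  have BE : B (2 * pi) 0 1 = B 0 0 1 by rewrite /B /gam /gam_l ce_2pi.
  by rewrite /Phi BE; ring.
move=> H; apply/eqP; rewrite -subr_eq0; apply/eqP; apply: H.
- move=> s m t u v s0 sm mt t1 u0 uv v1.
  have Bs w : 0 <= w <= 2 * pi -> B w s t = B w s m + B w m t.
    by move=> w1; apply: cint_split; [rewrite sm | apply: int_B => //; lra].
  by rewrite /Phi !Bs; [ring | lra | lra].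
- move=> s t u m v s0 st t1 u0 um mv v1.
  have As w : 0 <= w <= 1 -> A w u v = A w u m + A w m v.
    by move=> w1; apply: cint_split; [rewrite um | apply: int_A => //; lra].
  by rewrite /Phi !As; [ring | lra | lra].
Qed.

End Homotopy.

Lemma integrand_bounded {R : realType} (a b : R) (u : R -> Cplx R) : a <= b ->
  integrand a b u -> exists2 M, 0 < M & forall x, a <= x <= b -> nm (u x) <= M.
Proof.
move=> ab cu; have [||x0 _ xM] := @EVT_max R (fun x => nm (u x)) a b => //.
  apply: continuous_in_subspaceT => x; rewrite inE /= in_itv /= => /cu cux.
  apply/cvgrPdist_lt => e /cux; apply: filterS => y; apply: le_lt_trans.
  rewrite ler_norml; have := nm_lb (u x) (u y); have := nm_lb (u y) (u x).
  by rewrite (nmC (u x)); lra.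
exists (nm (u x0) + 1); first by have := nm_ge0 (u x0); lra.
move=> x xab; apply: le_trans (xM x _) _; first by rewrite in_itv.
by rewrite lerDl.
Qed.

(** * Cauchy's formula *)

Section CauchyFormula.
Context {R : realType}.
Local Notation C := (Cplx R).
Implicit Types (f h : C -> C) (z w c : C) (r : R).

Definition holo f c r := forall z, nm (z - c) < r -> exists m, cder f z m.

Definition circ c r th : C := c + r%:C%C * ce th.

Lemma circ_dist c r th : 0 <= r -> nm (circ c r th - c) = r.
Proof.
by move=> r0; rewrite /circ addrAC subrr add0r nmM nm_real nm_ce mulr1 ger0_norm.
Qed.

Lemma tends_circ c r th : tends (nbhs th) (circ c r) (circ c r th).
Proof.
apply: (@rder_continuous _ _ _ (0 + r%:C%C * ('i%C * ce th))).
by apply: rderD; [exact: rder_cst | apply: rderZ; exact: rder_ce].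
Qed.

Lemma circ_far c r z th d : 0 <= r -> nm (z - c) <= r - d -> d <= nm (circ c r th - z).
Proof.
move=> r0 zc; have := nm_lb (circ c r th - c) (z - c).
by rewrite circ_dist // opprB addrA subrK; lra.
Qed.

Let pi2 : 0 < 2 * pi :> R. Proof. by rewrite mulr_gt0 // pi_gt0. Qed.
Let pi2' : 0 <= 2 * pi :> R. Proof. exact: ltW. Qed.
Let i0 : 'i%C != 0 :> C. Proof. by rewrite -nm_gt0 nm_i. Qed.

Lemma cint_cst (k : C) : cint 0 (2 * pi) (fun=> k) = k * (2 * pi)%:C%C.
Proof.
rewrite (@cint_prim _ _ _ _ (fun x => k * x%:C%C)) //.
  by rewrite rmorph0 mulr0 subr0.
by move=> x _; rewrite -[k in rder _ _ k]mulr1; apply: rderZ; exact: rder_real.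
Qed.

Definition ctr (u : R -> C) c r w := cint 0 (2 * pi) (fun th => u th / (circ c r th - w)).

(** The circle is deformed into a small circle around [w], where continuity of [f] finishes the
    estimate. On the large circle dz = i (z - c) dth: the factor i cancels, and the weight
    [circ c r th - c] stays in the integrand. *)
Lemma cauchy_formula f c r w : 0 < r -> (forall z, nm (z - c) <= r -> exists m, cder f z m) ->
  nm (w - c) < r ->
  (2 * pi)%:C%C * f w = ctr (fun th => f (circ c r th) * (circ c r th - c)) c r w.
Proof.
move=> r0 fP wc; apply/eqP; rewrite -(inj_eq (mulfI i0)) -subr_eq0 -nm_eq0.
apply/eqP/le_anti/andP; split; last exact: nm_ge0.
apply/ler_addgt0Pl => e e0; rewrite addr0.
have [m /cder_continuous cf] := fP w (ltW wc).
have e1 : 0 < e / (2 * (2 * pi)) by rewrite divr_gt0 // mulr_gt0.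
have /cnbhsP[d d0 dP] := cf _ e1.
(* The second bound keeps all intermediate circles inside the closed disc and at distance at least
   [eps] from [w]; the first makes [f] close to [f w] on the small circle. *)
pose eps := Num.min (d / 2) (r - nm (w - c)).
have eps0 : 0 < eps by rewrite lt_min divr_gt0 // subr_gt0.
have epsd : eps < d by apply: le_lt_trans (_ : d / 2 < d); rewrite ?ge_min ?lexx //; lra.
have epsr : eps <= r - nm (w - c) by rewrite ge_min lexx orbT.
(* The centre moves from [w] to [c] while the radius grows from [eps] to [r]. *)
pose p := w; pose q := c - w; pose rho : C := eps%:C%C; pose kap : C := (r - eps)%:C%C.
have rE l : rho + l%:C%C * kap = (eps + l * (r - eps))%:C%C.
  by rewrite rmorphD rmorphM.
have geps l : 0 <= l <= 1 -> 0 <= eps + l * (r - eps).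
  by move=> /andP[l0 l1]; rewrite addr_ge0 ?mulr_ge0 //; have := nm_ge0 (w - c); lra.
have gamc l th : 0 <= l <= 1 -> nm (gam p q rho kap l th - c) <= r.
  move=> l1; have -> : gam p q rho kap l th - c = (1 - l)%:C%C * (w - c) +
      (rho + l%:C%C * kap) * ce th.
    by rewrite /gam /p /q rmorphB /= rmorph1; ring.
  apply: le_trans (nmD _ _) _; rewrite !nmM nm_ce mulr1 rE !nm_real !ger0_norm ?geps //; last lra.
  have : (1 - l) * nm (w - c) <= (1 - l) * (r - eps) by apply: ler_wpM2l; lra.
  by lra.
have gamw l th : 0 <= l <= 1 -> gam p q rho kap l th - w != 0.
  move=> l1; rewrite -nm_gt0; apply: lt_le_trans eps0 _.
  have -> : gam p q rho kap l th - w = (rho + l%:C%C * kap) * ce th - l%:C%C * (w - c).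
    by rewrite /gam /p /q; ring.
  apply: le_trans (nm_lb _ _).
  rewrite !nmM nm_ce mulr1 rE !nm_real !ger0_norm ?geps //; last lra.
  have : l * nm (w - c) <= l * (r - eps) by apply: ler_wpM2l; lra.
  by lra.
have := @homotopy_integral R p q rho kap (fun z => f z / (z - w)).
have g1 th : gam p q rho kap 1 th = circ c r th.
  rewrite /gam rE !mul1r /p /q /circ.
  by rewrite (addrC w) subrK (addrC eps) subrK.
have g0 th : gam p q rho kap 0 th = circ w eps th.
  by rewrite /gam rE !mul0r !addr0.
have hol l th : 0 <= l <= 1 -> 0 <= th <= 2 * pi ->
    exists m, cder (fun z => f z / (z - w)) (gam p q rho kap l th) m.
  move=> l1 _; have [m1 fm] := fP _ (gamc l th l1).
  eexists; apply: cderM; first exact: fm.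
  apply: cderV; first exact: gamw.
  by apply: cderB; [exact: cder_id | exact: cder_cst].
move=> /(_ hol) HH.
have fcirc th : tends (nbhs th) (fun x => f (circ c r x)) (f (circ c r th)).
  apply: (@tends_comp _ _ _ _ f (circ c r)); last exact: tends_circ.
  have cr : nm (circ c r th - c) <= r by rewrite circ_dist // ltW.
  by have [m2 /cder_continuous] := fP _ cr.
have fcirc' th : tends (nbhs th) (fun x => f (circ w eps x)) (f (circ w eps th)).
  apply: (@tends_comp _ _ _ _ f (circ w eps)); last exact: tends_circ.
  rewrite -g0; have [|m2 /cder_continuous //] := fP (gam p q rho kap 0 th).
  by apply: gamc; rewrite lexx ler01.
have L1 : 'i%C * ctr (fun th => f (circ c r th) * (circ c r th - c)) c r w =
    cint 0 (2 * pi) (fun th => 'i%C * f (circ w eps th)).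
  rewrite /ctr -cintZ //; last first.
    move=> th _; apply: tendsM; last first.
      apply: tendsV; first by rewrite -g1 gamw // ler01 lexx.
      by apply: tendsB; [exact: tends_circ | exact: tends_cst].
    apply: tendsM; first exact: fcirc.
    by apply: tendsB; [exact: tends_circ | exact: tends_cst].
  transitivity (cint 0 (2 * pi) (fun th => f (gam p q rho kap 1 th) /
      (gam p q rho kap 1 th - w) * ((rho + 1%:C%C * kap) * ('i%C * ce th)))).
    congr cint; apply/funext => th.
    have -> : rho + 1%:C%C * kap = r%:C%C by rewrite rE mul1r addrC subrK.
    by rewrite g1 /circ (addrAC c) subrr add0r; ring.
  rewrite HH; congr cint; apply/funext => th.
  have -> : rho + 0%:C%C * kap = eps%:C%C by rewrite rE mul0r addr0.
  rewrite g0 /circ (addrAC w) subrr add0r.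
  have e0' : eps%:C%C != 0 :> C by rewrite -nm_gt0 nm_real normr_gt0 gt_eqF.
  have c0 : ce th != 0 by rewrite -nm_gt0 nm_ce.
  by field; rewrite e0' c0.
have int1 : integrand 0 (2 * pi) (fun th => 'i%C * f (circ w eps th)).
  by move=> th _; apply: tendsM; [exact: tends_cst | exact: fcirc'].
rewrite L1 mulrCA mulrC -cint_cst nmC -cintB //; last by move=> th _; exact: tends_cst.
have -> : e = 2 * (e / (2 * (2 * pi))) * (2 * pi - 0).
  by rewrite subr0 mulrAC mulrC divfK // gt_eqF // mulr_gt0.
apply: cint_bound => // [th th1|th _].
  by apply: tendsB; [exact: (int1 th th1) | exact: tends_cst].
rewrite -mulrBr nmM nm_i mul1r ltW // dP //.
by rewrite circ_dist // ltW.
Qed.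

(** The divided difference of the Cauchy transform [ctr], written as one integral so that it makes
    sense for [z = w], where it is the derivative. *)
Definition ctr2 (u : R -> C) c r z w :=
  cint 0 (2 * pi) (fun th => u th / ((circ c r th - z) * (circ c r th - w))).

Section Kernel.
Variables (u : R -> C) (c : C) (r : R).
Hypothesis r0 : 0 < r.
Hypothesis cu : integrand 0 (2 * pi) u.

Let far z th : nm (z - c) < r -> circ c r th - z != 0.
Proof.
move=> zr; rewrite -nm_gt0; apply: (lt_le_trans (_ : 0 < r - nm (z - c))).
  by rewrite subr_gt0.
by apply: circ_far; [exact: ltW | rewrite subKr].
Qed.

Let int1 z : nm (z - c) < r -> integrand 0 (2 * pi) (fun th => (circ c r th - z)^-1).
Proof.
move=> zr th _; apply: tendsV; first exact: far.
by apply: tendsB; [exact: tends_circ | exact: tends_cst].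
Qed.

Let int2 z w : nm (z - c) < r -> nm (w - c) < r ->
  integrand 0 (2 * pi) (fun th => u th / ((circ c r th - z) * (circ c r th - w))).
Proof.
move=> zr wr th th1; apply: tendsM; first exact: cu.
apply: tendsV; first by rewrite mulf_neq0 // far.
by apply: tendsM; apply: tendsB; (exact: tends_circ || exact: tends_cst).
Qed.

Lemma ctr_ctr2 z w : nm (z - c) < r -> nm (w - c) < r ->
  ctr u c r z - ctr u c r w = (z - w) * ctr2 u c r z w.
Proof.
move=> zr wr; rewrite /ctr /ctr2 -cintB // -?cintZ //.
- congr cint; apply/funext => th.
  by field; rewrite !far.
- exact: int2.
- by apply: integrandM => //; exact: int1.
- by apply: integrandM => //; exact: int1.
Qed.

Lemma ctr2_lip d : 0 < d -> exists2 K : R, 0 < K & forall z z' w,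
  nm (z - c) <= r - d -> nm (z' - c) <= r - d -> nm (w - c) <= r - d ->
  nm (ctr2 u c r z w - ctr2 u c r z' w) <= K * nm (z - z').
Proof.
move=> d0; have [M M0 uM] := integrand_bounded pi2' cu.
exists (2 * (M / d ^+ 3) * (2 * pi)).
  by rewrite mulr_gt0 // mulr_gt0 // divr_gt0 // exprn_gt0.
move=> z z' w zd z'd wd.
have lt t : nm (t - c) <= r - d -> nm (t - c) < r by lra.
rewrite /ctr2 -cintB //; try by apply: int2; exact: lt.
rewrite (_ : _ * nm (z - z') = 2 * (M / d ^+ 3 * nm (z - z')) * (2 * pi - 0)); last first.
  by rewrite subr0; ring.
apply: cint_bound => //.
  by move=> th th1; apply: tendsB; apply: int2 => //; exact: lt.
move=> th th1; have far1 t : nm (t - c) <= r - d -> circ c r th - t != 0.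
  by move=> /lt/far.
have -> : u th / ((circ c r th - z) * (circ c r th - w)) -
    u th / ((circ c r th - z') * (circ c r th - w)) =
    u th * (z - z') / ((circ c r th - z) * (circ c r th - z') * (circ c r th - w)).
  by field; rewrite !far1.
have dge t : nm (t - c) <= r - d -> d <= nm (circ c r th - t).
  by apply: circ_far; exact: ltW.
rewrite !nmM nmV !nmM mulrAC ler_wpM2r ?nm_ge0 //.
apply: ler_pM; rewrite ?invr_ge0 ?mulr_ge0 ?nm_ge0 //; first exact: uM.
have d3 : d ^+ 3 <= nm (circ c r th - z) * nm (circ c r th - z') * nm (circ c r th - w).
  rewrite (_ : d ^+ 3 = d * d * d); last by ring.
  by apply: ler_pM; rewrite ?mulr_ge0 ?(ltW d0) ?dge //; apply: ler_pM; rewrite ?(ltW d0) ?dge.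
rewrite lef_pV2 // posrE ?exprn_gt0 //.
by apply: lt_le_trans d3; rewrite exprn_gt0.
Qed.

Lemma ctr2C z w : ctr2 u c r z w = ctr2 u c r w z.
Proof. by rewrite /ctr2; congr cint; apply/funext => th; rewrite [_ * (_ - w)]mulrC. Qed.

Lemma ctr_cder w : nm (w - c) < r -> cder (ctr u c r) w (ctr2 u c r w w).
Proof.
move=> wr; pose d := (r - nm (w - c)) / 2.
have d0 : 0 < d by rewrite divr_gt0 // subr_gt0.
have near : \forall z \near cnbhs w, nm (z - c) <= r - d.
  apply/cnbhsP; exists d => // z zw.
  have := nm_triangle w z c; rewrite /d in zw *; lra.
apply: (@cder_near _ (fun z => ctr u c r w + ctr2 u c r z w * (z - w))).
  apply: filterS near => z zd; rewrite mulrC -ctr_ctr2 //; last by lra.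
  by rewrite addrCA subrr addr0.
exists (fun z => ctr2 u c r z w); split => //; last first.
  by move=> z; rewrite subrr mulr0 addr0.
have [K K0 KP] := ctr2_lip d0.
move=> e e0; have eK : 0 < e / K by rewrite divr_gt0.
apply: filterS2 near (near_nm w eK) => z zd zw.
apply: le_lt_trans (KP z w w _ _ _) _ => //; try by rewrite /d; lra.
by rewrite mulrC -ltr_pdivlMr.
Qed.

End Kernel.

End CauchyFormula.

(** * Zeros, singularities and mapping properties of holomorphic functions *)

Section HolomorphicFunctions.
Context {R : realType}.
Local Notation C := (Cplx R).
Implicit Types (f g k : C -> C) (z w c l : C) (r : R).

Let pi2 : 0 < 2 * pi :> R. Proof. by rewrite mulr_gt0 // pi_gt0. Qed.
Let pi2C : (2 * pi)%:C%C != 0 :> C.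
Proof. by rewrite -nm_gt0 nm_real normr_gt0 gt_eqF. Qed.

Lemma holo_sub f c r c' r' : holo f c r -> nm (c' - c) + r' <= r -> holo f c' r'.
Proof.
by move=> fr rr z zc; apply: fr; have := nm_triangle c' z c; lra.
Qed.

Lemma holo_continuous f c r z : holo f c r -> nm (z - c) < r -> tends (cnbhs z) f (f z).
Proof. by move=> fr /fr [m /cder_continuous]. Qed.

Lemma integrand_circ f c r r' : 0 <= r -> r < r' -> holo f c r' ->
  integrand 0 (2 * pi) (fun th => f (circ c r th)).
Proof.
move=> r0 rr fr th _; apply: (@tends_comp _ _ _ _ f (circ c r)); last exact: tends_circ.
by apply: (holo_continuous fr); rewrite circ_dist.
Qed.

Lemma integrand_cauchy f c r r' : 0 <= r -> r < r' -> holo f c r' ->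
  integrand 0 (2 * pi) (fun th => f (circ c r th) * (circ c r th - c)).
Proof.
move=> r0 rr fr; apply: integrandM; first exact: integrand_circ rr fr.
by move=> th _; apply: tendsB; [exact: tends_circ | exact: tends_cst].
Qed.

Lemma cauchy_slope f c r r' z w : 0 < r -> r < r' -> holo f c r' ->
  nm (z - c) < r -> nm (w - c) < r ->
  f z - f w = (z - w) * ((2 * pi)%:C%C^-1 *
    ctr2 (fun th => f (circ c r th) * (circ c r th - c)) c r z w).
Proof.
move=> r0 rr fr zr wr; apply: (mulfI pi2C).
have fP t : nm (t - c) <= r -> exists m, cder f t m by move=> tr; apply: fr; lra.
rewrite mulrBr !(cauchy_formula r0 fP) // ctr_ctr2 //.
  by rewrite mulrCA mulVKf.
exact: integrand_cauchy (ltW r0) rr fr.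
Qed.

(** The value at the centre is a mean over the circle; the factor 2 is inherited from
    [rder_bound]. *)
Lemma max_bound f c r r' (M : R) : 0 < r -> r < r' -> holo f c r' ->
  (forall th, 0 <= th <= 2 * pi -> nm (f (circ c r th)) <= M) -> nm (f c) <= 2 * M.
Proof.
move=> r0 rr fr fM.
have fP t : nm (t - c) <= r -> exists m, cder f t m by move=> tr; apply: fr; lra.
have cc : nm (c - c) < r by rewrite subrr nm0.
have := cauchy_formula r0 fP cc.
rewrite /ctr; under [X in cint _ _ X]eq_fun => th.
  rewrite mulfK; last by rewrite -nm_gt0 circ_dist // ltW.
  over.
move=> E; have : nm ((2 * pi)%:C%C * f c) <= 2 * M * (2 * pi - 0).
  rewrite E; apply: cint_bound; first exact: ltW.
    exact: integrand_circ (ltW r0) rr fr.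
  exact: fM.
by rewrite nmM nm_real gtr0_norm // subr0 mulrC ler_pM2r.
Qed.

(** Away from [c] the difference quotient is visibly holomorphic. Near [c] it is a Cauchy transform
    of [f] itself: in the divided difference of Cauchy's formula the weight [circ c s th - c]
    cancels one denominator. *)
Lemma dslope f c r : 0 < r -> holo f c r ->
  exists2 k, holo k c r & forall w, f w = f c + (w - c) * k w.
Proof.
move=> r0 fr; have [l fl] : exists m, cder f c m by apply: fr; rewrite subrr nm0.
pose k w := if w == c then l else (f w - f c) / (w - c).
exists k; last first.
  move=> w; rewrite /k; case: eqP => [->|/eqP wc]; first by rewrite subrr mul0r addr0.
  by rewrite mulrC divfK ?subr_eq0 // addrCA subrr addr0.
pose s := r / 2; have [s0 sr] : 0 < s /\ s < r by rewrite /s; lra.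
pose u th := f (circ c s th); pose S w := (2 * pi)%:C%C^-1 * ctr u c s w.
have cu : integrand 0 (2 * pi) u by exact: integrand_circ (ltW s0) sr fr.
have cc : nm (c - c) < s by rewrite subrr nm0.
have SE w : nm (w - c) < s -> f w = f c + S w * (w - c).
  move=> wc; have := cauchy_slope s0 sr fr wc cc.
  rewrite /ctr2 => /eqP; rewrite subr_eq addrC => /eqP ->.
  rewrite [S w * _]mulrC /S /ctr; congr (_ + _ * (_ * cint _ _ _)).
  apply/funext => th; have c0 : circ c s th - c != 0 by rewrite -nm_gt0 circ_dist // ltW.
  by rewrite invfM mulrA mulrAC mulfK.
have Sder w : nm (w - c) < s -> exists m, cder S w m.
  by move=> wc; eexists; apply: cderZ; apply: ctr_cder.
have lS : l = S c.
  have [m /cder_continuous cS] := Sder c cc.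
  apply: (cder_uniq fl); apply: (@cder_near _ (fun w => f c + S w * (w - c))).
    by apply/cnbhsP; exists s => // w /SE ->.
  by exists S; split => // w; rewrite subrr mulr0 addr0.
move=> z zr; have [->|zc] := eqVneq z c.
  have [m dS] := Sder c cc; exists m; apply: cder_near dS; apply/cnbhsP; exists s => // w ws.
  rewrite /k; case: eqP => [->|/eqP wc]; first by rewrite lS.
  by rewrite (SE w ws) addrAC subrr add0r mulfK // subr_eq0.
have [m fz] := fr z zr.
eexists; apply: (@cder_near _ (fun w => (f w - f c) / (w - c))).
  by apply: filterS (near_neq zc) => w /negbTE wc; rewrite /k wc.
apply: cderM; first by apply: cderB; [exact: fz | exact: cder_cst].
apply: cderV; first by rewrite subr_eq0.
by apply: cderB; [exact: cder_id | exact: cder_cst].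
Qed.

(** The product [(z - c) * (f z - f c)] is differentiable even at [c], with derivative 0; dividing
    it by z - c through [dslope] gives back f - f c. *)
Lemma removable f c r : 0 < r -> (forall z, nm (z - c) < r -> z != c -> exists m, cder f z m) ->
  tends (cnbhs c) f (f c) -> holo f c r.
Proof.
move=> r0 fP cf; pose g z := (z - c) * (f z - f c).
have g0 : cder g c 0.
  exists (fun z => f z - f c); split.
  - by apply: tendsB => //; exact: tends_cst.
  - by rewrite subrr.
  - by move=> w; rewrite /g subrr mul0r add0r mulrC.
have gr : holo g c r.
  move=> z zr; have [->|zc] := eqVneq z c; first by exists 0.
  have [m fz] := fP z zr zc; eexists; apply: cderM.
    by apply: cderB; [exact: cder_id | exact: cder_cst].
  by apply: cderB; [exact: fz | exact: cder_cst].
have [k kr kE] := dslope r0 gr.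
have gc : g c = 0 by rewrite /g subrr mul0r.
have kc : k c = 0.
  apply: (cder_uniq _ g0); exists k; split => //.
    by apply: (holo_continuous kr); rewrite subrr nm0.
  by move=> w; rewrite kE mulrC.
have fE z : f z = f c + k z.
  have [->|zc] := eqVneq z c; first by rewrite kc addr0.
  have := kE z; rewrite gc add0r /g => /(mulfI (_ : z - c != 0)) <-; last by rewrite subr_eq0.
  by rewrite addrC subrK.
move=> z zr; have [m dk] := kr z zr; exists (0 + m).
rewrite (_ : f = fun z => f c + k z); last exact/funext.
by apply: cderD => //; exact: cder_cst.
Qed.

(** Multiplication by z - c turns a bounded function into one that tends to 0 at [c]; [removable]
    and then [dslope] apply to it. *)
Lemma removable_bounded f c r (M : R) : 0 < r ->
  (forall z, nm (z - c) < r -> z != c -> exists m, cder f z m) ->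
  (forall z, nm (z - c) < r -> z != c -> nm (f z) <= M) ->
  exists2 k, holo k c r & forall z, z != c -> k z = f z.
Proof.
move=> r0 fP fM; pose u z := (z - c) * f z.
have uc : u c = 0 by rewrite /u subrr mul0r.
have ur : holo u c r.
  apply: removable => // [z zr zc|].
    have [m fz] := fP z zr zc; eexists; apply: cderM; last exact: fz.
    by apply: cderB; [exact: cder_id | exact: cder_cst].
  rewrite uc => e e0; pose K := `|M| + 1.
  have K0 : 0 < K by rewrite ltr_wpDl.
  have eK : 0 < Num.min r (e / K) by rewrite lt_min r0 divr_gt0.
  apply: filterS (near_nm c eK) => z; rewrite subr0 lt_min => /andP[zr ze].
  have [->|zc] := eqVneq z c; first by rewrite uc nm0.
  rewrite /u nmM; apply: (@le_lt_trans _ _ (nm (z - c) * K)).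
    apply: ler_wpM2l; first exact: nm_ge0.
    apply: le_trans (fM z zr zc) _; apply: le_trans (ler_norm _) _.
    by rewrite /K lerDl.
  by rewrite -ltr_pdivlMr.
have [k kr kE] := dslope r0 ur; exists k => // z zc.
have := kE z; rewrite uc add0r /u => /(mulfI (_ : z - c != 0)) <- //.
by rewrite subr_eq0.
Qed.

Lemma liouville0 g : (forall z, exists m, cder g z m) ->
  (forall e : R, 0 < e -> exists r, forall z, r < nm z -> nm (g z) <= e) -> forall z, g z = 0.
Proof.
move=> gP g0 z; apply/eqP; rewrite -nm_eq0; apply/eqP/le_anti/andP; split; last exact: nm_ge0.
apply/ler_addgt0Pl => e e0; rewrite addr0.
have e2 : 0 < e / 2 by rewrite divr_gt0.
have [r rP] := g0 _ e2.
pose s := nm z + `|r| + 1.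
have s0 : 0 < s by rewrite /s; have := nm_ge0 z; have := normr_ge0 r; lra.
rewrite (_ : e = 2 * (e / 2)); last by field.
apply: (@max_bound _ _ s (s + 1)) => //; first by lra.
move=> th _; set t := circ z s th; have ts : nm (t - z) = s by rewrite circ_dist // ltW.
apply: rP; have := nm_lb (t - z) (- z); rewrite opprK subrK nmN ts /s.
by have := ler_norm r; have := nm_ge0 z; lra.
Qed.

(** Induction on the list: the singularity at the head is removed on a disc that misses the
    remaining points. A head that occurs again in the tail is simply dropped. *)
Lemma liouville_punctured (S : seq C) g :
  (forall z, z \notin S -> exists m, cder g z m) ->
  (forall s, s \in S -> exists M : R, exists2 r, 0 < r &
    forall z, nm (z - s) < r -> z != s -> nm (g z) <= M) ->
  (forall e : R, 0 < e -> exists r, forall z, r < nm z -> nm (g z) <= e) ->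
  forall z, z \notin S -> g z = 0.
Proof.
elim: S g => [|s S IH] g gP gM g0 z zS.
  by apply: liouville0 => // t; exact: gP.
have gtail s' : s' \in S -> exists M : R, exists2 r, 0 < r &
    forall z, nm (z - s') < r -> z != s' -> nm (g z) <= M.
  by move=> s'S; apply: gM; rewrite inE s'S orbT.
have [sS|sS] := boolP (s \in S).
  apply: IH => // [t tS|]; last by move: zS; rewrite inE negb_or => /andP[].
  by apply: gP; rewrite inE negb_or tS andbT; apply: contraNneq tS => ->.
have [M [r r0 rM]] := gM s (mem_head _ _).
have [d d0 dP] : exists2 d : R, 0 < d & forall t, t \in S -> d <= nm (t - s).
  elim: S sS {IH gP gM zS gtail} => [|t S IH]; first by exists 1.
  rewrite inE negb_or => /andP[st /IH[d d0 dP]].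
  exists (Num.min d (nm (t - s))); first by rewrite lt_min d0 nm_gt0 subr_eq0 eq_sym.
  move=> t'; rewrite inE => /predU1P[->|/dP]; first by rewrite ge_min lexx orbT.
  by move=> dt; rewrite ge_min dt.
pose q := Num.min r d.
have q0 : 0 < q by rewrite lt_min r0.
have [k kq kE] : exists2 k, holo k s q & forall z, z != s -> k z = g z.
  apply: (@removable_bounded _ _ _ M) => // t; rewrite lt_min => /andP[tr td] ts.
    apply: gP; rewrite inE negb_or ts /=; apply: contraTN td => /dP.
    by rewrite leNgt.
  exact: rM.
have zs : z != s by move: zS; rewrite inE negb_or => /andP[].
rewrite -kE //; apply: IH => //.
- move=> t tS; have [->|ts] := eqVneq t s; first by apply: kq; rewrite subrr nm0.
  have [|m gt] := gP t; first by rewrite inE negb_or ts.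
  exists m; apply: cder_near gt.
  by apply: filterS (near_neq ts) => w ws; rewrite kE.
- move=> t tS; have [N [r' r'0 r'N]] := gtail t tS; exists N.
  exists (Num.min r' d) => // [|w]; first by rewrite lt_min r'0.
  rewrite lt_min => /andP[wr wd] wt; rewrite kE; first exact: r'N.
  by apply: contraTneq wd => ->; rewrite -leNgt nmC dP.
- move=> e e0; have [r' r'P] := g0 e e0; exists (Num.max r' (nm s)) => w.
  rewrite gt_max => /andP[wr ws]; rewrite kE; first exact: r'P.
  by apply: contraTneq ws => ->; rewrite ltxx.
- by move: zS; rewrite inE negb_or => /andP[].
Qed.

(** Divide by w - c as long as the value at [c] is 0. If this never stops, [f] is divisible by every
    power of w - c with holomorphic quotient. Comparing [nm (w - c) < d] with a distance of at least
    [2 * d] on a circle around [w] then gives [nm (f w) <= 2 * M / 2 ^+ n] for a suitable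
    arbitrarily large [n]. *)
Lemma isolated_zero f c r : 0 < r -> holo f c r ->
  (\forall w \near cnbhs c, f w = 0) \/
  exists n, exists k, [/\ holo k c r, k c != 0 & forall w, f w = (w - c) ^+ n * k w].
Proof.
move=> r0 fr; have [|H] := pselect (exists n, exists k,
  [/\ holo k c r, k c != 0 & forall w, f w = (w - c) ^+ n * k w]); first by right.
left; have all n : exists2 k, holo k c r & forall w, f w = (w - c) ^+ n * k w.
  elim: n => [|n [k kr kE]]; first by exists f => // w; rewrite expr0 mul1r.
  have [kc|kc] := eqVneq (k c) 0; last by case: H; exists n, k.
  have [k' k'r k'E] := dslope r0 kr; exists k' => // w.
  by rewrite kE k'E kc add0r mulrA exprSr.
pose d := r / 8; have d0 : 0 < d by rewrite divr_gt0.
apply/cnbhsP; exists d => // w wd.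
have rd : r = 8 * d by rewrite /d; field.
have fw : holo f w (6 * d) by apply: holo_sub fr _; lra.
have cu : integrand 0 (2 * pi) (fun th => f (circ w (4 * d) th)).
  by apply: (@integrand_circ _ _ _ (6 * d)) => //; lra.
apply/eqP; rewrite -nm_eq0; apply/eqP/le_anti/andP; split; last exact: nm_ge0.
have [M M0 fM] := integrand_bounded (ltW pi2) cu.
apply/ler_addgt0Pl => e e0; rewrite addr0.
pose n := Num.bound (2 * M / e).
have ne : 2 * M / 2 ^+ n <= e.
  rewrite ler_pdivrMr ?exprn_gt0 // [leRHS]mulrC -ler_pdivrMr // ltW //.
  exact: upper_nthrootP.
apply: le_trans ne; have [k kr kE] := all n.
have kM : nm (k w) <= 2 * (M / (2 * d) ^+ n).
  apply: (@max_bound _ _ (4 * d) (6 * d)); [lra | lra | by apply: holo_sub kr _; lra |].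
  move=> th th1; set z := circ w (4 * d) th; have zc : 2 * d <= nm (z - c).
    have zw : nm (z - w) = 4 * d by rewrite circ_dist // mulr_ge0 // ltW.
    by have := nm_triangle c z w; have := nmC c w; lra.
  rewrite ler_pdivlMr ?exprn_gt0 ?mulr_gt0 //.
  apply: le_trans (fM th th1); rewrite -/z; rewrite kE nmM nmX mulrC ler_wpM2r ?nm_ge0 //.
  by apply: lerXn2r; rewrite ?nnegrE ?nm_ge0 // mulr_ge0 // ltW.
rewrite kE nmM nmX.
have h1 : nm (w - c) ^+ n <= d ^+ n by apply: lerXn2r; rewrite ?nnegrE ?nm_ge0 ?ltW.
apply: le_trans (ler_pM _ _ h1 kM) _; rewrite ?exprn_ge0 ?nm_ge0 //.
rewrite [(2 * d) ^+ n]exprMn le_eqVlt; apply/orP; left; apply/eqP.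
by field; rewrite !expf_neq0 // gt_eqF.
Qed.

(** f z - f w is z - w times a divided difference that is Lipschitz in each variable and takes the
    value [l] at (c, c); it remains nonzero nearby. *)
Lemma holo_inj f c r l : 0 < r -> holo f c r -> cder f c l -> l != 0 ->
  exists2 s : R, 0 < s & forall z w, nm (z - c) < s -> nm (w - c) < s -> f z = f w -> z = w.
Proof.
move=> r0 fr fl l0; pose s := r / 2.
have [s0 sr] : 0 < s /\ s < r by rewrite /s; lra.
set u := fun th => f (circ c s th) * (circ c s th - c).
have cu : integrand 0 (2 * pi) u by exact: integrand_cauchy (ltW s0) sr fr.
have cc : nm (c - c) < s by rewrite subrr nm0.
pose d := s / 2; have d0 : 0 < d by rewrite divr_gt0.
have [K K0 KP] := @ctr2_lip _ u c s s0 cu d d0.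
have lE : l = (2 * pi)%:C%C^-1 * ctr2 u c s c c.
  apply: (cder_uniq fl).
  apply: (@cder_near _ (fun z => f c + (2 * pi)%:C%C^-1 * ctr2 u c s z c * (z - c))).
    apply/cnbhsP; exists s => // z zs.
    by rewrite mulrC -(cauchy_slope s0 sr fr) // addrCA subrr addr0.
  exists (fun z => (2 * pi)%:C%C^-1 * ctr2 u c s z c); split => //; last first.
    by move=> z; rewrite subrr mulr0 addr0.
  apply: tendsM; first exact: tends_cst.
  move=> e e0; have eK : 0 < Num.min d (e / K) by rewrite lt_min d0 divr_gt0.
  apply: filterS (near_nm c eK) => z; rewrite lt_min => /andP[zd ze].
  apply: le_lt_trans (KP z c c _ _ _) _; rewrite ?subrr ?nm0; try by rewrite /d; lra.
    by rewrite /d in zd *; lra.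
  by rewrite mulrC -ltr_pdivlMr.
have Q0 : ctr2 u c s c c != 0 by apply: contra_neq l0 => e; rewrite lE e mulr0.
pose q := nm (ctr2 u c s c c); have q0 : 0 < q by rewrite nm_gt0.
exists (Num.min d (q / (2 * K))); first by rewrite lt_min d0 divr_gt0 // mulr_gt0.
move=> z w; rewrite !lt_min => /andP[zd zq] /andP[wd wq] fzw.
have sd : s = 2 * d by rewrite /d; field.
have h1 : nm (ctr2 u c s z w - ctr2 u c s c w) <= K * nm (z - c).
  by apply: KP; rewrite ?subrr ?nm0; lra.
have h2 : nm (ctr2 u c s c w - ctr2 u c s c c) <= K * nm (w - c).
  by rewrite (ctr2C u c s c w); apply: KP; rewrite ?subrr ?nm0; lra.
have b1 : K * nm (z - c) < q / 2 by rewrite mulrC -ltr_pdivlMr // -mulrA -invfM.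
have b2 : K * nm (w - c) < q / 2 by rewrite mulrC -ltr_pdivlMr // -mulrA -invfM.
have Qzw : ctr2 u c s z w != 0.
  apply: contraTneq (nm_triangle (ctr2 u c s c w) (ctr2 u c s z w) (ctr2 u c s c c)).
  move=> e; rewrite -ltNge; apply: le_lt_trans (lerD h1 h2) _.
  rewrite e sub0r nmN -/q; lra.
have zs : nm (z - c) < s by lra.
have ws : nm (w - c) < s by lra.
have := cauchy_slope s0 sr fr zs ws; rewrite fzw subrr => /esym/eqP.
by rewrite mulf_eq0 subr_eq0 mulf_eq0 invr_eq0 (negbTE pi2C) (negbTE Qzw) !orbF => /eqP.
Qed.

(** If [v] were omitted, 1 / (f - v) would be holomorphic, with a value at [c] too large for the
    bound that [max_bound] draws from a circle on which [f] stays away from [f c]. *)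
Lemma open_mapping f c r : 0 < r -> holo f c r ->
  (\forall z \near pnbhs c, f z != f c) ->
  forall s : R, 0 < s -> exists2 d : R, 0 < d &
    forall v, nm (v - f c) < d -> exists2 z, nm (z - c) < s & f z = v.
Proof.
move=> r0 fr /pnbhsP[t t0 tP] s s0.
pose q := Num.min r (Num.min t s).
have q0 : 0 < q by rewrite !lt_min r0 t0 s0.
have [qr [qt qs]] : q <= r /\ q <= t /\ q <= s.
  by rewrite /q !ge_min !lexx !orbT.
pose p := q / 2; have [p0 pq] : 0 < p /\ p < q by rewrite /p; lra.
have fq : holo f c q by apply: holo_sub fr _; rewrite subrr nm0 add0r.
have nz th : f (circ c p th) - f c != 0.
  rewrite subr_eq0; apply: tP; first by rewrite circ_dist ?ltW //; lra.
  by rewrite -subr_eq0 -nm_gt0 circ_dist ?ltW.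
have ci : integrand 0 (2 * pi) (fun th => (f (circ c p th) - f c)^-1).
  move=> th th1; apply: tendsV; first exact: nz.
  apply: tendsB; last exact: tends_cst.
  exact: (integrand_circ (ltW p0) pq fq th1).
have [M M0 MP] := integrand_bounded (ltW pi2) ci.
(* On the circle |f - v| is at least 1/M - 1/(4M) = 3/(4M). With the factor 2 of [max_bound], |f c -
   v| is at least 3/(8M), which exceeds the radius chosen here. *)
exists (1 / (4 * M)); first by rewrite divr_gt0 // mulr_gt0.
move=> v vd; apply: contrapT => nsol.
have {}nsol z : nm (z - c) < s -> f z - v != 0.
  by move=> zs; rewrite subr_eq0; apply/eqP => fz; apply: nsol; exists z.
have gq : holo (fun z => (f z - v)^-1) c q.
  move=> z zq; have [m fz] := fq z zq; eexists; apply: cderV; first by apply: nsol; lra.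
  by apply: cderB; [exact: fz | exact: cder_cst].
have nv0 : 0 < nm (f c - v) by rewrite nm_gt0 nsol // subrr nm0.
have : nm (f c - v)^-1 <= 2 * (4 * M / 3).
  apply: (max_bound p0 pq gq) => th th1.
  have pc : nm (circ c p th - c) < s by rewrite circ_dist ?ltW //; lra.
  have h0 := nsol _ pc; have := MP th th1; rewrite !nmV => h1.
  have nz1 : 0 < nm (f (circ c p th) - f c) by rewrite nm_gt0.
  have h2 : M^-1 <= nm (f (circ c p th) - f c) by rewrite -[leRHS]invrK lef_pV2 // posrE invr_gt0.
  have h3 := nm_lb (f (circ c p th) - f c) (v - f c).
  have e3 : f (circ c p th) - f c - (v - f c) = f (circ c p th) - v by ring.
  rewrite e3 in h3.
  have e4 : (4 * M / 3)^-1 = M^-1 - 1 / (4 * M) by field; rewrite gt_eqF.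
  rewrite -[leRHS]invrK lef_pV2 ?posrE ?nm_gt0 ?invr_gt0 ?divr_gt0 ?mulr_gt0 //.
  by rewrite e4; lra.
rewrite nmV => le1; have : (2 * (4 * M / 3))^-1 <= nm (f c - v).
  by rewrite -[leRHS]invrK lef_pV2 // posrE ?invr_gt0 ?mulr_gt0 ?divr_gt0 ?mulr_gt0.
rewrite nmC; have -> : (2 * (4 * M / 3))^-1 = 3 / 2 * (1 / (4 * M)).
  by field; rewrite gt_eqF.
have : 0 < 1 / (4 * M) by rewrite divr_gt0 // mulr_gt0.
lra.
Qed.

End HolomorphicFunctions.

(** * Finite products and their growth *)

Section Products.
Context {R : realType}.
Local Notation C := (Cplx R).

Lemma cder_prod {I : Type} (r : seq I) (P : pred I) (G : I -> C -> C) (z : C) :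
  (forall i, P i -> exists l, cder (G i) z l) ->
  exists l, cder (fun w => \prod_(i <- r | P i) G i w) z l.
Proof.
move=> dG; elim: r => [|i r [l dl]].
  by exists 0; apply: cder_near (cder_cst 1 z); apply: nearW => w; rewrite big_nil.
have [Pi|nPi] := boolP (P i); last first.
  exists l; apply: cder_near dl; apply: nearW => w.
  by rewrite big_cons (negbTE nPi).
have [m dm] := dG i Pi; eexists; apply: cder_near (cderM dm dl).
by apply: nearW => w; rewrite big_cons Pi.
Qed.

Lemma tends_bounded {T} (F : set_system T) {FF : Filter F} (u : T -> C) (a : C) :
  tends F u a -> exists2 M : R, 0 < M & \forall x \near F, nm (u x) <= M.
Proof.
move=> ua; exists (nm a + 1); first by have := nm_ge0 a; lra.
apply: filterS (ua 1 ltr01) => x xa; have := nm_triangle a (u x) 0.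
by rewrite !subr0; lra.
Qed.

Lemma tends_away {T} (F : set_system T) {FF : Filter F} (u : T -> C) (a : C) :
  tends F u a -> a != 0 -> exists2 m : R, 0 < m & \forall x \near F, m <= nm (u x).
Proof.
move=> ua; rewrite -nm_gt0 => a0; exists (nm a / 2); first by rewrite divr_gt0.
have a2 : 0 < nm a / 2 by rewrite divr_gt0.
apply: filterS (ua _ a2) => x xa; have := nm_triangle (u x) a 0.
by rewrite !subr0 (nmC a); lra.
Qed.

Lemma near_notin_C (s : seq C) (z : C) : z \notin s -> \forall w \near cnbhs z, w \notin s.
Proof.
elim: s => [|c s IH]; first by move=> _; exact: nearW.
rewrite inE negb_or => /andP[zc /IH zs].
by apply: filterS2 (near_neq zc) zs => w wc ws; rewrite inE negb_or wc.
Qed.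

Lemma near_pnotin_C (s : seq C) (z : C) : \forall w \near pnbhs z, w \notin s.
Proof.
elim: s => [|c s IH]; first exact: nearW.
have : \forall w \near pnbhs z, w != c.
  have [->|zc] := eqVneq z c; first by apply/pnbhsP; exists 1.
  exact/pnbhs_cnbhs/near_neq.
by apply: filterS2 IH => w ws wc; rewrite inE negb_or wc.
Qed.

Lemma prod_growth (s : seq C) : exists M : R, forall z, M < nm z ->
  (nm z / 2) ^+ size s <= nm (\prod_(c <- s) (z - c)) <= (2 * nm z) ^+ size s.
Proof.
elim: s => [|c s [M MP]]; first by exists 0 => z _; rewrite big_nil nm1 !expr0 lexx.
exists (Num.max M (2 * nm c)) => z; rewrite gt_max => /andP[/MP/andP[h1 h2] zc].
rewrite big_cons nmM !exprS.
have z0 := nm_ge0 z; have c0 := nm_ge0 c.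
have h3 := nm_lb z c; have h4 := nmB z c.
have z2 : 0 <= nm z / 2 by rewrite divr_ge0.
have p0 := nm_ge0 (\prod_(c <- s) (z - c)).
apply/andP; split; apply: ler_pM => //; rewrite ?exprn_ge0 ?nm_ge0 //; lra.
Qed.

Lemma prod_le_exp {I : finType} (P : pred I) (g : I -> R) (B : R) (n : nat) :
  1 <= B -> (forall i, P i -> 0 <= g i <= B) -> (#|I| <= n)%N ->
  \prod_(i | P i) g i <= B ^+ n.
Proof.
move=> B1 gB In; apply: (@le_trans _ _ (\prod_(i | P i) B)); first exact: ler_prod.
rewrite big_const iter_mulr mulr1 ler_weXn2l //.
by apply: leq_trans In; exact: max_card.
Qed.

End Products.

(** * Connectedness of the punctured disc *)

Section PuncturedDisc.
Context {R : realType}.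
Local Notation C := (Cplx R).

(* Two points of a punctured disc are joined by at most two segments avoiding the
   centre. *)
Lemma punctured_disc_const (P : nat -> C -> Prop) (z0 : C) (r : R) : 0 < r ->
  (forall z, nm (z - z0) < r -> z != z0 -> exists k, P k z) ->
  (forall k l z, nm (z - z0) < r -> z != z0 -> P k z -> P l z -> k = l) ->
  (forall k z, nm (z - z0) < r -> z != z0 -> P k z -> \forall w \near cnbhs z, P k w) ->
  exists k, forall z, nm (z - z0) < r -> z != z0 -> P k z.
Proof.
move=> r0 ex un op.
have seg k z w : nm (z - z0) < r -> nm (w - z0) < r ->
    (forall t : R, 0 <= t <= 1 -> z + t%:C%C * (w - z) != z0) -> P k z -> P k w.
  move=> zr wr av Pz; pose g (t : R) : C := z + t%:C%C * (w - z).
  have gr t : 0 <= t <= 1 -> nm (g t - z0) < r.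
    move=> t1; have -> : g t - z0 = (1 - t)%:C%C * (z - z0) + t%:C%C * (w - z0).
      by rewrite /g rmorphB /=; ring.
    apply: le_lt_trans (nmD _ _) _; rewrite !nmM !nm_real !ger0_norm; [|lra|lra].
    have [t0|t0] := eqVneq t 0; first by rewrite t0 subr0 mul0r mul1r addr0.
    have tp : 0 < t by rewrite lt_def t0; case/andP: t1.
    have h1 : t * nm (w - z0) < t * r by rewrite ltr_pM2l.
    have h2 : (1 - t) * nm (z - z0) <= (1 - t) * r by apply: ler_wpM2l; lra.
    lra.
  have cg t : tends (nbhs t) g (g t).
    apply: (@rder_continuous _ _ _ (0 + (1 * (w - z) + t%:C%C * 0))).
    apply: rderD; first exact: rder_cst.
    by apply: rderM; [exact: rder_real | exact: rder_cst].
  have nearP l t : 0 <= t <= 1 -> P l (g t) -> \forall s \near t, P l (g s).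
    move=> t1 Pt; have /cnbhsP[s s0 sP] := op l (g t) (gr t t1) (av t t1) Pt.
    by apply: filterS (cg t s s0) => u; exact: sP.
  pose I := [set t : R | 0 <= t <= 1].
  have cI : connected I.
    have -> : I = `[0, 1]%classic by apply/seteqP; split => t; rewrite /= in_itv.
    exact: segment_connected.
  pose B := [set t | I t /\ P k (g t)].
  have BI : B = I.
    apply: cI.
    - by exists 0; split; [rewrite /I /= lexx ler01 | rewrite /g mul0r addr0].
    - exists (interior [set t | I t -> P k (g t)]); first exact: open_interior.
      apply/seteqP; split => t [t1 tP]; split => //; last exact: (interior_subset tP).
      by apply: filterS (nearP k t t1 tP) => s Ps _.
    - exists (~` interior [set t | I t -> ~ P k (g t)]).
        by apply: open_closedC; exact: open_interior.
      apply/seteqP; split => t [t1 tP]; split => //.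
        by move=> /interior_subset /(_ t1).
      have [l Pl] := ex (g t) (gr t t1) (av t t1).
      have [<-//|kl] := eqVneq l k; exfalso; apply: tP.
      apply: filterS (nearP l t t1 Pl) => s Ps s1 Pk.
      by move/eqP: kl; apply; apply: un Ps Pk; [exact: gr | exact: av].
  have : B 1 by rewrite BI /I /= lexx ler01.
  by move=> [_]; rewrite /g mul1r addrC subrK.
have tot k z w : nm (z - z0) < r -> z != z0 -> nm (w - z0) < r -> w != z0 -> P k z -> P k w.
  move=> zr zn wr wn Pz.
  have [[t t1 tE]|H'] := pselect (exists2 t : R, 0 <= t <= 1 & z + t%:C%C * (w - z) = z0); last first.
    apply: seg zr wr _ Pz => t t1; apply/eqP => tE; apply: H'; by exists t.
  (* Here the centre lies on the segment from z to w; the detour passes through z turned by a right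
     angle around the centre. *)
  pose v := z0 + 'i%C * (z - z0).
  have vz : v - z0 = 'i%C * (z - z0) by rewrite /v addrAC subrr add0r.
  have vr : nm (v - z0) < r by rewrite vz nmM nm_i mul1r.
  have zz : z - z0 != 0 by rewrite subr_eq0.
  have wz : w - z0 != 0 by rewrite subr_eq0.
  have ni (u1 u2 : R) : u1%:C%C + u2%:C%C * 'i%C = 0 :> C -> u1 = 0 /\ u2 = 0.
    by move=> /eqP; rewrite eq_complex /= => /andP[/eqP + /eqP]; rewrite !(mul0r, mulr0, mulr1, subr0, addr0, add0r) => -> ->.
  have tw : (1 - t)%:C%C * (z - z0) + t%:C%C * (w - z0) = 0.
    rewrite rmorphB /=; move/eqP: tE; rewrite -subr_eq0 => /eqP <-; ring.
  have t0 : t != 0.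
    apply/eqP => t0; move: tw; rewrite t0 mul0r addr0 subr0 mul1r => /eqP.
    by rewrite (negbTE zz).
  have tn : t%:C%C != 0 :> C by rewrite -nm_gt0 nm_real normr_gt0.
  have wE : w - z0 = (- (1 - t) / t)%:C%C * (z - z0).
    apply: (mulfI tn); rewrite mulrA -rmorphM /= mulrCA divff // mulr1 rmorphN /= mulNr.
    by apply/eqP; rewrite -addr_eq0 addrC tw.
  have Pv : P k v.
    apply: seg zr vr _ Pz => s s1; rewrite -subr_eq0.
    have -> : z + s%:C%C * (v - z) - z0 = ((1 - s)%:C%C + s%:C%C * 'i%C) * (z - z0).
      by rewrite /v rmorphB /=; ring.
    rewrite mulf_neq0 //; apply/eqP => /ni[? ?]; lra.
  apply: seg vr wr _ Pv => s s1; rewrite -subr_eq0.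
  have -> : v + s%:C%C * (w - v) - z0 = ((s * (- (1 - t) / t))%:C%C + (1 - s)%:C%C * 'i%C) * (z - z0).
    transitivity (s%:C%C * (w - z0) + (1 - s)%:C%C * ('i%C * (z - z0))).
      by rewrite rmorphB /= /v; ring.
    by rewrite wE rmorphM /=; ring.
  rewrite mulf_neq0 //; apply/eqP => /ni[/eqP s0 s1'].
  have {}s1' : s = 1 by lra.
  move: s0; rewrite s1' mul1r mulf_eq0 invr_eq0 (negbTE t0) orbF oppr_eq0 => /eqP t1'.
  by move/eqP: wz; apply; rewrite wE t1' oppr0 mul0r mul0r.
pose z1 := z0 + (r / 2)%:C%C.
have z1r : nm (z1 - z0) < r by rewrite /z1 addrAC subrr add0r nm_real ger0_norm; lra.
have z1n : z1 != z0.
  by rewrite -subr_eq0 /z1 addrAC subrr add0r -nm_gt0 nm_real normr_gt0; lra.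
have [k Pk] := ex z1 z1r z1n; exists k => z zr zn.
exact: tot z1r z1n zr zn Pk.
Qed.

End PuncturedDisc.

(** * Functions on Riemann surfaces *)

Section Charts.
Context {R : realType} {X : riemannSurface R}.
Local Notation C := (Cplx R).
Implicit Types (p q : X) (i j : chart_index X) (u : X -> C) (z l : C).

Lemma near_chart_inv i p (A : set X) : chart_dom i p -> nbhs p A ->
  \forall t \near cnbhs (chart i p), A (chart_inv i t).
Proof.
move=> ip pA; have := @chart_inv_continuous R X i p ip A.
by rewrite /= chartK // => /(_ pA).
Qed.

Lemma near_codom i p : chart_dom i p -> \forall t \near cnbhs (chart i p),
  chart_dom i (chart_inv i t) /\ chart i (chart_inv i t) = t.
Proof.
move=> ip; have : nbhs (chart i p) (chart i @` chart_dom i).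
  by apply: open_nbhs_nbhs; split; [exact: chart_codom_open | exists p].
by apply: filterS => _ [q iq <-]; rewrite chartK.
Qed.

Lemma near_dom i p : chart_dom i p -> \forall q \near p, chart_dom i q.
Proof. by move=> ip; apply: open_nbhs_nbhs; split; [exact: chart_dom_open|]. Qed.

Lemma tends_chart i p : chart_dom i p -> tends (nbhs p) (chart i) (chart i p).
Proof. by move=> ip; apply/tendsP; exact: chart_continuous. Qed.

Lemma near_chart i p (A : set C) : chart_dom i p -> cnbhs (chart i p) A ->
  \forall q \near p, A (chart i q).
Proof. by move=> ip /cnbhsP[e e0 eA]; apply: filterS (tends_chart ip e0) => q; exact: eA. Qed.

Lemma near_of_chart i p (P : set X) : chart_dom i p ->
  (\forall t \near cnbhs (chart i p), P (chart_inv i t)) -> \forall q \near p, P q.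
Proof.
move=> ip /(near_chart ip); apply: filterS2 (near_dom ip) => q iq.
by rewrite /= chartK.
Qed.

Lemma pnear_of_chart i p (P : set X) : chart_dom i p ->
  (\forall t \near pnbhs (chart i p), P (chart_inv i t)) ->
  \forall q \near p, q <> p -> P q.
Proof.
move=> ip /pnbhsP[e e0 eP].
apply: filterS2 (near_dom ip) (tends_chart ip e0) => q iq qe qp.
rewrite -(chartK iq); apply: eP => //; apply/eqP => E; apply: qp.
by rewrite -(chartK iq) E chartK.
Qed.

Lemma pnear_chart_inv i p (A : set X) : chart_dom i p ->
  (\forall q \near p, q <> p -> A q) ->
  \forall t \near pnbhs (chart i p), A (chart_inv i t).
Proof.
move=> ip /(near_chart_inv ip) /(filterI (near_codom ip)) /cnbhsP[e e0 eA].
apply/pnbhsP; exists e => // t te tp; have [[_ tE] /=] := eA t te; apply.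
by move=> E; move/eqP: tp; apply; rewrite -tE E.
Qed.

Lemma tends_of_chart i p u : chart_dom i p ->
  tends (cnbhs (chart i p)) (u \o chart_inv i) (u p) -> tends (nbhs p) u (u p).
Proof. by move=> ip ut e e0; apply: (near_of_chart ip); exact: ut. Qed.

Lemma tends_chart_inv i p u l : chart_dom i p -> tends (nbhs p) u l ->
  tends (cnbhs (chart i p)) (u \o chart_inv i) l.
Proof. by move=> ip up e /up /(near_chart_inv ip). Qed.

(** The two transition maps are inverse to each other, so the chain rule forbids a zero
    derivative. *)
Lemma transition_cder i j p : chart_dom i p -> chart_dom j p ->
  exists2 l, l != 0 & cder (chart j \o chart_inv i) (chart i p) l.
Proof.
have T i' j' : chart_dom i' p -> chart_dom j' p ->
    exists l, cder (chart j' \o chart_inv i') (chart i' p) l.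
  by move=> ip jp; eexists; apply/derivable_cder/chart_transition.
move=> ip jp; have [l dl] := T i j ip jp; exists l => //.
have [m dm] := T j i jp ip.
have dm' : cder (chart i \o chart_inv j) ((chart j \o chart_inv i) (chart i p)) m.
  by rewrite /= chartK.
have nr : \forall w \near cnbhs (chart i p), ((chart i \o chart_inv j) \o (chart j \o chart_inv i)) w = id w.
  have := near_chart_inv ip (near_dom jp).
  by apply: filterS2 (near_codom ip) => w [_ wE] jw; rewrite /= chartK.
have e1 := cder_uniq (cder_near nr (cder_comp dl dm')) (cder_id _).
apply/eqP => l0; move: e1; rewrite l0 mulr0 => /eqP.
by rewrite eq_sym oner_eq0.
Qed.

Lemma cder_chart_change i j p u l : chart_dom i p -> chart_dom j p ->
  cder (u \o chart_inv i) (chart i p) l ->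
  exists2 l', cder (u \o chart_inv j) (chart j p) l' & (l' == 0) = (l == 0).
Proof.
move=> ip jp du; have [m m0 dT] := transition_cder jp ip.
have E : chart i p = (chart i \o chart_inv j) (chart j p) by rewrite /= chartK.
rewrite E in du; have D := cder_comp dT du; exists (l * m).
  apply: cder_near D; have := near_chart_inv jp (near_dom ip).
  by apply: filterS => w iw; rewrite /= chartK.
by rewrite mulf_eq0 (negbTE m0) orbF.
Qed.

Definition xhol u p := forall i, chart_dom i p ->
  exists l, cder (u \o chart_inv i) (chart i p) l.

Lemma xholP i u p l : chart_dom i p -> cder (u \o chart_inv i) (chart i p) l -> xhol u p.
Proof.
by move=> ip du j jp; have [l' dl' _] := cder_chart_change ip jp du; exists l'.
Qed.

Lemma xhol_tends u p : xhol u p -> tends (nbhs p) u (u p).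
Proof.
have [i ip] := chart_cover p => /(_ i ip)[l /cder_continuous].
by rewrite /= chartK //; exact: tends_of_chart.
Qed.

(* Order of vanishing of [u - u p]; mere continuity of the unit v suffices, and makes
   the notion compatible with the antiholomorphic sigma. *)
Definition xord u p (m : nat) := forall i, chart_dom i p -> exists2 v : C -> C,
  tends (cnbhs (chart i p)) v (v (chart i p)) /\ v (chart i p) != 0 &
  \forall t \near cnbhs (chart i p),
    u (chart_inv i t) - u p = (t - chart i p) ^+ m * v t.

(** One chart suffices: in another one the slope [phi] of the transition map is a continuous unit
    and contributes the factor [phi ^+ m]. *)
Lemma xordP i u p m v : chart_dom i p ->
  tends (cnbhs (chart i p)) v (v (chart i p)) -> v (chart i p) != 0 ->
  (\forall t \near cnbhs (chart i p),
    u (chart_inv i t) - u p = (t - chart i p) ^+ m * v t) -> xord u p m.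
Proof.
move=> ip cv v0 uE j jp; have [l l0 dT] := transition_cder jp ip.
have cT := cder_continuous dT; case: dT => phi [cphi pl TE].
have E : chart i p = (chart i \o chart_inv j) (chart j p) by rewrite /= chartK.
exists (fun t => phi t ^+ m * v ((chart i \o chart_inv j) t)); first split.
- apply: tendsM.
    elim: m {uE} => [|m IH]; first exact: tends_cst.
    rewrite exprS; apply: (@tends_near_eq _ _ _ _ (fun t => phi t * phi t ^+ m)).
      by apply: nearW => t; rewrite exprS.
    by apply: tendsM.
  by apply: tends_comp; last exact: cT; rewrite -E.
- by rewrite mulf_neq0 // ?expf_neq0 ?pl // -E.
- have /(near_chart_inv jp) := near_chart ip uE.
  apply: filterS2 (near_chart_inv jp (near_dom ip)) => t it.
  rewrite /= chartK // => ->.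
  have e : chart i (chart_inv j t) - chart i p = phi t * (t - chart j p).
    by have := TE t; rewrite /= chartK // => ->; rewrite addrAC subrr add0r.
  by rewrite e exprMn -mulrA mulrCA.
Qed.

Lemma xord1 i u p l : chart_dom i p -> cder (u \o chart_inv i) (chart i p) l ->
  l != 0 -> xord u p 1.
Proof.
move=> ip [phi [cphi pl uE]] l0; apply: (@xordP i _ _ _ phi) => //; first by rewrite pl.
apply: nearW => t; rewrite expr1.
by have := uE t; rewrite /= chartK // => ->; rewrite addrAC subrr add0r mulrC.
Qed.

Lemma xord1_cder i u p : chart_dom i p -> xord u p 1 ->
  exists2 l, l != 0 & cder (u \o chart_inv i) (chart i p) l.
Proof.
move=> ip /(_ i ip)[v [cv v0] uE]; exists (v (chart i p)) => //.
apply: (@cder_near _ (fun t => u p + v t * (t - chart i p))).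
  by apply: filterS uE => t /eqP; rewrite subr_eq expr1 mulrC addrC => /eqP <-.
by exists v; split => // w; rewrite subrr mulr0 addr0.
Qed.

Lemma xord_comp u p m (M : C -> C) l : tends (nbhs p) u (u p) -> xord u p m ->
  cder M (u p) l -> l != 0 -> xord (M \o u) p m.
Proof.
move=> cu um [phi [cphi pl ME]] l0 i ip; have [v [cv v0] uE] := um i ip.
exists (fun t => v t * phi (u (chart_inv i t))); first split.
- apply: tendsM => //; rewrite chartK //.
  apply: (@tends_comp _ _ _ _ phi (u \o chart_inv i)); first exact: cphi.
  exact: tends_chart_inv.
- by rewrite mulf_neq0 // chartK // pl.
- apply: filterS uE => t tE.
  by rewrite /= [M (u (chart_inv i t))]ME addrAC subrr add0r tE mulrC -mulrA.
Qed.

Lemma eq_near_xord u w p m : (\forall q \near p, u q = w q) -> xord u p m -> xord w p m.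
Proof.
move=> uw um i ip; have [v vP uE] := um i ip; exists v => //.
have := near_chart_inv ip uw; apply: filterS2 uE => t tE /= <-.
by rewrite -(nbhs_singleton uw).
Qed.

Lemma eq_near_xhol u w p : (\forall q \near p, u q = w q) -> xhol u p -> xhol w p.
Proof.
move=> uw uh i ip; have [l du] := uh i ip; exists l.
by apply: cder_near du; exact: near_chart_inv uw.
Qed.

Lemma xhol_comp u p (M : C -> C) l : xhol u p -> cder M (u p) l -> xhol (M \o u) p.
Proof.
move=> uh dM i ip; have [m du] := uh i ip; exists (l * m).
by apply: (cder_comp du); rewrite /= chartK.
Qed.

Lemma xhol_near u (A : set X) p : (forall q, A q -> xhol u q) -> (\forall q \near p, A q) ->
  forall i, chart_dom i p -> exists2 r : R, 0 < r & holo (u \o chart_inv i) (chart i p) r.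
Proof.
move=> uh pA i ip.
have [r r0 rP] := (cnbhsP _ _).1 (filterI (near_codom ip) (near_chart_inv ip pA)).
exists r => // z /rP[[iz zE] /uh] /(_ i iz) [m].
by rewrite zE; exists m.
Qed.

(** A continuous local section of a function of order 1 is holomorphic: solving F - x0 = phi (t -
    chart q) for the chart coordinate t shows that its slope along [S] is 1 / phi, which is
    continuous. *)
Lemma section_cder (F u : X -> C) (S : C -> X) (x0 : C) :
  (forall A, nbhs (S x0) A -> \forall x \near cnbhs x0, A (S x)) ->
  (\forall x \near cnbhs x0, F (S x) = x) ->
  xord F (S x0) 1 -> xhol u (S x0) -> exists l, cder (u \o S) x0 l.
Proof.
move=> cS fS o1 uh; set q := S x0; have [i iq] := chart_cover q.
have fq : F q = x0 := cnbhs_singleton fS.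
have [l l0 [phi [cphi pl FE]]] := xord1_cder iq o1.
pose k x := (phi (chart i (S x)))^-1.
have cchart : tends (cnbhs x0) (fun x => chart i (S x)) (chart i q).
  by move=> e e0; exact: (cS _ (tends_chart iq e0)).
have ck : tends (cnbhs x0) k (k x0).
  apply: tendsV; first by rewrite -/q pl.
  exact: (@tends_comp _ _ _ _ phi (fun x => chart i (S x)) _ _ cphi cchart).
have dchart : cder (fun x => chart i (S x)) x0 (k x0).
  apply: (@cder_near _ (fun x => chart i q + k x * (x - x0))); last first.
    by exists k; split => // w; rewrite subrr mulr0 addr0.
  have p0 : \forall x \near cnbhs x0, phi (chart i (S x)) != 0.
    apply: (@tends_neq _ _ _ _ _ (phi (chart i q))); first by rewrite pl.
    exact: (@tends_comp _ _ _ _ phi (fun x => chart i (S x)) _ _ cphi cchart).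
  apply: filterS3 p0 fS (cS _ (near_dom iq)) => x px fx ix.
  have := FE (chart i (S x)); rewrite /= !chartK // fq fx => E.
  have -> : x - x0 = phi (chart i (S x)) * (chart i (S x) - chart i q).
    by rewrite {1}E addrAC subrr add0r.
  by rewrite /k mulKf // addrCA subrr addr0.
have [m du] := uh i iq; exists (m * k x0).
apply: (@cder_near _ ((u \o chart_inv i) \o (fun x => chart i (S x)))).
  by apply: filterS (cS _ (near_dom iq)) => x ix; rewrite /= chartK.
exact: cder_comp dchart du.
Qed.

Lemma pnbhs_surface_proper p (A : set X) : (\forall q \near p, q <> p -> A q) ->
  exists2 q, q <> p & A q.
Proof.
have [i ip] := chart_cover p => pA.
have := pnear_chart_inv ip (_ : \forall q \near p, q <> p -> (A q /\ q <> p)).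
case/(_ _)/filter_ex => [|t [At tp]]; last by exists (chart_inv i t).
by apply: filterS pA => q qA qp; split => //; exact: qA.
Qed.

End Charts.

(** * Composition with the real structure *)

Section AntiholomorphicInvolution.
Context {R : realType} {X : riemannSurface R}.
Local Notation C := (Cplx R).
Variable sigma : X -> X.
Hypothesis sigma_real : antiholomorphic_involution sigma.
Implicit Types (p q : X) (i j k : chart_index X) (u : X -> C).

Let sC : continuous sigma. Proof. by case: sigma_real => -[]. Qed.
Let sK : involutive sigma. Proof. by case: sigma_real. Qed.

(** [sigma] in charts, conjugated so as to be holomorphic. *)
Let S i k : C -> C := cj \o chart k \o sigma \o chart_inv i.

Let dS i k p : chart_dom i p -> chart_dom k (sigma p) ->
  exists l, cder (S i k) (chart i p) l.
Proof.
move=> ip kp; case: sigma_real => -[_ sd] _.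
by exists (derive1 (S i k) (chart i p)); apply: derivable_cder; exact: sd.
Qed.

Let near_S i k p : chart_dom i p -> chart_dom k (sigma p) ->
  \forall t \near cnbhs (chart i p), sigma (chart_inv i t) = chart_inv k (cj (S i k t)).
Proof.
move=> ip kp; have := near_chart_inv ip (sC (near_dom kp)).
by apply: filterS => t; rewrite /= cjK => kt; rewrite chartK.
Qed.

Let S_at i k p : chart_dom i p -> S i k (chart i p) = cj (chart k (sigma p)).
Proof. by move=> ip; rewrite /S /= chartK. Qed.

(** As [sigma] is an involution, [S k i] conjugated on both sides inverts [S i k]. Nonvanishing of
    this derivative is what preserves orders in [xord_conj]. *)
Let dS_neq0 i k p : chart_dom i p -> chart_dom k (sigma p) ->
  exists2 l, l != 0 & cder (S i k) (chart i p) l.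
Proof.
move=> ip kp; have [l dl] := dS ip kp; exists l => //.
have ip' : chart_dom i (sigma (sigma p)) by rewrite sK.
have [m dm] := dS kp ip'.
have dm' : cder (cj \o S k i \o cj) (S i k (chart i p)) (cj m).
  by apply: cder_conj; rewrite S_at // cjK.
have D := cder_comp dl dm'.
have nr : \forall w \near cnbhs (chart i p), ((cj \o S k i \o cj) \o S i k) w = id w.
  apply: filterS2 (near_S ip kp) (near_codom ip) => t tE [_ it].
  by rewrite /= cjK -tE sK it.
have := cder_uniq (cder_near nr D) (cder_id _) => e1.
apply/eqP => l0; move: e1; rewrite l0 mulr0 => /eqP; by rewrite eq_sym oner_eq0.
Qed.

Lemma xhol_conj u p : xhol u (sigma p) -> xhol (cj \o u \o sigma) p.
Proof.
move=> uh i ip; have [k kp] := chart_cover (sigma p).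
have [l du] := uh k kp; have [m dSm] := dS ip kp; exists (cj l * m).
have du' : cder (cj \o (u \o chart_inv k) \o cj) (S i k (chart i p)) (cj l).
  by apply: cder_conj; rewrite S_at // cjK.
apply: cder_near (cder_comp dSm du').
by apply: filterS (near_S ip kp) => t /= ->.
Qed.

Lemma xord_conj u p m : xord u (sigma p) m -> xord (cj \o u \o sigma) p m.
Proof.
move=> um i ip; have [k kp] := chart_cover (sigma p).
have [v [cv v0] uE] := um k kp; have [l l0 dl] := dS_neq0 ip kp.
have cS := cder_continuous dl; case: dl => phi [cphi pl SE].
have cS' : tends (cnbhs (chart i p)) (cj \o S i k) (chart k (sigma p)).
  by rewrite -[chart k _]cjK -(@S_at i k p ip); exact: tends_cj.
exists (fun t => phi t ^+ m * cj (v (cj (S i k t)))); first split.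
- apply: tendsM.
    elim: m {um uE} => [|m IH]; first exact: tends_cst.
    rewrite exprS; apply: (@tends_near_eq _ _ _ _ (fun t => phi t * phi t ^+ m)).
      by apply: nearW => t; rewrite exprS.
    exact: tendsM.
  rewrite (@S_at i k p ip) cjK.
  exact: tends_cj (tends_comp cv cS').
- by rewrite mulf_neq0 ?expf_neq0 ?pl // cj_eq0 (@S_at i k p ip) cjK.
- have uE' : \forall t \near cnbhs (chart i p),
      u (chart_inv k (cj (S i k t))) - u (sigma p) =
      (cj (S i k t) - chart k (sigma p)) ^+ m * v (cj (S i k t)).
    by have /cnbhsP[e e0 eP] := uE; apply: filterS (cS' e e0) => t; exact: eP.
  apply: filterS2 (near_S ip kp) uE' => t /= -> tE.
  rewrite -cjB tE cjM cjX cjB cjK -(@S_at i k p ip) SE addrAC subrr add0r.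
  by rewrite exprMn mulrA [phi t ^+ m * _]mulrC.
Qed.

End AntiholomorphicInvolution.

(** * Coordinates on the sphere with a prescribed pole *)

Section SphereCoordinates.
Context {R : realType}.
Local Notation C := (Cplx R).
Local Notation P1 := (CP1 R).
Implicit Types (a b x z : C) (y : P1).

(** The pole is at [a] and the zero at infinity. Since the inverse of 0 is 0, the value at [Some a]
    is also 0; hence the conditions [y <> Some a] below. *)
Definition coordc a (y : P1) : C := if y is Some z then (z - a)^-1 else 0.

Definition cinv a x : P1 := if x == 0 then None else Some (a + x^-1).

Lemma cinvK a x : coordc a (cinv a x) = x.
Proof.
rewrite /cinv; case: eqP => [->//|_] /=.
by rewrite addrAC subrr add0r invrK.
Qed.

Lemma coordcK a y : y <> Some a -> cinv a (coordc a y) = y.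
Proof.
case: y => [z|] za; rewrite /cinv /=; last by rewrite eqxx.
have za0 : z - a != 0 by rewrite subr_eq0; apply: contra_notN za => /eqP ->.
by rewrite invr_eq0 (negbTE za0) invrK addrCA subrr addr0.
Qed.

Lemma cinv_neq a x : cinv a x <> Some a.
Proof.
rewrite /cinv; case: eqP => // /eqP x0 [/eqP].
by rewrite -subr_eq0 addrAC subrr add0r invr_eq0 (negbTE x0).
Qed.

Lemma coordc_cder a (b : bool) y : y <> Some a -> @chart_dom R P1 b y ->
  exists2 l, l != 0 & cder (coordc a \o @chart_inv R P1 b) (@chart R P1 b y) l.
Proof.
move=> ya; case: b => yb.
- pose w := @chart R P1 true y.
  have w1 : 1 - a * w != 0.
    rewrite /w; case: y ya yb {w} => [z|] za zb /=; last by rewrite mulr0 subr0 oner_neq0.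
    have z0 : z != 0 by apply: contra_notN zb => /eqP ->.
    rewrite subr_eq0; apply: contra_notN za => /eqP e.
    by rewrite -[z]mul1r e divfK.
  have dq : cder (fun t => 1 - a * t) w (0 - a * 1).
    by apply: cderB; [exact: cder_cst | apply: cderZ; exact: cder_id].
  have D := cderM (cder_id w) (@cderV _ (fun t => 1 - a * t) w _ w1 dq).
  exists ((1 - a * w) ^- 2); first by rewrite invr_eq0 expf_neq0.
  have -> : (1 - a * w) ^- 2 = 1 / (1 - a * w) + w * (- (0 - a * 1) / (1 - a * w) ^+ 2).
    by field.
  apply: cder_near D.
  have w1' : \forall t \near cnbhs w, 1 - a * t != 0.
    exact: (@tends_neq _ _ _ _ (fun t => 1 - a * t) _ _ w1 (cder_continuous dq)).
  apply: filterS w1' => t t1; rewrite /= /sphere_chart_inv.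
  case: eqP => [->|/eqP t0]; first by rewrite mul0r.
  rewrite /=; have -> : t^-1 - a = (1 - a * t) / t by field.
  by rewrite invfM invrK mulrC.
- case: y ya yb => [z|//] za _ /=.
  have z0 : z - a != 0 by rewrite subr_eq0; apply: contra_notN za => /eqP ->.
  exists (- (1 - 0) / (z - a) ^+ 2).
    by rewrite subr0 mulf_neq0 ?oppr_eq0 ?oner_neq0 // invr_eq0 expf_neq0.
  apply: (@cderV _ (fun t => t - a)) => //.
  by apply: cderB; [exact: cder_id | exact: cder_cst].
Qed.

Lemma coordc_ord a y : y <> Some a -> xord (coordc a) y 1.
Proof.
move=> ya; have [b yb] := chart_cover y; have [l l0 dl] := coordc_cder ya yb.
exact: xord1 yb dl l0.
Qed.

Lemma coordc_hol a y : y <> Some a -> xhol (coordc a) y.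
Proof.
move=> ya; have [b yb] := chart_cover y; have [l l0 dl] := coordc_cder ya yb.
exact: xholP yb dl.
Qed.

Lemma near_cinv a x (A : set P1) : nbhs (cinv a x) A ->
  \forall t \near cnbhs x, A (cinv a t).
Proof.
move=> xA; have [x0|x0] := eqVneq x 0.
- rewrite x0 /cinv eqxx in xA; rewrite x0.
  have d0 : @chart_dom R P1 true None by [].
  have := near_chart_inv d0 xA; rewrite /= => /cnbhsP[e e0 eA].
  have g0 : tends (cnbhs 0) (fun t => t / (1 + a * t)) (0 / (1 + a * 0)).
    apply: tendsM; first exact: tends_id.
    apply: tendsV; first by rewrite mulr0 addr0 oner_neq0.
    apply: tendsD; first exact: tends_cst.
    by apply: tendsM; [exact: tends_cst | exact: tends_id].
  have h0 : \forall t \near cnbhs (0 : C), 1 + a * t != 0.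
    apply: (@tends_neq _ _ _ _ _ (1 + a * 0)); first by rewrite mulr0 addr0 oner_neq0.
    apply: tendsD; first exact: tends_cst.
    by apply: tendsM; [exact: tends_cst | exact: tends_id].
  apply: filterS2 h0 (g0 e e0) => t t1; rewrite mul0r => /eA.
  rewrite /sphere_chart_inv /cinv.
  have [->|t0] := eqVneq t 0; first by rewrite mul0r eqxx.
  rewrite mulf_eq0 invr_eq0 (negbTE t0) (negbTE t1) /=.
  by have -> : (t / (1 + a * t))^-1 = a + t^-1 by field; rewrite t1 t0.
- rewrite /cinv (negbTE x0) in xA.
  have d0 : @chart_dom R P1 false (Some (a + x^-1)) by [].
  have := near_chart_inv d0 xA; rewrite /= => /cnbhsP[e e0 eA].
  have g0 : tends (cnbhs x) (fun t => a + t^-1) (a + x^-1).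
    by apply: tendsD; [exact: tends_cst | apply: tendsV; [|exact: tends_id]].
  apply: filterS2 (near_neq x0) (g0 e e0) => t t1 /eA.
  by rewrite /cinv (negbTE t1).
Qed.

Lemma cinv_infty a (A : set P1) : nbhs (Some a : P1) A ->
  exists M : R, forall x, M < nm x -> A (cinv a x).
Proof.
move=> aA; have d0 : @chart_dom R P1 false (Some a) by [].
have := near_chart_inv d0 aA; rewrite /= => /cnbhsP[e e0 eA].
exists e^-1 => x xe; have nx : 0 < nm x by apply: lt_trans xe; rewrite invr_gt0.
have x0 : x != 0 by rewrite -nm_gt0.
rewrite /cinv (negbTE x0); apply: (eA (a + x^-1)).
by rewrite addrAC subrr add0r nmV -[e]invrK ltf_pV2 // posrE invr_gt0.
Qed.

Lemma coordc_change a b y : y <> Some a -> coordc b y = coordc a y / (1 + (a - b) * coordc a y).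
Proof.
case: y => [z|] za /=; last by rewrite mul0r.
have za0 : z - a != 0 by rewrite subr_eq0; apply: contra_notN za => /eqP ->.
rewrite -invfM; congr _^-1; field => //.
Qed.

Lemma coordc_inj b y y' : y <> Some b -> y' <> Some b -> coordc b y = coordc b y' -> y = y'.
Proof. by move=> yb y'b e; rewrite -(coordcK yb) -(coordcK y'b) e. Qed.

End SphereCoordinates.

(** * Holomorphic maps and multiplicities *)

Section HolomorphicMap.
Context {R : realType} {X Y : riemannSurface R}.
Local Notation C := (Cplx R).
Variable f : X -> Y.
Hypothesis f_holo : holomorphic f.
Implicit Types (p q : X) (u : Y -> C).

Let fC : continuous f. Proof. by case: f_holo. Qed.

Lemma chart_map_hol (j : chart_index Y) p : chart_dom j (f p) -> xhol (chart j \o f) p.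
Proof.
move=> jp i ip; eexists; apply: derivable_cder; case: f_holo => _; apply => //.
Qed.

Lemma chart_mapK (j : chart_index Y) p u : chart_dom j (f p) ->
  \forall q \near p, ((u \o chart_inv j) \o (chart j \o f)) q = (u \o f) q.
Proof.
move=> jp; have H : \forall q \near p, chart_dom j (f q) by exact: fC (near_dom jp).
by apply: filterS H => q jq; rewrite /= chartK.
Qed.

Lemma xhol_map u p : xhol u (f p) -> xhol (u \o f) p.
Proof.
have [j jp] := chart_cover (f p) => uh; have [l du] := uh j jp.
apply: eq_near_xhol (chart_mapK u jp) _.
exact: xhol_comp (chart_map_hol jp) du.
Qed.

Lemma noncritical_ord (j : chart_index Y) p : ~ critical f p -> chart_dom j (f p) ->
  xord (chart j \o f) p 1.
Proof.
move=> nc jp; have [i0 [j0 [ip0 jp0 d0]]] : exists i0, exists j0,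
    [/\ chart_dom i0 p, chart_dom j0 (f p) & derive1 (local_expr f i0 j0) (chart i0 p) != 0].
  apply: contrapT => H; apply: nc => i0 j0 ip0 jp0; apply: contrapT => /eqP h.
  by apply: H; exists i0, j0.
have h0 : xord (chart j0 \o f) p 1.
  apply: (xord1 ip0 _ d0); apply: derivable_cder; case: f_holo => _; exact.
have [l l0 dT] := transition_cder jp0 jp.
apply: eq_near_xord (chart_mapK (chart j) jp0) _.
apply: xord_comp h0 _ l0; last exact: dT.
exact: xhol_tends (chart_map_hol jp0).
Qed.

Lemma noncritical_map_ord u p : ~ critical f p -> xord u (f p) 1 -> xord (u \o f) p 1.
Proof.
have [j jp] := chart_cover (f p) => nc uo; have [l l0 du] := xord1_cder jp uo.
apply: eq_near_xord (chart_mapK u jp) _.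
apply: xord_comp (noncritical_ord nc jp) _ l0; last exact: du.
exact: xhol_tends (chart_map_hol jp).
Qed.

Lemma noncritical_mult p : ~ critical f p -> local_mult f p = 1%N.
Proof.
move=> nc; have D i j : chart_dom i p -> chart_dom j (f p) ->
    derive1n 1 (local_expr f i j) (chart i p) != 0.
  move=> ip jp; have [l l0 dl] := xord1_cder ip (noncritical_ord nc jp).
  by have [_ E] := cder_derivable dl; rewrite derive1n1 /local_expr -compA E.
rewrite /local_mult; case: xgetP => [m mE [m0 mP]|/(_ 1%N)]; last first.
  by case; split => // i j ip jp; split; [case=> [|[|k]] | exact: D].
have [i ip] := chart_cover p; have [j jp] := chart_cover (f p).
have [mP1 _] := mP i j ip jp.
case: m {mE mP} m0 mP1 => [//|[//|m]] _ /(_ 1%N isT) E.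
by have := D i j ip jp; rewrite E eqxx.
Qed.

(** The conclusion only excludes 1, because [local_mult] is 0 by default when no order exists; this
    is all that the count in [two_points] requires. *)
Lemma critical_mult p : critical f p -> local_mult f p <> 1%N.
Proof.
move=> pc; rewrite /local_mult; case: xgetP => [m mE [m0 mP]|] // m1.
have [i ip] := chart_cover p; have [j jp] := chart_cover (f p).
have [_] := mP i j ip jp; rewrite m1 derive1n1.
by rewrite (pc i j ip jp) eqxx.
Qed.

Variable d : nat.
Hypothesis f_deg : has_degree f d.

Lemma fiber_seq y : exists s : seq X,
  [/\ uniq s, forall p, (p \in s) = (f p == y) & d = (\sum_(p <- s) local_mult f p)%N].
Proof.
have [fin sumE] := f_deg y.
exists (finmap.enum_fset (fset_set (f @^-1` [set y]))); split.
- exact: finmap.fset_uniq.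
- by move=> p; rewrite in_fset_set //; apply/idP/eqP; rewrite inE.
- by rewrite -sumE fsbig_finite.
Qed.

End HolomorphicMap.

(** * Neighbourhoods of finitely many points *)

Section Separation.
Context {T : topologicalType}.
Hypothesis hT : hausdorff_space T.
Implicit Types (p q : T) (s : seq T).

Lemma near_neq_top p q : p <> q -> \forall x \near p, x <> q.
Proof.
move=> pq; have := (hausdorff_accessible hT) => /accessible_closed_set1 /(_ q).
move=> /closed_openC o; apply: open_nbhs_nbhs; split => //.
Qed.

Lemma near_notin s p : \forall x \near p, x <> p -> x \notin s.
Proof.
elim: s => [|q s IH]; first exact: nearW.
have [->|pq] := eqVneq q p.
  by apply: filterS IH => x xs xp; rewrite inE negb_or xs // andbT; apply/eqP.
have := near_neq_top (_ : p <> q) => /(_ (fun e => negP pq (introT eqP (esym e)))).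
apply: filterS2 IH => x xs xq xp; rewrite inE negb_or xs // andbT; exact/eqP.
Qed.

Lemma near_allin {I : eqType} (s : seq I) p (W : I -> set T) :
  (forall i, i \in s -> nbhs p (W i)) -> \forall x \near p, forall i, i \in s -> W i x.
Proof.
elim: s => [|q s IH] sW; first exact: nearW.
have h1 := sW q (mem_head _ _).
have h2 : \forall x \near p, forall i, i \in s -> W i x.
  by apply: IH => r rs; apply: sW; rewrite inE rs orbT.
by apply: filterS2 h1 h2 => x xq xs r; rewrite inE => /predU1P[->|/xs].
Qed.

Lemma separate s (A : T -> set T) : (forall q, q \in s -> nbhs q (A q)) ->
  exists W : T -> set T, [/\ forall q, open (W q), forall q, q \in s -> W q q,
    forall q, q \in s -> W q `<=` A q &
    forall p q x, p \in s -> q \in s -> W p x -> W q x -> p = q].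
Proof.
move=> sA; have sep (pq : T * T) : exists AB : set T * set T, pq.1 <> pq.2 ->
    [/\ nbhs pq.1 AB.1, nbhs pq.2 AB.2 & AB.1 `&` AB.2 = set0].
  case: pq => p q /=; have [->|/eqP pq] := eqVneq p q; first by exists (set0, set0).
  move: hT; rewrite open_hausdorff => /(_ p q (introN eqP pq)) [[B1 B2] [p1 q2] [u1 u2 /eqP i0]].
  rewrite /= in p1 q2 u1 u2 i0.
  exists (B1, B2) => _; split => //=; apply: open_nbhs_nbhs; split => //.
  - by move: p1; rewrite inE.
  - by move: q2; rewrite inE.
have [AB ABP] := choice sep.
pose W q := interior (A q `&` [set x | forall r, r \in s -> r <> q ->
  (AB (q, r)).1 x /\ (AB (r, q)).2 x]).
exists W; split.
- by move=> q; exact: open_interior.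
- move=> q qs; apply: filterI; first exact: sA.
  apply: near_allin => r rs; have [->|/eqP rq] := eqVneq r q; first exact: nearW.
  have qr : q <> r by move=> e; exact: rq.
  have [h1 _ _] := ABP (q, r) qr; have [_ h2 _] := ABP (r, q) rq.
  by apply: filterS2 h1 h2.
- by move=> q qs x /interior_subset[].
- move=> p q x ps qs /interior_subset[_ xp] /interior_subset[_ xq].
  apply: contrapT => pq; have [h1 _] := xp q qs (fun e => pq (esym e)).
  have [_ h2] := xq p ps pq; have [_ _ i0] := ABP (p, q) pq.
  by have : ((AB (p, q)).1 `&` (AB (p, q)).2) x by []; rewrite i0.
Qed.

End Separation.

(** * Branched covers of the sphere *)

Section FiniteCover.
Context {R : realType} {X : riemannSurface R}.
Local Notation C := (Cplx R).
Local Notation P1 := (CP1 R).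
Variables (f : X -> P1) (d : nat).
Hypothesis X_compact : compact [set: X].
Hypothesis f_holo : holomorphic f.
Hypothesis f_deg : has_degree f d.
Hypothesis crit_inj : set_inj (critical f) f.
Variable crs : seq X.
Hypothesis crsP : forall p, (p \in crs) <-> critical f p.
Implicit Types (p q : X) (y : P1) (a : C).

Let fC : continuous f. Proof. by case: f_holo. Qed.
Let hX : hausdorff_space X. Proof. exact: rs_hausdorff. Qed.
Let hP : hausdorff_space P1. Proof. exact: rs_hausdorff. Qed.

Lemma near_map_neq q y : f q <> y -> \forall q' \near q, f q' <> y.
Proof. by move=> qy; exact: fC (near_neq_top hP qy). Qed.

Lemma near_fiber_isolated q : \forall q' \near q, q' <> q -> f q' <> f q.
Proof.
have [s [_ sP _]] := fiber_seq f_deg (f q).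
apply: filterS (near_notin hX s q) => q' q's q'q.
by move: (q's q'q); rewrite sP => /eqP.
Qed.

(** Compactness makes [f] a closed map: the image of the complement of the interior of [O] is closed
    and misses [y]. *)
Lemma fiber_near y (O : set X) : (forall q, f q = y -> nbhs q O) ->
  \forall y' \near y, forall q, f q = y' -> O q.
Proof.
move=> yO; pose K := ~` interior O.
have cK : compact K.
  apply: (@subclosed_compact _ _ [set: X]) => //.
  by apply: open_closedC; exact: open_interior.
have cfK : closed (f @` K).
  apply: compact_closed => //; apply: continuous_compact cK.
  exact: continuous_subspaceT.
have : nbhs y (~` (f @` K)).
  apply: open_nbhs_nbhs; split; first exact: closed_openC.
  by move=> [q qK /yO qO]; exact: qK.
apply: filterS => y' y'K q qy'; apply: contrapT => qO; apply: y'K.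
by exists q => // /interior_subset.
Qed.

Lemma avoid_point y : exists a, y <> Some a.
Proof.
have [->|/eqP y0] := eqVneq y (Some 0); last by exists 0.
by exists 1 => -[/esym/eqP]; rewrite oner_eq0.
Qed.

Lemma map_hol a q : f q <> Some a -> xhol (coordc a \o f) q.
Proof. by move=> qa; apply: (xhol_map f_holo); exact: coordc_hol. Qed.

Lemma map_chart_holo a q i : f q <> Some a -> chart_dom i q ->
  exists2 r : R, 0 < r & holo ((coordc a \o f) \o chart_inv i) (chart i q) r.
Proof.
move=> qa; apply: (@xhol_near _ _ _ [set q' | f q' <> Some a]).
  by move=> q'; exact: map_hol.
exact: near_map_neq.
Qed.

(** This is [open_mapping] in a coordinate whose pole is not [f q]; finiteness of the fibre excludes
    a map that is constant near [q]. *)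
Lemma f_open q (A : set X) : nbhs q A -> \forall y \near f q, exists2 q', A q' & f q' = y.
Proof.
move=> qA; have [a qa] := avoid_point (f q); have [i iq] := chart_cover q.
have [r r0 hr] := map_chart_holo qa iq.
set F := coordc a \o f in hr.
have nF : \forall z \near pnbhs (chart i q),
    (F \o chart_inv i) z != (F \o chart_inv i) (chart i q).
  rewrite [(F \o _) (chart i q)]/= chartK //.
  apply: (@pnear_chart_inv _ _ i q (fun q' => F q' != F q)) => //.
  apply: filterS2 (near_fiber_isolated q) (near_map_neq qa) => q' nq q'a q'q.
  apply: contra_notN (nq q'q) => /eqP; exact: coordc_inj.
have [s s0 sP] := (cnbhsP _ _).1 (near_chart_inv iq (filterI qA (near_map_neq qa))).
have [e e0 eP] := open_mapping r0 hr nF s0.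
rewrite /= chartK // in eP.
have n1 : \forall y \near f q, y <> Some a by exact: near_neq_top.
have n2 := xhol_tends (coordc_hol qa) e0.
apply: filterS2 n1 n2 => y ya /eP[z /sP [Az za] Fz].
by exists (chart_inv i z) => //; exact: coordc_inj Fz.
Qed.

Lemma f_locally_inj q : ~ critical f q ->
  exists2 U, nbhs q U & forall q1 q2, U q1 -> U q2 -> f q1 = f q2 -> q1 = q2.
Proof.
move=> nc; have [a qa] := avoid_point (f q); have [i iq] := chart_cover q.
have [r r0 hr] := map_chart_holo qa iq.
have o1 : xord (coordc a \o f) q 1.
  by apply: noncritical_map_ord => //; exact: coordc_ord.
have [l l0 dl] := xord1_cder iq o1.
have [s s0 sP] := holo_inj r0 hr dl l0.
exists [set q' | chart_dom i q' /\ nm (chart i q' - chart i q) < s].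
  apply: filterI; first exact: near_dom.
  exact: (tends_chart iq s0).
move=> q1 q2 /= [i1 s1] [i2 s2] e; rewrite -(chartK i1) -(chartK i2).
by congr chart_inv; apply: sP => //=; rewrite !chartK // e.
Qed.

Definition critical_value y := exists2 p, critical f p & f p = y.

Lemma near_noncritical_value y : \forall y' \near y, y' <> y -> ~ critical_value y'.
Proof.
apply: filterS (near_notin hP (map f crs) y) => y' ny' y'y [p /crsP pc py'].
by move/negP: (ny' y'y); apply; rewrite -py'; exact: map_f.
Qed.

Lemma near_noncritical_value' y : ~ critical_value y -> \forall y' \near y, ~ critical_value y'.
Proof.
move=> nc; apply: filterS (near_noncritical_value y) => y' ny'.
by have [->//|/eqP /ny'] := eqVneq y' y.
Qed.

Lemma noncritical_fiber y : ~ critical_value y -> exists s : seq X,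
  [/\ uniq s, forall p, (p \in s) = (f p == y) & size s = d].
Proof.
move=> nc; have [s [us sP dE]] := fiber_seq f_deg y; exists s; split => //.
rewrite dE -sum1_size big_seq [RHS]big_seq; apply: eq_bigr => p; rewrite sP => /eqP py.
apply/esym/(noncritical_mult f_holo) => pc; apply: nc; by exists p.
Qed.

(** [s i y] is the point over [y] in the i-th of [d] disjoint neighbourhoods of the fibre over [y0].
    It exists because [f] is open, is unique by local injectivity, and nothing else lies over [y] by
    [fiber_near]. All properties, continuity included, hold at every [y] near [y0], so they can be
    used away from the centre. *)
Lemma sheets y0 : ~ critical_value y0 -> exists s : 'I_d -> P1 -> X,
  \forall y \near y0, [/\ forall i, f (s i y) = y, injective (s^~ y),
    forall q, f q = y -> exists i, q = s i y &
    forall i A, nbhs (s i y) A -> \forall y' \near y, A (s i y')].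
Proof.
move=> nc; have [sq [usq sqP szq]] := noncritical_fiber nc.
have ncq q : q \in sq -> ~ critical f q.
  by rewrite sqP => /eqP qy qc; apply: nc; exists q.
have injU q : exists U, q \in sq ->
    nbhs q U /\ forall q1 q2, U q1 -> U q2 -> f q1 = f q2 -> q1 = q2.
  have [/ncq/f_locally_inj[U nU UP]|] := boolP (q \in sq); first by exists U.
  by exists set0.
have [U UP] := choice injU.
have [|W [oW Wq WU Wdis]] := @separate _ hX sq U; first by move=> q /UP[].
have nW q x : W q x -> nbhs x (W q) by move=> Wx; apply: open_nbhs_nbhs; split.
have [p0 _] := rs_nonempty X.
pose nq (i : 'I_d) := nth p0 sq i.
have nqs i : nq i \in sq by apply: mem_nth; rewrite szq.
pose s i y := xget p0 [set q' | W (nq i) q' /\ f q' = y].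
exists s.
have sW i y q' : W (nq i) q' -> f q' = y -> s i y = q'.
  move=> Wq' fq'; rewrite /s; case: xgetP => [q'' _ [Wq'' fq'']|/(_ q')]; last by case.
  have [_] := UP _ (nqs i); apply; rewrite ?fq' ?fq'' //; exact: (WU _ (nqs i)).
have n1 : \forall y \near y0, forall q, q \in sq -> exists2 q', W q q' & f q' = y.
  apply: near_allin => q qs; have /eqP <- : f q == y0 by rewrite -sqP.
  by apply: f_open; apply: nW; exact: Wq.
have n2 : \forall y \near y0, forall q', f q' = y -> exists2 q, q \in sq & W q q'.
  apply: fiber_near => q /eqP; rewrite -sqP => qs.
  by apply: filterS (nW q q (Wq q qs)) => q' Wq'; exists q.
apply: filterS2 n1 n2 => y h1 h2.
have sP i : W (nq i) (s i y) /\ f (s i y) = y.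
  by have [q' Wq' fq'] := h1 _ (nqs i); rewrite (sW i y q').
split.
- by move=> i; have [] := sP i.
- move=> i j e; have [Wi _] := sP i; have [Wj _] := sP j.
  rewrite -e in Wj; have := Wdis _ _ _ (nqs i) (nqs j) Wi Wj.
  by move/eqP; rewrite nth_uniq ?szq // => /eqP/ord_inj.
- move=> q fq; have [q0 q0s Wq0] := h2 q fq.
  have lt : (index q0 sq < d)%N by rewrite -szq index_mem.
  exists (Ordinal lt); apply/esym/sW => //.
  by rewrite /nq /= nth_index.
- move=> i A sA; have [Wi fi] := sP i.
  have nA : nbhs (s i y) (A `&` W (nq i)) by apply: filterI => //; exact: nW.
  have := f_open nA; rewrite fi.
  apply: filterS => y' [q' [Aq' Wq'] fq'].
  by rewrite (sW i y' q').
Qed.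

(** By counting. The other points over [f p] are noncritical by [crit_inj], hence of multiplicity 1
    with [f] injective around them. If only one point over a nearby [y] were close to [p], the
    fibres over [y] and [f p] would have equally many points, and since multiplicities add up to [d]
    over both, [p] would have multiplicity 1. *)
Lemma two_points p (U : set X) : critical f p -> nbhs p U ->
  \forall y \near f p, y <> f p -> exists q1, exists q2,
    [/\ q1 <> q2, U q1, U q2, f q1 = y & f q2 = y].
Proof.
move=> pc pU; have [s0 [us0 s0P dE]] := fiber_seq f_deg (f p).
have ps0 : p \in s0 by rewrite s0P.
have ncq q : q \in s0 -> q <> p -> ~ critical f q.
  rewrite s0P => /eqP qp qp' qc; apply: qp'; apply: crit_inj => //; exact/mem_set.
have dE' : (d + 1 = local_mult f p + size s0)%N.
  rewrite dE (big_rem p) //= -addnA; congr addn.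
  rewrite [RHS](_ : _ = (size (rem p s0)).+1); last first.
    by rewrite size_rem // prednK //; case: (s0) ps0.
  rewrite addn1; congr S; rewrite -sum1_size [LHS]big_seq [RHS]big_seq; apply: eq_bigr => q.
  rewrite (mem_rem_uniq _ us0) inE => /andP[/eqP qp /ncq /(_ qp)].
  exact: noncritical_mult.
have injA q : exists A, q \in s0 -> nbhs q A /\ (q = p -> A = U) /\
    (q <> p -> forall q1 q2, A q1 -> A q2 -> f q1 = f q2 -> q1 = q2).
  have [->|/eqP qp] := eqVneq q p; first by exists U.
  have [qs|] := boolP (q \in s0); last by exists set0.
  by have [A nA AP] := f_locally_inj (ncq _ qs qp); exists A.
have [A AP] := choice injA.
have [|W [oW Wq WA Wdis]] := @separate _ hX s0 A; first by move=> q /AP[].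
have nW q x : W q x -> nbhs x (W q) by move=> Wx; apply: open_nbhs_nbhs; split.
have n1 : \forall y \near f p, forall q, q \in s0 -> exists2 q', W q q' & f q' = y.
  apply: near_allin => q qs; have /eqP <- : f q == f p by rewrite -s0P.
  by apply: f_open; apply: nW; exact: Wq.
have n2 : \forall y \near f p, forall q', f q' = y -> exists2 q, q \in s0 & W q q'.
  apply: fiber_near => q /eqP; rewrite -s0P => qs.
  by apply: filterS (nW q q (Wq q qs)) => q' Wq'; exists q.
apply: filterS3 n1 n2 (near_noncritical_value (f p)) => y h1 h2 h3 /h3 ncy.
have [sy [usy syP szy]] := noncritical_fiber ncy.
apply: contrapT => H.
have one q q1 q2 : q \in s0 -> W q q1 -> W q q2 -> f q1 = y -> f q2 = y -> q1 = q2.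
  move=> qs W1 W2 f1 f2; have [_ [AU AI]] := AP q qs.
  have [qp|/eqP qp] := eqVneq q p; last first.
    by apply: (AI qp); rewrite ?f1 ?f2 //; exact: (WA q qs).
  apply: contrapT => q12; apply: H; exists q1, q2; split => //; rewrite -(AU qp).
    exact: (WA q qs).
  exact: (WA q qs).
have ex_rho q : exists q', q \in s0 -> W q q' /\ f q' = y.
  by have [/h1[q' Wq' fq']|] := boolP (q \in s0); [exists q' | exists q].
have ex_pi q : exists q', q \in sy -> q' \in s0 /\ W q' q.
  have [|] := boolP (q \in sy); last by exists q.
  by rewrite syP => /eqP /h2[q' q's Wq']; exists q'.
have [rho rhoP] := choice ex_rho; have [pi piP] := choice ex_pi.
have le1 : (size s0 <= size sy)%N.
  rewrite -(size_map rho); apply: uniq_leq_size.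
    rewrite map_inj_in_uniq // => q q' qs q's e.
    have [W1 _] := rhoP q qs; have [W2 _] := rhoP q' q's.
    by apply: Wdis qs q's W1 _; rewrite e.
  by move=> _ /mapP[q /rhoP[_ fq] ->]; rewrite syP fq.
have le2 : (size sy <= size s0)%N.
  rewrite -(size_map pi); apply: uniq_leq_size.
    rewrite map_inj_in_uniq // => q q' qs q's e.
    have [s1 W1] := piP q qs; have [s2 W2] := piP q' q's; rewrite -e in W2.
    apply: one s1 W1 W2 _ _; apply/eqP; by rewrite -syP.
  by move=> _ /mapP[q /piP[qs _] ->].
apply: (critical_mult pc); move: dE'; rewrite -szy; lia.
Qed.

End FiniteCover.

(** * The discriminant *)

Section Discriminant.
Context {R : realType} {X : riemannSurface R}.
Local Notation C := (Cplx R).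
Local Notation P1 := (CP1 R).
Variables (f : X -> P1) (d : nat).
Hypothesis X_compact : compact [set: X].
Hypothesis f_holo : holomorphic f.
Hypothesis f_deg : has_degree f d.
Hypothesis crit_inj : set_inj (critical f) f.
Variable crs : seq X.
Hypothesis crsP : forall p, (p \in crs) <-> critical f p.
Variable sigma : X -> X.
Hypothesis sigma_real : antiholomorphic_involution sigma.
Hypothesis crit_real : critical f `<=` real_part sigma.
(** [a] is sent to infinity by the coordinate of [F], [b] by that of [H]. By [a_gen] the critical
    values are finite; by [b_gen] no pole of [H] lies over infinity or over a critical value. Each
    exceptional value of x is thus of one kind only. *)
Variables a b : C.
Hypothesis a_gen : forall p, critical f p -> f p <> Some a.
Hypothesis b_gen : forall q, f (sigma q) = Some b ->
  f q <> Some a /\ forall p, critical f p -> f q <> f p.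
Variable bs : seq X.
Hypothesis bsP : forall q, (q \in bs) <-> f (sigma q) = Some b.
Implicit Types (p q : X) (x : C).

Let fC : continuous f. Proof. by case: f_holo. Qed.
Let sC : continuous sigma. Proof. by case: sigma_real => -[]. Qed.

Let F := coordc a \o f.
Let H := cj \o (coordc b \o f) \o sigma.
Let noncv x := ~ critical_value f (cinv a x).

Let F_of q x : f q = cinv a x -> F q = x.
Proof. by move=> e; rewrite /F /= e cinvK. Qed.

Let of_F q : f q <> Some a -> f q = cinv a (F q).
Proof. by move=> qa; rewrite /F /= coordcK. Qed.

Let crit_b p : critical f p -> f (sigma p) <> Some b.
Proof. by move=> pc pb; have [_ /(_ p pc)] := b_gen pb. Qed.

Let H_hol q : f (sigma q) <> Some b -> xhol H q.
Proof. by move=> qb; apply: (xhol_conj sigma_real); exact: map_hol. Qed.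

Lemma noncvP x : noncv x <-> x \notin map F crs.
Proof.
split=> [nx|nx [p pc px]].
  apply/mapP => -[p /crsP pc xp]; apply: nx; exists p => //.
  by rewrite xp; apply: of_F; exact: a_gen.
by move/negP: nx; apply; apply/mapP; exists p; [apply/crsP | rewrite (F_of px)].
Qed.

Lemma order_exists p : f p <> Some a -> exists m, xord F p m.
Proof.
move=> pa; have [i ip] := chart_cover p.
have [r r0 hr] := map_chart_holo f_holo pa ip.
pose u t := (F \o chart_inv i) t - F p.
have hu : holo u (chart i p) r.
  move=> z zr; have [m dm] := hr z zr; eexists; apply: cderB; first exact: dm.
  exact: cder_cst.
have [u0|[m [k [hk k0 kE]]]] := isolated_zero r0 hu.
  have n1 := pnear_chart_inv ip (near_fiber_isolated f_deg p).
  have n2 := pnbhs_cnbhs (cnbhsI u0 (near_chart_inv ip (near_map_neq f_holo pa))).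
  have [t [[/eqP ut ta] nt]] := filter_ex (pnbhsI n2 n1).
  exfalso; apply: nt; move: ut; rewrite /u subr_eq0 => /eqP.
  exact: coordc_inj.
exists m; apply: (@xordP _ _ i _ _ _ k) => //.
  by apply: (holo_continuous hk); rewrite subrr nm0.
by apply: nearW => t; exact: kE.
Qed.

(** Since [sigma] fixes [p], both functions arise from [f] at the same point. They differ by the
    Moebius change of coordinate [M], a conjugation and composition with [sigma], none of which
    alters the order. *)
Lemma H_order p m : critical f p -> xord F p m -> xord H p m.
Proof.
move=> pc Fm; have sp : sigma p = p by exact: crit_real.
have pa := a_gen pc; have pb : f p <> Some b by rewrite -{1}sp; exact: crit_b.
apply: (xord_conj sigma_real); rewrite sp.
pose M x := x / (1 + (a - b) * x).
have nz : 1 + (a - b) * F p != 0.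
  rewrite /F /=; case: (f p) pa pb => [z|] za zb /=; last by rewrite mulr0 addr0 oner_neq0.
  have za0 : z - a != 0 by rewrite subr_eq0; apply: contra_notN za => /eqP ->.
  have -> : 1 + (a - b) * (z - a)^-1 = (z - b) / (z - a) by field.
  rewrite mulf_neq0 ?invr_eq0 // subr_eq0; by apply: contra_notN zb => /eqP ->.
have dq : cder (fun x => 1 + (a - b) * x) (F p) (0 + (a - b) * 1).
  by apply: cderD; [exact: cder_cst | apply: cderZ; exact: cder_id].
have dM := cderM (cder_id (F p)) (@cderV _ (fun x => 1 + (a - b) * x) (F p) _ nz dq).
apply: (@eq_near_xord _ _ (M \o F)).
  apply: filterS (near_map_neq f_holo pa) => q qa.
  by rewrite /M /F /= [RHS](coordc_change b qa).
apply: xord_comp Fm dM _; first exact: xhol_tends (map_hol f_holo pa).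
have -> : 1 / (1 + (a - b) * F p) + F p * (- (0 + (a - b) * 1) / (1 + (a - b) * F p) ^+ 2)
    = (1 + (a - b) * F p) ^- 2 by field.
by rewrite invr_eq0 expf_neq0.
Qed.

(** The number c is the quotient of the leading coefficients of [H] and [F] in a chart at [p];
    equality of the orders makes the remainder small relative to [F - F p]. *)
Lemma slope p : critical f p -> exists c, forall e : R, 0 < e ->
  \forall q \near p, nm (H q - H p - c * (F q - F p)) <= e * nm (F q - F p).
Proof.
move=> pc; have [m Fm] := order_exists (a_gen pc); have Hm := H_order pc Fm.
have [i ip] := chart_cover p.
have [v1 [cv1 v10] FE] := Fm i ip; have [v2 [cv2 v20] HE] := Hm i ip.
exists (v2 (chart i p) / v1 (chart i p)) => e e0.
set c := _ / _; apply: (near_of_chart ip).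
have [k k0 kP] := tends_away cv1 v10.
have ek : 0 < e * k by rewrite mulr_gt0.
have t0 : tends (cnbhs (chart i p)) (fun t => v2 t - c * v1 t) 0.
  have <- : v2 (chart i p) - c * v1 (chart i p) = 0 by rewrite /c divfK // subrr.
  by apply: tendsB => //; apply: tendsM => //; exact: tends_cst.
have n1 := cnbhsI FE HE.
apply: filterS3 n1 kP (t0 _ ek) => t [E1 E2] kt; rewrite subr0 => vt.
rewrite E1 E2 (_ : _ - _ = (t - chart i p) ^+ m * (v2 t - c * v1 t)); last by ring.
rewrite !nmM mulrCA ler_wpM2l ?nm_ge0 //.
apply: le_trans (ltW vt) _; by rewrite ler_pM2l.
Qed.

Lemma local_sheets x0 : noncv x0 -> exists S : 'I_d -> C -> X,
  \forall x \near cnbhs x0, [/\ noncv x, forall i, f (S i x) = cinv a x,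
    injective (S^~ x), (forall q, f q = cinv a x -> exists i, q = S i x) &
    forall i A, nbhs (S i x) A -> \forall x' \near cnbhs x, A (S i x')].
Proof.
move=> nc; have [s sP] := sheets X_compact f_holo f_deg nc.
exists (fun i x => s i (cinv a x)).
have n1 := near_cinv (near_noncritical_value' crsP nc).
apply: filterS2 n1 (near_cinv sP) => x ncx [h1 h2 h3 h4]; split => //.
by move=> i A /h4 /near_cinv.
Qed.

Variable e : C -> 'I_d -> X.
Hypothesis eP : forall x, noncv x -> [/\ forall i, f (e x i) = cinv a x,
  injective (e x) & forall q, f q = cinv a x -> exists i, q = e x i].

Definition disc x := \prod_(k : 'I_d * 'I_d | k.1 != k.2) (H (e x k.1) - H (e x k.2)).

(** [e] enumerates each fibre with no continuity in [x]. The product is symmetric, so continuous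
    local sheets may replace [e] when derivatives or bounds are needed. *)
Lemma disc_eq x (t : 'I_d -> X) : noncv x -> (forall i, f (t i) = cinv a x) ->
  injective t -> disc x = \prod_(k : 'I_d * 'I_d | k.1 != k.2) (H (t k.1) - H (t k.2)).
Proof.
move=> nx ft it; have [fe ie se] := eP nx.
have [pi piP] := choice (fun i => se (t i) (ft i)).
have ipi : injective pi by move=> i j ij; apply: it; rewrite !piP ij.
have ih : injective (fun k : 'I_d * 'I_d => (pi k.1, pi k.2)).
  by move=> [i j] [i' j'] [/ipi -> /ipi ->].
rewrite /disc (reindex_inj ih) /=; apply: eq_big => [k|k _].
  by rewrite (inj_eq ipi).
by rewrite -!piP.
Qed.

Lemma noncritical_fib q x : noncv x -> f q = cinv a x -> ~ critical f q.
Proof. by move=> nx qx qc; apply: nx; exists q. Qed.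

Lemma fib_ord q x : noncv x -> f q = cinv a x -> xord F q 1.
Proof.
move=> nx qx; apply: (noncritical_map_ord f_holo (noncritical_fib nx qx)).
by apply: coordc_ord; rewrite qx; exact: cinv_neq.
Qed.

Lemma disc_cder x0 : noncv x0 -> x0 \notin map F bs -> exists l, cder disc x0 l.
Proof.
move=> nx nb; have [S SP] := local_sheets nx.
have nS := cnbhs_singleton SP.
have [h1 h2 h3 h4 h5] := nS.
have dS i : exists l, cder (H \o S i) x0 l.
  apply: (@section_cder _ _ F); first exact: h5.
  - by apply: filterS SP => x [_ /(_ i)/F_of].
  - exact: fib_ord nx (h2 i).
  - apply: H_hol => Sb; move/negP: nb; apply; apply/mapP.
    by exists (S i x0); [apply/bsP | rewrite (F_of (h2 i))].
have [l dl] : exists l, cder (fun x => \prod_(k : 'I_d * 'I_d | k.1 != k.2)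
    (H (S k.1 x) - H (S k.2 x))) x0 l; last first.
  exists l; apply: cder_near dl; apply: filterS SP => x [g1 g2 g3 g4 g5].
  by rewrite (disc_eq g1 g2 g3).
apply: cder_prod => k _; have [l1 d1] := dS k.1; have [l2 d2] := dS k.2.
by exists (l1 - l2); exact: cderB.
Qed.

Lemma H_bounded y : (forall q, f q = y -> f (sigma q) <> Some b) ->
  exists2 M : R, 1 <= M & \forall y' \near y, forall q, f q = y' -> nm (H q) <= M.
Proof.
move=> yb; have [s [_ sP _]] := fiber_seq f_deg y.
have s0 : 0 <= \sum_(q <- s) nm (H q) by apply: sumr_ge0 => q _; exact: nm_ge0.
exists (\sum_(q <- s) nm (H q) + 1); first by rewrite lerDr.
apply: fiber_near => // q qy; have qs : q \in s by rewrite sP qy.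
have := xhol_tends (H_hol (yb q qy)) ltr01; apply: filterS => q' hq.
have := nm_triangle (H q) (H q') 0; rewrite !subr0 => h; apply: le_trans h _.
rewrite addrC; apply: lerD; last exact: ltW.
by rewrite (big_rem q) //= lerDl; apply: sumr_ge0 => r _; exact: nm_ge0.
Qed.

(** [d * d] overcounts the factors, which is harmless because the base is at least 1. *)
Lemma disc_le x (M : R) : noncv x -> 1 <= M -> (forall q, f q = cinv a x -> nm (H q) <= M) ->
  nm (disc x) <= (2 * M) ^+ (d * d).
Proof.
move=> nx M1 HM; have [fe _ _] := eP nx; rewrite nm_prod; apply: prod_le_exp.
- by lra.
- move=> k _; rewrite nm_ge0 /=; apply: le_trans (nmB _ _) _.
  by have := HM _ (fe k.1); have := HM _ (fe k.2); lra.
- by rewrite card_prod card_ord.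
Qed.

(** The square appears because the pair of close points is a factor in both orders. *)
Lemma disc_le2 x (M del : R) q1 q2 : noncv x -> 1 <= M ->
  (forall q, f q = cinv a x -> nm (H q) <= M) -> q1 <> q2 ->
  f q1 = cinv a x -> f q2 = cinv a x -> nm (H q1 - H q2) <= del ->
  nm (disc x) <= del ^+ 2 * (2 * M) ^+ (d * d).
Proof.
move=> nx M1 HM q12 f1 f2 Hd; have [fe ie se] := eP nx.
have [i qi] := se q1 f1; have [j qj] := se q2 f2.
have ij : i != j by apply: contra_notN q12 => /eqP ij; rewrite qi qj ij.
rewrite /disc (bigD1 (i, j)) //= (bigD1 (j, i)) /=; last first.
  by rewrite eq_sym ij /= xpair_eqE negb_and ij orbT.
rewrite -qi -qj !nmM mulrA expr2.
apply: ler_pM; rewrite ?mulr_ge0 ?nm_ge0 //.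
  by apply: ler_pM; rewrite ?nm_ge0 // nmC.
rewrite nm_prod; apply: prod_le_exp.
- by lra.
- move=> k _; rewrite nm_ge0 /=; apply: le_trans (nmB _ _) _.
  by have := HM _ (fe k.1); have := HM _ (fe k.2); lra.
- by rewrite card_prod card_ord.
Qed.

Lemma disc_critical p : critical f p ->
  tends (pnbhs (F p)) (fun x => disc x / (x - F p) ^+ 2) 0.
Proof.
move=> pc eps eps0; have pa := a_gen pc; have fp := of_F pa.
have [M M1 MP] : exists2 M : R, 1 <= M &
    \forall y' \near f p, forall q, f q = y' -> nm (H q) <= M.
  apply: H_bounded => q qp qb; have [_ /(_ p pc)] := b_gen qb; exact.
pose K := (2 * M) ^+ (d * d).
have K0 : 0 < K by rewrite exprn_gt0 //; lra.
(* As [e' <= 1], the final bound is [4 * e' ^+ 2 * K <= 4 * e' * K < 8 * e' * K <= eps]. *)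
pose e' := Num.min 1 (eps / (8 * K)).
have e'0 : 0 < e' by rewrite lt_min ltr01 divr_gt0 // mulr_gt0.
have e'1 : e' <= 1 by rewrite ge_min lexx.
have e'K : e' * (8 * K) <= eps by rewrite -ler_pdivlMr ?mulr_gt0 // ge_min lexx orbT.
have [c cP] := slope pc.
have [U UP] : exists U, U = [set q | nm (H q - H p - c * (F q - F p)) <= e' * nm (F q - F p)].
  by eexists.
have nU : nbhs p U by rewrite UP; exact: cP.
have tp := two_points X_compact f_holo f_deg crit_inj crsP pc nU.
rewrite fp in MP tp.
have n1 := cnbhsI (near_cinv MP) (near_cinv tp).
have n2 : \forall x \near pnbhs (F p), x \notin map F crs by exact: near_pnotin_C.
have n3 : \forall x \near pnbhs (F p), x != F p by apply/pnbhsP; exists 1.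
have n4 := pnbhsI n2 n3.
apply: filterS2 (pnbhs_cnbhs n1) n4 => x [HM tw] [/noncvP nx xp].
have [|q1 [q2 [q12]]] := tw.
  by move=> E; move/eqP: xp; apply; rewrite -(cinvK a x) E cinvK.
rewrite UP /= => U1 U2 f1 f2.
have xp0 : 0 < nm (x - F p) by rewrite nm_gt0 subr_eq0.
have Hd : nm (H q1 - H q2) <= 2 * e' * nm (x - F p).
  rewrite -/(F q1) -/(F q2) in U1 U2.
  have E1 : coordc a (f q1) = x by rewrite f1 cinvK.
  have E2 : coordc a (f q2) = x by rewrite f2 cinvK.
  have {}U1 : nm (H q1 - H p - c * (x - F p)) <= e' * nm (x - F p) by rewrite -{1 2}(F_of f1).
  have {}U2 : nm (H q2 - H p - c * (x - F p)) <= e' * nm (x - F p) by rewrite -{1 2}(F_of f2).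
  have -> : H q1 - H q2 = (H q1 - H p - c * (x - F p)) - (H q2 - H p - c * (x - F p)) by ring.
  by apply: le_trans (nmB _ _) _; lra.
have := disc_le2 nx M1 HM q12 f1 f2 Hd; rewrite -/K subr0 nmM nmV nmX => le1.
rewrite ltr_pdivrMr ?exprn_gt0 //; apply: le_lt_trans le1 _.
rewrite exprMn mulrAC ltr_pM2r ?exprn_gt0 //.
apply: (@le_lt_trans _ _ (e' * (4 * K))).
  rewrite exprMn (_ : e' * (4 * K) = 2 ^+ 2 * (e' * 1) * K); last by ring.
  rewrite ler_pM2r // ler_pM2l // expr2 ler_pM2l //.
apply: (@lt_le_trans _ _ (e' * (8 * K))) => //.
by rewrite ltr_pM2l // ltr_pM2r // ltr_nat.
Qed.

(** The quotient of the discriminant by (x - x0)^2, extended by 0, is continuous at x0 and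
    holomorphic around it, hence holomorphic at x0; as it vanishes there, it is O(x - x0). *)
Lemma disc_critical3 p : critical f p -> exists M : R,
  \forall x \near pnbhs (F p), nm (disc x) <= M * nm (x - F p) ^+ 3.
Proof.
move=> pc; set x0 := F p.
pose k x := if x == x0 then 0 else disc x / (x - x0) ^+ 2.
have nb : x0 \notin map F bs.
  apply/mapP => -[q /bsP qb] E; have [qa /(_ p pc)] := b_gen qb; apply.
  by apply: coordc_inj (esym E) => //; exact: a_gen.
have [r r0 rP] := (pnbhsP _ _).1 (pnbhsI (near_pnotin_C (map F crs) x0) (pnbhs_cnbhs (near_notin_C nb))).
have hk : holo k x0 r.
  apply: removable => // [x xr xx0|].
    have [/noncvP nx xb] := rP x xr xx0; have [l dl] := disc_cder nx xb.
    have dq : cder (fun x => (x - x0) ^+ 2) x (2%:R * (x - x0) ^+ 1 * (1 - 0)).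
      by apply: (@cderX _ (fun x => x - x0)); apply: cderB; [exact: cder_id | exact: cder_cst].
    eexists; apply: cder_near (cderM dl (@cderV _ (fun x => (x - x0) ^+ 2) x _ _ dq)).
      by apply: filterS (near_neq xx0) => w /negbTE wx; rewrite /k wx.
    by rewrite expf_neq0 // subr_eq0.
  rewrite {2}/k eqxx => eps eps0.
  have /pnbhsP[s s0 sP] := disc_critical pc eps0.
  apply/cnbhsP; exists s => // w ws; rewrite /k.
  by case: eqP => [_|/eqP wx]; [rewrite subrr nm0 | exact: sP].
have [|m [phi [cphi _ kE]]] := hk x0; first by rewrite subrr nm0.
have [M M0 MP] := tends_bounded cphi; exists M.
have n1 : \forall x \near pnbhs x0, x != x0 by apply/pnbhsP; exists 1.
apply: filterS2 (pnbhs_cnbhs MP) n1 => x xM xx0.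
have := kE x; rewrite /k eqxx (negbTE xx0) add0r => E.
have x2 : (x - x0) ^+ 2 != 0 by rewrite expf_neq0 // subr_eq0.
have -> : disc x = phi x * (x - x0) ^+ 3.
  by rewrite -[LHS](divfK x2) E -mulrA -exprS.
by rewrite nmM nmX ler_wpM2r // exprn_ge0 // nm_ge0.
Qed.

(** The pole is simple and [F] is a coordinate at [q]: [q] is noncritical by [b_gen], and [sigma q]
    is too, because a critical [sigma q] would be fixed and so equal to [q]. Hence 1 / H and F - F q
    both vanish to order 1. *)
Lemma pole_bound q : q \in bs -> exists2 M : R, 0 < M &
  \forall q' \near q, nm (H q') * nm (F q' - F q) <= M.
Proof.
move=> /bsP qb; have [qa qnc] := b_gen qb.
have nc : ~ critical f q by move=> /qnc.
have ncs : ~ critical f (sigma q).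
  move=> sc; have sK : sigma (sigma q) = sigma q by exact: crit_real.
  have sq : sigma q = q by case: sigma_real => _ /(_ q); rewrite sK.
  by apply: nc; rewrite -sq.
pose z := @chart R P1 false.
have d0 : @chart_dom R P1 false (f (sigma q)) by rewrite qb.
have [l l0 dl] := transition_cder d0 d0.
have oz : xord z (f (sigma q)) 1 by exact: xord1 d0 dl l0.
have oV := xord_conj sigma_real (noncritical_map_ord f_holo ncs oz).
have oF : xord F q 1 by apply: noncritical_map_ord => //; exact: coordc_ord.
have [i iq] := chart_cover q.
have [v1 [cv1 v10] E1] := oV i iq; have [v2 [cv2 v20] E2] := oF i iq.
have [k k0 kP] := tends_away cv1 v10; have [M M0 MP] := tends_bounded cv2.
exists (M / k); first by rewrite divr_gt0.
have fin : \forall q' \near q, f (sigma q') <> None.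
  apply: (sC (near_map_neq f_holo _)); by rewrite qb.
apply: (near_of_chart iq).
have n1 := cnbhsI E1 E2; have n2 := cnbhsI kP MP.
apply: filterS3 n1 n2 (near_chart_inv iq fin) => t [e1 e2] [kt Mt] ft.
have -> : H (chart_inv i t) = ((t - chart i q) ^+ 1 * v1 t)^-1.
  rewrite -e1 /H /z /= qb /=; case: (f (sigma (chart_inv i t))) ft => [w|//] _ /=.
  by rewrite -cjB /cj -fmorphV.
rewrite e2 expr1 nmV !nmM; have [->|tq] := eqVneq (t - chart i q) 0.
  by rewrite nm0 !mul0r mulr0 divr_ge0 ?ltW.
have t0 : nm (t - chart i q) != 0 by rewrite nm_eq0.
have vt0 : nm (v1 t) != 0 by rewrite gt_eqF // (lt_le_trans k0).
rewrite (_ : _ * _ = nm (v2 t) / nm (v1 t)); last by field; rewrite t0 vt0.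
by apply: ler_pM; rewrite ?invr_ge0 ?nm_ge0 // lef_pV2 // posrE (lt_le_trans k0).
Qed.

Definition pole_prod x := \prod_(q <- bs) (x - F q).

Hypothesis bs_uniq : uniq bs.

(** On a sheet through a pole [H] grows at most like 1 / (x - x1), and each sheet belongs to 2 (d -
    1) ordered pairs. The factors of [pole_prod] that vanish at [x1] compensate exactly this
    growth. *)
Lemma disc_pole x1 : noncv x1 -> exists M : R,
  \forall x \near pnbhs x1, nm (disc x) * nm (pole_prod x ^+ (2 * d.-1)) <= M.
Proof.
move=> nx; have [S SP] := local_sheets nx.
have [h1 h2 h3 h4 h5] := cnbhs_singleton SP.
(* A weight, at most 1 near [x1], that keeps [H] bounded on the i-th sheet. *)
pose om i x : R := if S i x1 \in bs then nm (x - x1) else 1.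
have om0 i x : 0 <= om i x by rewrite /om; case: ifP => // _; exact: nm_ge0.
have [B BP] : exists B : 'I_d -> R, forall i, 0 <= B i /\
    \forall x \near cnbhs x1, nm (H (S i x)) * om i x <= B i.
  apply: (@fin_all_exists _ (fun=> R) (fun i c => 0 <= c /\
    \forall x \near cnbhs x1, nm (H (S i x)) * om i x <= c)) => i.
  rewrite /om; have [ib|ib] := boolP (S i x1 \in bs).
    have [M M0 MP] := pole_bound ib; exists M; split; first exact: ltW.
    apply: filterS2 SP (h5 i _ MP) => x [g1 g2 _ _ _].
    by rewrite -/(F _) -/(F (S i x1)) (F_of (g2 i)) (F_of (h2 i)).
  have cH : tends (cnbhs x1) (H \o S i) (H (S i x1)).
    move=> eps eps0; apply: (h5 i [set q | nm (H q - H (S i x1)) < eps]).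
    apply: (xhol_tends (H_hol _) eps0) => sb; move/negP: ib; apply; exact/bsP.
  have [M M0 MP] := tends_bounded cH; exists M; split; first exact: ltW.
  by apply: filterS MP => x; rewrite mulr1.
pose Bm := \sum_i B i + 1.
have Bi i : B i <= Bm.
  rewrite /Bm (bigD1 i) //= -addrA lerDl addr_ge0 //.
  by apply: sumr_ge0 => j _; have [] := BP j.
have Bm1 : 1 <= Bm by rewrite lerDr; apply: sumr_ge0 => j _; have [] := BP j.
pose w2 x := \prod_(q <- bs | F q != x1) (x - F q).
have [l dw2] : exists l, cder w2 x1 l.
  apply: cder_prod => q _; exists (1 - 0).
  by apply: cderB; [exact: cder_id | exact: cder_cst].
have [K K0 KP] := tends_bounded (cder_continuous dw2).
have nB : \forall x \near cnbhs x1, forall i, i \in index_enum 'I_d ->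
    nm (H (S i x)) * om i x <= B i.
  apply: (@near_allin C _ (index_enum 'I_d) x1 (fun i => [set x | nm (H (S i x)) * om i x <= B i])).
  by move=> i _; have [_] := BP i.
exists ((2 * Bm) ^+ (d * d) * K ^+ (2 * d.-1)).
have nb1 := near_nm x1 (ltr01 : 0 < 1 :> R).
apply: filterS2 (pnbhs_cnbhs (cnbhsI SP nb1)) (pnbhs_cnbhs (cnbhsI KP nB)).
move=> x [[g1 g2 g3 _ _] x1x] [Kx Bx].
have om1 i : om i x <= 1 by rewrite /om; case: ifP => // _; exact: ltW.
have Bx' i : nm (H (S i x)) * om i x <= Bm.
  by apply: le_trans (Bi i); apply: Bx; rewrite mem_index_enum.
have L1 : nm (disc x) * \prod_(k : 'I_d * 'I_d | k.1 != k.2) (om k.1 x * om k.2 x)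
    <= (2 * Bm) ^+ (d * d).
  rewrite (disc_eq g1 g2 g3) nm_prod -big_split /=; apply: prod_le_exp.
  - by lra.
  - move=> k _; rewrite !mulr_ge0 ?nm_ge0 //=.
    have h := nmB (H (S k.1 x)) (H (S k.2 x)).
    apply: le_trans (ler_wpM2r _ h) _; first by rewrite mulr_ge0.
    have b1 := Bx' k.1; have b2 := Bx' k.2.
    have c1 := om1 k.1; have c2 := om1 k.2; have d1 := om0 k.1 x; have d2 := om0 k.2 x.
    have m1 : nm (H (S k.1 x)) * om k.1 x * om k.2 x <= Bm * 1.
      by apply: ler_pM => //; rewrite mulr_ge0 ?nm_ge0.
    have m2 : nm (H (S k.2 x)) * om k.2 x * om k.1 x <= Bm * 1.
      by apply: ler_pM => //; rewrite mulr_ge0 ?nm_ge0.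
    rewrite mulrDl mulrA (mulrC (om k.1 x)) mulrA; lra.
  - by rewrite card_prod card_ord.
have omE : \prod_(k : 'I_d * 'I_d | k.1 != k.2) (om k.1 x * om k.2 x) =
    (\prod_i om i x) ^+ (2 * d.-1).
  have half (g : 'I_d -> R) : \prod_(k : 'I_d * 'I_d | k.1 != k.2) g k.1 = (\prod_i g i) ^+ d.-1.
    rewrite -(pair_big_dep xpredT (fun i j => i != j) (fun i j => g i)) /= -prodrXl.
    apply: eq_bigr => i _; rewrite prodr_const; congr (_ ^+ _).
    rewrite (eq_card (_ : _ =i predC (pred1 i))); last by move=> j; rewrite !inE eq_sym.
    by have := congr1 predn (cardC (pred1 i)); rewrite card1 card_ord.
  have half2 (g : 'I_d -> R) : \prod_(k : 'I_d * 'I_d | k.1 != k.2) g k.2 = (\prod_i g i) ^+ d.-1.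
    rewrite -half (reindex_inj (_ : injective (fun k : 'I_d * 'I_d => (k.2, k.1)))) /=; last first.
      by move=> [i j] [i' j'] [-> ->].
    by apply: eq_bigl => k; rewrite eq_sym.
  by rewrite big_split /= (half (om^~ x)) (half2 (om^~ x)) -exprD addnn mul2n.
rewrite omE in L1.
have wE : nm (pole_prod x) <= K * \prod_i om i x.
  rewrite /pole_prod (bigID (fun q => F q == x1)) /= nmM mulrC; apply: ler_pM; rewrite ?nm_ge0 //.
  rewrite nm_prod [leLHS](eq_bigr (fun=> nm (x - x1))); last by move=> q /eqP ->.
  rewrite -big_filter big_const_seq iter_mulr mulr1 count_predT.
  rewrite (bigID (fun i => S i x1 \in bs)) /= [X in _ * X]big1 ?mulr1; last first.
    by move=> i /negbTE ib; rewrite /om ib.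
  rewrite (eq_bigr (fun=> nm (x - x1))); last by move=> i ib; rewrite /om ib.
  rewrite -big_filter big_const_seq iter_mulr mulr1 count_predT.
  rewrite -(size_map (S^~ x1) [seq i <- index_enum 'I_d | S i x1 \in bs]).
  set t := [seq S i x1 | i <- _].
  (* The poles over [x1] correspond one to one to the sheets through them, so both sides contain the
     same power of [nm (x - x1)]. *)
  suff /perm_size -> : perm_eq [seq q <- bs | F q == x1] t by [].
  rewrite {}/t; apply: uniq_perm.
  - exact: filter_uniq.
  - by rewrite map_inj_uniq // filter_uniq // index_enum_uniq.
  - move=> q; rewrite mem_filter; apply/andP/mapP => [[/eqP qx qb]|[i im ->]].
      have [|i qi] := h4 q; first by rewrite -qx; apply: of_F; have /bsP/b_gen[] := qb.
      by exists i => //; rewrite mem_filter mem_index_enum -qi qb.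
    by move: im; rewrite mem_filter (F_of (h2 i)) => /andP[].
have wE2 : nm (pole_prod x ^+ (2 * d.-1)) <= K ^+ (2 * d.-1) * (\prod_i om i x) ^+ (2 * d.-1).
  rewrite nmX -exprMn; apply: lerXn2r; rewrite ?nnegrE ?nm_ge0 //.
  by apply: mulr_ge0; [exact: ltW | apply: prodr_ge0].
apply: le_trans (ler_wpM2l (nm_ge0 _) wE2) _.
by rewrite mulrCA mulrC ler_wpM2r // exprn_ge0 // ltW.
Qed.

(** * Vanishing of the discriminant *)

Hypothesis bs_size : size bs = d.
Hypothesis crs_uniq : uniq crs.
Hypothesis crs_size : (2 * (d * d.-1) < 3 * size crs)%N.

Definition crit_prod x := \prod_(p <- crs) (x - F p).

Lemma crit_prod_neq0 x : noncv x -> crit_prod x != 0.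
Proof.
move=> /noncvP nx; rewrite /crit_prod prodf_seq_neq0; apply/allP => p pc /=.
by rewrite subr_eq0; apply: contraNneq nx => ->; exact: map_f.
Qed.

(* Degree at most 2 d (d - 1) at infinity against 3 (2 d - 2 + 2 g) zeros. *)
Let G x := disc x * pole_prod x ^+ (2 * d.-1) / crit_prod x ^+ 3.

Let cder_pp (s : seq X) n x : exists l, cder (fun x => (\prod_(q <- s) (x - F q)) ^+ n) x l.
Proof.
have [l dl] : exists l, cder (fun x => \prod_(q <- s) (x - F q)) x l.
  apply: cder_prod => q _; exists (1 - 0).
  by apply: cderB; [exact: cder_id | exact: cder_cst].
by eexists; exact: cderX dl.
Qed.

Let G_cder x : x \notin map F crs ++ map F bs -> exists l, cder G x l.
Proof.
rewrite mem_cat negb_or => /andP[/noncvP nx nb].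
have [l dl] := disc_cder nx nb; have [m dm] := cder_pp bs (2 * d.-1) x.
have [n dn] := cder_pp crs 3 x; eexists.
apply: cderM; first exact: (cderM dl dm).
by apply: (cderV _ dn); rewrite expf_neq0 // crit_prod_neq0.
Qed.

(** [F] is injective on the critical points by [crit_inj], so exactly one factor of [crit_prod]
    vanishes at [F p]; its cube is absorbed by [disc_critical3]. *)
Let G_critical p : critical f p -> exists M : R, \forall x \near pnbhs (F p), nm (G x) <= M.
Proof.
move=> pc; have [M MP] := disc_critical3 pc.
have [m dm] := cder_pp bs (2 * d.-1) (F p).
have [K K0 KP] := tends_bounded (cder_continuous dm).
have [n dn] := cder_pp (rem p crs) 3 (F p).
have nz : (\prod_(q <- rem p crs) (F p - F q)) ^+ 3 != 0.
  rewrite expf_neq0 // prodf_seq_neq0; apply/allP => q; rewrite mem_rem_uniq // inE.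
  move=> /andP[qp qc] /=; rewrite subr_eq0; apply: contra_neq qp => E.
  apply: crit_inj; rewrite ?inE //; try exact/crsP.
  by apply: (coordc_inj _ _ (esym E)); apply: a_gen => //; apply/crsP.
have [k k0 kP] := tends_away (cder_continuous dn) nz.
have n1 : \forall x \near pnbhs (F p), x != F p by apply/pnbhsP; exists 1.
exists (`|M| * K / k).
apply: filterS2 (pnbhsI MP n1) (pnbhsI (pnbhs_cnbhs KP) (pnbhs_cnbhs kP)).
move=> x [Mx xp] [Kx kx].
have xp0 : 0 < nm (x - F p) by rewrite nm_gt0 subr_eq0.
have pcs : p \in crs by apply/crsP.
rewrite /G /crit_prod (big_rem p) //= exprMn !nmM nmV nmM [nm ((x - F p) ^+ 3)]nmX.
have k1 : 0 < nm ((\prod_(q <- rem p crs) (x - F q)) ^+ 3) by apply: lt_le_trans kx.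
rewrite ler_pdivrMr ?mulr_gt0 ?exprn_gt0 //.
have h1 : nm (disc x) <= `|M| * nm (x - F p) ^+ 3.
  by apply: le_trans Mx _; rewrite ler_wpM2r ?exprn_ge0 ?nm_ge0 // ler_norm.
apply: le_trans (ler_pM _ _ h1 Kx) _; rewrite ?nm_ge0 //.
rewrite (_ : `|M| * nm (x - F p) ^+ 3 * K = `|M| * K / k * nm (x - F p) ^+ 3 * k); last first.
  by field; rewrite gt_eqF.
have [K0' k0' xp0'] : [/\ 0 <= K, 0 <= k & 0 <= nm (x - F p)] by split; exact: ltW.
by rewrite [leRHS]mulrA ler_wpM2l // !mulr_ge0 ?invr_ge0 ?exprn_ge0.
Qed.

Let G_pole q : q \in bs -> exists M : R, \forall x \near pnbhs (F q), nm (G x) <= M.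
Proof.
move=> qb; have [qa qnc] : f q <> Some a /\ forall p, critical f p -> f q <> f p.
  by apply: b_gen; exact/bsP.
have nx : noncv (F q).
  by move=> [p pc]; rewrite -of_F // => fp; apply: (qnc p pc).
have [M MP] := disc_pole nx; have [n dn] := cder_pp crs 3 (F q).
have [|k k0 kP] := tends_away (cder_continuous dn); first by rewrite expf_neq0 // crit_prod_neq0.
exists (`|M| / k); apply: filterS2 MP (pnbhs_cnbhs kP) => x Mx kx.
rewrite /G !nmM nmV; apply: ler_pM; rewrite ?invr_ge0 ?mulr_ge0 ?nm_ge0 //.
  by apply: le_trans Mx _; exact: ler_norm.
by rewrite lef_pV2 // posrE (lt_le_trans k0).
Qed.

(** Large x means values of [f] near [a], over which [H] has no pole; the discriminant stays bounded
    there. The numerator then has degree at most [A < B], which leaves a factor of at least [nm x]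
    in the denominator. *)
Let G_infty eps : 0 < eps -> exists r : R, forall x, r < nm x -> nm (G x) <= eps.
Proof.
move=> eps0; have [M M1 MP] : exists2 M : R, 1 <= M &
    \forall y' \near (Some a : P1), forall q, f q = y' -> nm (H q) <= M.
  by apply: H_bounded => q qa qb; have [] := b_gen qb.
have [r1 r1P] := cinv_infty MP.
have [r2 r2P] := prod_growth (map F bs); have [r3 r3P] := prod_growth (map F crs).
pose A := (2 * (d * d.-1))%N; pose B := (3 * size crs)%N.
pose K := (2 * M) ^+ (d * d) * 2 ^+ A * 2 ^+ B.
have K0 : 0 < K by rewrite !mulr_gt0 ?exprn_gt0 //; lra.
exists (Num.max (Num.max r1 1) (Num.max (Num.max r2 r3) (K / eps))) => x.
rewrite !gt_max => /andP[/andP[x1 xr1] /andP[/andP[x2 x3] xK]].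
have /andP[_ w1] := r2P x x2; have /andP[z1 _] := r3P x x3.
rewrite big_map size_map -/(pole_prod x) bs_size in w1.
rewrite big_map size_map -/(crit_prod x) in z1.
have nx0 : 0 < nm x by lra.
have c0 : 0 < nm (crit_prod x) by apply: lt_le_trans z1; rewrite exprn_gt0 // divr_gt0.
have nx : noncv x.
  apply/noncvP/mapP => -[p pc xp]; move: c0; rewrite nm_gt0 /crit_prod prodf_seq_neq0.
  by move=> /allP/(_ p pc) /=; rewrite xp subrr eqxx.
have dM := disc_le nx M1 (r1P x x1).
have w2 : nm (pole_prod x ^+ (2 * d.-1)) <= (2 * nm x) ^+ A.
  rewrite nmX /A mulnCA [(2 * nm x) ^+ _]exprM; apply: lerXn2r; rewrite ?nnegrE ?nm_ge0 ?exprn_ge0 ?mulr_ge0 ?nm_ge0 //.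
have z2 : (nm x / 2) ^+ B <= nm (crit_prod x ^+ 3).
  rewrite nmX /B mulnC [(nm x / 2) ^+ _]exprM; apply: lerXn2r; rewrite ?nnegrE ?nm_ge0 ?exprn_ge0 ?divr_ge0 ?nm_ge0 //.
have xB : 0 < (nm x / 2) ^+ B by rewrite exprn_gt0 // divr_gt0.
rewrite /G !nmM nmV ler_pdivrMr; last by apply: lt_le_trans z2.
apply: le_trans (ler_pM _ _ dM w2) _; rewrite ?nm_ge0 //.
apply: (@le_trans _ _ (eps * (nm x / 2) ^+ B)); last by rewrite ler_pM2l.
rewrite [(2 * nm x) ^+ A]exprMn expr_div_n [leRHS]mulrA ler_pdivlMr ?exprn_gt0 //.
have -> : (2 * M) ^+ (d * d) * (2 ^+ A * nm x ^+ A) * 2 ^+ B = K * nm x ^+ A.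
  by rewrite /K; ring.
apply: (@le_trans _ _ (eps * nm x * nm x ^+ A)).
  by rewrite ler_wpM2r ?exprn_ge0 ?ltW // mulrC -ltr_pdivrMr.
rewrite -mulrA ler_pM2l // -exprS ler_weXn2l // ltW //.
Qed.

(** [liouville_punctured] gives [G = 0]. Off the exceptional values [pole_prod] and [crit_prod] are
    nonzero, so some factor of the discriminant is 0. *)
Lemma collision x : x \notin map F crs ++ map F bs ->
  exists i, exists2 j, i != j & H (e x i) = H (e x j).
Proof.
move=> xS; have G0 : G x = 0.
  apply: (@liouville_punctured _ (map F crs ++ map F bs)) => //.
  move=> s; rewrite mem_cat => sS.
  have [M /pnbhsP[r r0 rP]] : exists M : R, \forall x \near pnbhs s, nm (G x) <= M.
    case/orP: sS => /mapP[q qs ->]; last exact: G_pole.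
    by apply: G_critical; exact/crsP.
  by exists M, r.
move: xS; rewrite mem_cat negb_or => /andP[/noncvP nx nb].
move: G0 => /eqP; rewrite /G mulf_eq0 invr_eq0 expf_eq0 /= (negbTE (crit_prod_neq0 nx)) orbF.
rewrite mulf_eq0 expf_eq0 => /orP[|/andP[_]]; last first.
  rewrite /pole_prod prodf_seq_eq0 => /hasP[q qb /=].
  by rewrite subr_eq0 => /eqP xq; move/negP: nb; case; rewrite xq; exact: map_f.
rewrite /disc => /prodf_eq0[[i j] /= ij]; rewrite subr_eq0 => /eqP Hij.
by exists i, j.
Qed.

(** * Counting coincidences of [H] on the fibres *)

Local Notation S0 := (map F crs ++ map F bs).

Let H_sheet_cder (S : 'I_d -> C -> X) x0 : x0 \notin S0 ->
  (\forall x \near cnbhs x0, [/\ noncv x, forall i, f (S i x) = cinv a x,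
    injective (S^~ x), (forall q, f q = cinv a x -> exists i, q = S i x) &
    forall i A, nbhs (S i x) A -> \forall x' \near cnbhs x, A (S i x')]) ->
  forall i, exists l, cder (H \o S i) x0 l.
Proof.
move=> xS SP i; have [h1 h2 _ _ h5] := cnbhs_singleton SP.
apply: (@section_cder _ _ F); first exact: h5.
- by apply: filterS SP => x [_ /(_ i)/F_of].
- exact: fib_ord h1 (h2 i).
- apply: H_hol => Sb; move/negP: xS; apply; rewrite mem_cat; apply/orP; right.
  by apply/mapP; exists (S i x0); [apply/bsP | rewrite (F_of (h2 i))].
Qed.

(** The difference of the values of [H] on two sheets is holomorphic; by [isolated_zero] it is
    either 0 near [x0] or nonzero on a punctured neighbourhood. *)
Lemma sheets_compare (S : 'I_d -> C -> X) x0 : x0 \notin S0 ->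
  (\forall x \near cnbhs x0, [/\ noncv x, forall i, f (S i x) = cinv a x,
    injective (S^~ x), (forall q, f q = cinv a x -> exists i, q = S i x) &
    forall i A, nbhs (S i x) A -> \forall x' \near cnbhs x, A (S i x')]) ->
  exists k : 'I_d -> nat, \forall x \near pnbhs x0,
    forall i, #|[pred j | H (S j x) == H (S i x)]| = k i.
Proof.
move=> xS SP; have [r r0 rP] := (cnbhsP _ _).1 (cnbhsI (cnbhs_nbhs SP) (near_notin_C xS)).
have cmp (ij : 'I_d * 'I_d) : exists c : bool, \forall x \near pnbhs x0,
    (H (S ij.1 x) == H (S ij.2 x)) = c.
  case: ij => i j /=; pose g x := H (S i x) - H (S j x).
  have hg : holo g x0 r.
    move=> x xr; have [Px xS'] := rP x xr.
    have [l dl] := H_sheet_cder xS' Px i; have [m dm] := H_sheet_cder xS' Px j.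
    by exists (l - m); exact: cderB.
  have [g0|[n [k [hk k0 kE]]]] := isolated_zero r0 hg.
    by exists true; apply: pnbhs_cnbhs; apply: filterS g0 => x /eqP; rewrite subr_eq0.
  exists false.
  have ck : tends (cnbhs x0) k (k x0) by apply: (holo_continuous hk); rewrite subrr nm0.
  have n1 : \forall x \near pnbhs x0, x != x0 by apply/pnbhsP; exists 1.
  apply: filterS2 n1 (pnbhs_cnbhs (tends_neq k0 ck)) => x xx0 kx.
  by rewrite -subr_eq0 -/(g x) kE mulf_eq0 expf_eq0 subr_eq0 (negbTE xx0) andbF (negbTE kx).
have [c cP] := choice cmp.
exists (fun i => #|[pred j | c (j, i)]|).
have : \forall x \near pnbhs x0, forall ij : 'I_d * 'I_d,
    (H (S ij.1 x) == H (S ij.2 x)) = c ij by apply: filter_forall.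
apply: filterS => x xc i; apply: eq_card => j; rewrite !inE.
exact: (xc (j, i)).
Qed.

(** The size of the class of [q] under equality of [H] in its fibre. As a function on the curve
    rather than on the sphere, it can be compared between different points of one fibre by
    connectedness of the curve. *)
Definition coinc q := #|[pred i : 'I_d | H (e (F q) i) == H q]|.

Lemma coincE x (t : 'I_d -> X) i : noncv x -> (forall i, f (t i) = cinv a x) ->
  injective t -> coinc (t i) = #|[pred j | H (t j) == H (t i)]|.
Proof.
move=> nx ft it; have [fe ie se] := eP nx.
have [pi piP] := choice (fun i => se (t i) (ft i)).
have ipi : injective pi by move=> k l kl; apply: it; rewrite !piP kl.
rewrite /coinc (F_of (ft i)) -!sum1_card (reindex_inj ipi) /=.
by apply: eq_bigl => j; rewrite !inE /= -piP.
Qed.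

Let good q := f q <> Some a /\ F q \notin S0.

(** Points near [q] lie on the sheet through [q], since the other sheets are kept away by
    separation; [sheets_compare] then gives the count along this sheet. *)
Let coinc_good q : good q -> exists k, \forall q' \near q, q' <> q -> coinc q' = k.
Proof.
move=> [qa qS]; set x0 := F q in qS; have fq : f q = cinv a x0 := of_F qa.
have nx : noncv x0 by apply/noncvP; move: qS; rewrite mem_cat negb_or => /andP[].
have [S SP] := local_sheets nx; have [k kP] := sheets_compare qS SP.
have [h1 h2 h3 h4 h5] := cnbhs_singleton SP; have [i0 qi0] := h4 q fq.
exists (k i0).
have hX := @rs_hausdorff R X.
have cF := xhol_tends (map_hol f_holo qa).
have toX (P : set C) : cnbhs x0 P -> \forall q' \near q, P (F q').
  by move=> /cnbhsP[r r0 rP]; apply: filterS (cF r r0) => q'; exact: rP.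
have other i : i <> i0 -> \forall q' \near q, q' <> S i (F q').
  move=> ii0; have ne : q <> S i x0 by rewrite qi0 => /h3 E; apply: ii0.
  have := hX; rewrite open_hausdorff => /(_ q (S i x0) (introN eqP ne)).
  move=> [[A B] [qA SB] [oA oB /eqP AB]]; rewrite /= in qA SB oA oB AB.
  have nA : nbhs q A by apply: open_nbhs_nbhs; split => //; move: qA; rewrite inE.
  have nB : nbhs (S i x0) B by apply: open_nbhs_nbhs; split => //; move: SB; rewrite inE.
  apply: filterS2 nA (toX _ (h5 i B nB)) => q' Aq' Bq' E.
  have : (A `&` B) q' by split => //; rewrite E.
  by rewrite AB.
have others : \forall q' \near q, forall i, i <> i0 -> q' <> S i (F q').
  apply: filter_forall => i; have [->|/eqP ii0] := eqVneq i i0; first exact: nearW.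
  by apply: filterS (other i ii0) => q' h _.
have /pnbhsP[r r0 rP] := kP.
have n1 := filterI (near_map_neq f_holo qa) (near_fiber_isolated f_deg q).
have n2 := toX _ SP; have n3 := cF r r0.
near=> q' => q'q.
have oth : forall i, i <> i0 -> q' <> S i (F q') by near: q'; exact: others.
have [q'a iso] : f q' <> Some a /\ (q' <> q -> f q' <> f q) by near: q'; exact: n1.
have [g1 g2 g3 g4 _] : [/\ noncv (F q'), forall i, f (S i (F q')) = cinv a (F q'),
    injective (S^~ (F q')), (forall q, f q = cinv a (F q') -> exists i, q = S i (F q')) &
    forall i A, nbhs (S i (F q')) A -> \forall x' \near cnbhs (F q'), A (S i x')].
  by near: q'; exact: n2.
have xr : nm (F q' - x0) < r by near: q'; exact: n3.
have [i q'i] := g4 q' (of_F q'a).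
have ii0 : i = i0 by apply: contrapT => /oth; apply.
have x'x0 : F q' != x0.
  by apply: contra_notN (iso q'q) => /eqP E; apply: (coordc_inj q'a qa E).
rewrite {1}q'i ii0 (@coincE (F q') (S^~ (F q')) i0) //.
exact: rP.
Unshelve. all: by end_near. Qed.

(* [agen] weakens [gen] so that it also makes sense at the bad points; this is what
   the connectedness of X needs. *)
Let gen k q := \forall q' \near q, q' <> q -> coinc q' = k.
Let agen k q := \forall q' \near q, q' <> q -> gen k q'.

Let punctured_near (A : set X) q : (\forall q' \near q, q' <> q -> A q') ->
  \forall q1 \near q, q1 <> q -> \forall q' \near q1, A q'.
Proof.
move=> /nbhs_interior; apply: filterS => q1 qA q1q.
apply: filterS2 qA (near_neq_top (@rs_hausdorff R X) q1q) => q' h q'q; exact: h.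
Qed.

Let gen_agen k q : gen k q -> agen k q.
Proof.
move=> /punctured_near; apply: filterS => q1 h q1q.
by apply: filterS (h q1q) => q' -> _.
Qed.

Let agen_near k q : agen k q -> \forall q' \near q, agen k q'.
Proof.
move=> gk; have h := punctured_near gk.
apply: filterS h => q1 h; have [->//|/eqP /h h1] := eqVneq q1 q.
by apply: filterS h1 => q' g _.
Qed.

Let gen_uniq k l q : gen k q -> gen l q -> k = l.
Proof.
move=> gk gl; have [|q' _ [<- <-]//] := @pnbhs_surface_proper _ X q
  [set q' | coinc q' = k /\ coinc q' = l].
by apply: filterS2 gk gl => q' h1 h2 q'q; split; [exact: h1 | exact: h2].
Qed.

Let agen_uniq k l q : agen k q -> agen l q -> k = l.
Proof.
move=> gk gl; have [|q' _ [h1 h2]] := @pnbhs_surface_proper _ X q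
  [set q' | gen k q' /\ gen l q'].
  by apply: filterS2 gk gl => q' h1 h2 q'q; split; [exact: h1 | exact: h2].
exact: gen_uniq h1 h2.
Qed.

Let near_good q : \forall q' \near q, q' <> q -> good q'.
Proof.
have [fs fsP] := choice (fun y => fiber_seq f_deg y).
pose bad := flatten (map fs (Some a :: map (cinv a) S0)).
apply: filterS (near_notin (@rs_hausdorff R X) bad q) => q' qb q'q.
have {}qb y : y \in Some a :: map (cinv a) S0 -> f q' <> y.
  move=> yb fy; move/negP: (qb q'q); apply; apply/flattenP; exists (fs y).
    exact: map_f.
  by have [_ -> _] := fsP y; rewrite fy.
split; first by apply: qb; rewrite mem_head.
apply/negP => xS; apply: (qb (cinv a (F q'))).
  by rewrite inE map_f ?orbT.
by apply: of_F; apply: qb; rewrite mem_head.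
Qed.

Let gen_good q : good q -> exists k, gen k q. Proof. exact: coinc_good. Qed.

(** A small punctured chart disc around [q] consists of good points, where the generic count exists
    and is locally constant; the punctured disc is connected, so the count is the same all around
    [q], even when [q] is bad. *)
Let agen_exists q : exists k, agen k q.
Proof.
have [i iq] := chart_cover q.
have n1 := pnear_chart_inv iq (near_good q).
have [r r0 rP] := (pnbhsP _ _).1 (pnbhsI n1 (pnbhs_cnbhs (near_codom iq))).
have [|||k kP] := punctured_disc_const (P := fun k z => gen k (chart_inv i z)) (z0 := chart i q) r0.
- by move=> z zr zn; have [/gen_good] := rP z zr zn.
- by move=> k l z _ _; exact: gen_uniq.
- move=> k z zr zn gk; have [_ [iz zE]] := rP z zr zn.
  have := near_chart_inv iz (_ : \forall q' \near chart_inv i z, gen k q'); rewrite zE; apply.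
  apply: filterS (gen_agen gk) => q' h; have [->//|/eqP] := eqVneq q' (chart_inv i z).
  exact: h.
- exists k; apply: (pnear_of_chart iq); apply/pnbhsP; exists r => // z; exact: kP.
Qed.

(** The sets on which [agen] holds with a given k are open, disjoint for different k, and cover the
    connected curve. *)
Lemma coinc_const : exists k, forall q, good q -> gen k q.
Proof.
have [q0 _] := rs_nonempty X; have [k kq0] := agen_exists q0; exists k.
have all q : agen k q.
  have cX := @rs_connected R X.
  have BX : [set q | agen k q] = setT.
    apply: cX.
    - by exists q0.
    - exists (interior [set q | agen k q]); first exact: open_interior.
      rewrite setTI; apply/seteqP; split => [q' /agen_near //|]; exact: interior_subset.
    - exists (~` interior [set q | ~ agen k q]); first by apply: open_closedC; exact: open_interior.
      rewrite setTI; apply/seteqP; split => [q' kq' /interior_subset //|q' nq'].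
      have [l lq'] := agen_exists q'; have [<-//|kl] := eqVneq l k; exfalso; apply: nq'.
      apply: filterS (agen_near lq') => q1 l1 k1; move/eqP: kl; apply.
      exact: agen_uniq l1 k1.
  by have : [set q | agen k q] q by rewrite BX.
move=> q /gen_good[l lq]; have /(agen_uniq (all q)) := gen_agen lq.
by move->.
Qed.

(** * Constancy of [H] on the fibres *)

Hypothesis d_prime : prime d.

(** Equality of [H] partitions the [d] sheets into classes of the common size k, so k divides [d],
    and [collision] excludes k = 1. The argument runs over x' near x, as [gen] says nothing at the
    point itself; continuity along the sheets then reaches x. *)
Lemma H_fiber x q q' : x \notin S0 -> f q = cinv a x -> f q' = cinv a x -> H q = H q'.
Proof.
move=> xS fq fq'.
have nx : noncv x by apply/noncvP; move: xS; rewrite mem_cat negb_or => /andP[].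
have [S SP] := local_sheets nx; have [k kP] := coinc_const.
have [h1 h2 h3 h4 h5] := cnbhs_singleton SP.
have gS i : good (S i x).
  by split; [rewrite h2; exact: cinv_neq | rewrite (F_of (h2 i))].
have n0 i : \forall x' \near cnbhs x, S i x' <> S i x -> coinc (S i x') = k.
  by apply: (h5 i (fun q => q <> S i x -> coinc q = k)); exact: kP.
have n1 : \forall x' \near cnbhs x, forall i, S i x' <> S i x -> coinc (S i x') = k.
  exact: filter_forall.
have n2 : \forall x' \near pnbhs x, x' != x by apply/pnbhsP; exists 1.
have key : \forall x' \near pnbhs x, forall i j, H (S i x') = H (S j x').
  apply: filterS3 (pnbhs_cnbhs (cnbhsI SP n1)) (pnbhs_cnbhs (near_notin_C xS)) n2.
  move=> x' [[g1 g2 g3 g4 _] nk] xS' x'x.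
  have ck i : #|[pred j | H (S j x') == H (S i x')]| = k.
    rewrite -(@coincE x' (S^~ x') i g1 g2 g3); apply: nk => E.
    by move/eqP: x'x; apply; rewrite -(F_of (g2 i)) E (F_of (h2 i)).
  have kd : (k %| d)%N.
    pose D : {set 'I_d} := finset.setTfor _; pose Q := preim_partition (fun j => H (S j x')) D.
    have := @card_uniform_partition _ k Q D.
    rewrite cardsT card_ord => -> //; last exact: preim_partitionP; first exact: dvdn_mull.
    move=> A /imsetP[i _ ->]; rewrite -(ck i); rewrite cardsE; apply: eq_card => j.
    by rewrite [LHS]unfold_in /= [RHS]unfold_in /= /D finset.in_setT eq_sym.
  have k2 : k != 1%N.
    have [i [j ij Hij]] := collision xS'; have [fe ie se] := eP g1.
    have [i' ei'] := g4 _ (fe i); have [j' ej'] := g4 _ (fe j).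
    have ij' : i' != j'.
      by apply: contra_neq ij => E; apply: ie; rewrite ei' ej' E.
    rewrite -(ck i') neq_ltn; apply/orP; right; apply/card_gt1P; exists i', j'.
    by split; rewrite ?inE // -ei' -ej' Hij.
  have kE : k = d by apply/(prime_nt_dvdP d_prime k2).
  move=> i j; have : #|[pred j | H (S j x') == H (S i x')]| = #|'I_d| by rewrite ck card_ord.
  move/subset_cardP => /(_ (subset_predT _)) /(_ j); rewrite !inE => /eqP //.
have [i ->] := h4 q fq; have [j ->] := h4 q' fq'.
have ci l : tends (pnbhs x) (H \o S l) (H (S l x)).
  by have [m /cder_continuous/tends_pnbhs] := H_sheet_cder xS SP l.
apply: (tends_uniq (ci i)); apply: tends_near_eq (ci j).
by apply: filterS key => x' h; exact: h.
Qed.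

(** If the images differed, disjoint neighbourhoods would separate them. As [f] is open, points near
    [q] and near [q'] have a common unexceptional value, and [H_fiber] makes their images under f o
    sigma equal, a contradiction. *)
Lemma map_sigma_fiber q q' : f q = f q' -> f (sigma q) = f (sigma q').
Proof.
move=> fqq'; apply: contrapT => ne.
have := @rs_hausdorff R P1; rewrite open_hausdorff => /(_ _ _ (introN eqP ne)).
move=> [[A B] [qA qB] [oA oB /eqP AB]]; rewrite /= in qA qB oA oB AB.
have fsC (q1 : X) (A1 : set P1) : nbhs (f (sigma q1)) A1 -> nbhs q1 ((f \o sigma) @^-1` A1).
  by move=> /fC /sC.
have nA : nbhs q ((f \o sigma) @^-1` A).
  by apply: fsC; apply: open_nbhs_nbhs; split => //; move: qA; rewrite inE.
have nB : nbhs q' ((f \o sigma) @^-1` B).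
  by apply: fsC; apply: open_nbhs_nbhs; split => //; move: qB; rewrite inE.
have m1 := f_open f_holo f_deg nA; have m2 := f_open f_holo f_deg nB.
rewrite -fqq' in m2.
have m3 := near_notin (@rs_hausdorff R P1) (Some a :: map (cinv a) S0) (f q).
have [|y _ [[q1 A1 f1] [q2 B2 f2] yn]] := @pnbhs_surface_proper _ P1 (f q)
  [set y | [/\ exists2 q1, ((f \o sigma) @^-1` A) q1 & f q1 = y,
    exists2 q2, ((f \o sigma) @^-1` B) q2 & f q2 = y & y \notin Some a :: map (cinv a) S0]].
  by apply: filterS3 m1 m2 m3 => y h1 h2 h3 yq; split => //; exact: h3.
move: yn; rewrite inE negb_or => /andP[/eqP ya yS].
pose x := coordc a y; have yx : y = cinv a x by rewrite /x coordcK.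
have xS : x \notin S0 by apply: contraNN yS => xS; rewrite yx; exact: map_f.
rewrite yx in f1 f2; have := H_fiber xS f1 f2.
have nb q3 : f q3 = cinv a x -> f (sigma q3) <> Some b.
  move=> f3 b3; move/negP: xS; apply; rewrite mem_cat; apply/orP; right.
  by apply/mapP; exists q3; [apply/bsP | rewrite (F_of f3)].
rewrite /H /= => /(can_inj cjK) /(coordc_inj (nb _ f1) (nb _ f2)) E.
have : (A `&` B) (f (sigma q1)) by split => //; rewrite E.
by rewrite AB.
Qed.

End Discriminant.

(** * Descent of the real structure to the sphere *)

Section Descent.
Context {R : realType} {X : riemannSurface R}.
Local Notation C := (Cplx R).
Local Notation P1 := (CP1 R).
Variables (f : X -> P1) (d : nat) (crs : seq X) (sigma : X -> X).
Hypothesis X_compact : compact [set: X].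
Hypothesis f_holo : holomorphic f.
Hypothesis f_deg : has_degree f d.
Hypothesis d_gt0 : (0 < d)%N.
Hypothesis crsP : forall p, (p \in crs) <-> critical f p.
Hypothesis sigma_real : antiholomorphic_involution sigma.
Hypothesis sigma_fiber : forall q q', f q = f q' -> f (sigma q) = f (sigma q').

Lemma f_surj y : exists q, f q = y.
Proof.
have [s [_ sP dE]] := fiber_seq f_deg y.
case: s sP dE => [|q s] sP dE; first by move: d_gt0; rewrite dE big_nil.
by exists q; apply/eqP; rewrite -sP mem_head.
Qed.

(** The induced map is continuous because [f] is open and onto. Over a noncritical value it is f o
    sigma composed with a local sheet, hence antiholomorphic; critical values are isolated and, by
    continuity, removable singularities of the conjugated local expression. *)
Lemma sigma_descends : exists tau : P1 -> P1,
  antiholomorphic_involution tau /\ tau \o f \o sigma = f.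
Proof.
have fC : continuous f by case: f_holo.
have [[sC _] sK] := sigma_real.
have [pt ptP] := choice f_surj; pose tau y := f (sigma (pt y)).
have tauE q : tau (f q) = f (sigma q) by apply: sigma_fiber; rewrite ptP.
exists tau; split; last by apply/funext => q; rewrite /= tauE sK.
have tauC : continuous tau.
  move=> y A; rewrite /= -[y]ptP tauE => /fC/sC nA.
  by apply: filterS (f_open f_holo f_deg nA) => _ [q' Aq' <-]; rewrite /= tauE.
split; last by move=> y; rewrite -[y]ptP !tauE sK.
split=> // i j y0 iy jy; set z0 := chart i y0.
pose g : C -> C := cj \o (chart j \o tau) \o chart_inv i.
suff [l /cder_derivable[]] : exists l, cder g z0 l by [].
have cg : tends (cnbhs z0) g (g z0).
  have -> : g z0 = cj (chart j (tau y0)) by congr (cj (chart j (tau _))); exact: chartK.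
  apply: (tends_chart_inv iy); apply: tends_cj => e e0.
  exact: tauC (tends_chart jy e0).
have n1 := pnear_chart_inv iy (near_noncritical_value crsP y0).
have n2 := near_chart_inv iy (tauC _ _ (near_dom jy)).
have [r r0 rP] := (pnbhsP _ _).1 (pnbhsI n1 (pnbhs_cnbhs (cnbhsI (near_codom iy) n2))).
apply: (@removable _ g z0 r) => //; last by rewrite subrr nm0.
move=> z zr zz0; have [nc [[iz zE] jz]] := rP z zr zz0.
set y := chart_inv i z in nc iz jz zE.
have [s sP] := sheets X_compact f_holo f_deg nc.
have [h1 _ _ h4] := nbhs_singleton sP; pose k := Ordinal d_gt0.
have toC (A : set P1) : nbhs y A -> \forall w \near cnbhs z, A (chart_inv i w).
  by move=> /(near_chart_inv iz); rewrite zE.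
have ncz : \forall w \near cnbhs z, chart_dom i (chart_inv i w) /\ chart i (chart_inv i w) = w.
  by have := near_codom iz; rewrite zE.
have [l dl] : exists l, cder ((cj \o (chart j \o f) \o sigma) \o (s k \o chart_inv i)) z l.
  apply: (@section_cder _ _ (chart i \o f)).
  - by move=> A /h4/toC.
  - by apply: filterS2 (toC _ sP) ncz => w [/= -> _ _ _] [_].
  - apply: noncritical_ord => //; last by rewrite /= h1.
    by move=> pc; apply: nc; exists (s k y).
  - apply: (xhol_conj sigma_real); apply: chart_map_hol => //.
    by rewrite -tauE /= h1.
exists l; apply: cder_near dl; apply: filterS (toC _ sP) => w [hw _ _ _].
have E : f (sigma (s k (chart_inv i w))) = tau (chart_inv i w) by rewrite -tauE hw.
exact: (congr1 (fun v : P1 => cj (@chart R P1 j v)) E).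
Qed.

End Descent.

(** * Generic choices and the numerical bound *)

Section GenericPoint.
Context {R : realType}.
Local Notation C := (Cplx R).

Lemma exists_notin (l : seq (CP1 R)) : exists a : C, Some a \notin l.
Proof.
have [s sP] : exists s : seq C, forall a : C, Some a \in l -> a \in s.
  elim: l => [|y l [s sP]]; first by exists [::].
  exists (if y is Some c then c :: s else s) => a; rewrite inE => /predU1P[<-|/sP].
    exact: mem_head.
  by case: y => [c|//]; rewrite inE orbC => ->.
have [a as_] := filter_ex (near_pnotin_C s 0).
by exists a; apply: contra as_; exact: sP.
Qed.

End GenericPoint.

(** 3 (2 d - 2 + 2 g) - 2 d (d - 1) = 2 (3 g - (d^2 - 4 d + 3)), so this inequality is the bound on
    g. *)
Lemma critical_count (d g : nat) : prime d ->
  (d%:R ^+ 2 - 4 * d%:R + 3) / 3 < g%:R :> rat ->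
  (2 * (d * d.-1) < 3 * (2 * d - 2 + 2 * g))%N.
Proof.
move=> /prime_gt1 d1; rewrite ltr_pdivrMr // => gd.
have : (d ^ 2 + 3 < g * 3 + 4 * d)%N.
  rewrite -(@ltr_nat rat) !natrD !natrM; lra.
case: d d1 {gd} => [//|m] _ /=; rewrite -mulnn; nia.
Qed.

Theorem theorem2 (R : realType) (d g : nat)
  (d_prime : prime d)
  (g_large : (d%:R ^+ 2 - 4 * d%:R + 3) / 3 < g%:R :> rat)
  (X : riemannSurface R) (X_compact : compact [set: X])
  (X_genus : has_genus X g)
  (sigma : X -> X) (sigma_real : antiholomorphic_involution sigma)
  (f : X -> CP1 R) (f_holo : holomorphic f) (f_deg : has_degree f d)
  (crit_distinct : (critical f #= `I_(2 * d - 2 + 2 * g))%card)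
  (critval_distinct : set_inj (critical f) f)
  (crit_real : critical f `<=` real_part sigma) :
  exists tau : CP1 R -> CP1 R,
    antiholomorphic_involution tau /\ tau \o f \o sigma = f.
Proof.
have fin : finite_set (critical f) by apply/finite_setP; exists (2 * d - 2 + 2 * g)%N.
pose crs : seq X := finmap.enum_fset (fset_set (critical f)).
have crsP p : p \in crs <-> critical f p.
  by rewrite /crs in_fset_set // inE.
have crs_size : size crs = (2 * d - 2 + 2 * g)%N := card_fset_set crit_distinct.
have [_ sK] := sigma_real.
have [fs fsP] := choice (fun y => fiber_seq f_deg y).
have in_fs q y : (q \in fs y) = (f q == y) by have [_ ->] := fsP y.
have [a aP] := exists_notin (map f crs).
(* [b] has to avoid the values of f o sigma on the fibres over [a] and over the critical values,
   which are finitely many points. *)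
have [b bP] := exists_notin (map (f \o sigma) (flatten (map fs (Some a :: map f crs)))).
have a_gen p : critical f p -> f p <> Some a.
  by move=> /crsP pc pa; move/negP: aP; apply; rewrite -pa; exact: map_f.
have b_gen q : f (sigma q) = Some b -> f q <> Some a /\ forall p, critical f p -> f q <> f p.
  move=> qb; have avoid y : y \in (Some a : CP1 R) :: map f crs -> f q <> y.
    move=> ys qy; move/negP: bP; apply; apply/mapP; exists q; last exact: esym.
    by apply/flattenP; exists (fs y); [exact: map_f | rewrite in_fs; exact/eqP].
  split; first by apply: avoid; rewrite mem_head.
  by move=> p /crsP pc; apply: avoid; rewrite inE map_f ?orbT.
(* A critical point over [b] would be fixed by [sigma], hence a pole of [H] over a critical value.
   So the fibre over [b] has exactly [d] points, and its image under [sigma] is the list of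
   poles. *)
have nb : ~ critical_value f (Some b).
  move=> [p pc pb]; have [_ /(_ p pc)] : f p <> Some a /\ forall p', critical f p' -> f p <> f p'.
    by apply: b_gen; rewrite (crit_real _ pc).
  exact.
have [s [us sP szs]] := noncritical_fiber f_holo f_deg nb.
have bsP q : q \in map sigma s <-> f (sigma q) = Some b.
  suff -> : (q \in map sigma s) = (f (sigma q) == Some b) by split => /eqP.
  by rewrite -sP -{1}[q]sK mem_map //; exact: inv_inj.
have fib (x : Cplx R) : exists t : 'I_d -> X, ~ critical_value f (cinv a x) ->
    [/\ forall i, f (t i) = cinv a x, injective t & forall q, f q = cinv a x -> exists i, q = t i].
  have [nx|cx] := pselect (critical_value f (cinv a x)).
    by have [q _] := rs_nonempty X; exists (fun=> q).
  have [t /nbhs_singleton[t1 t2 t3 _]] := sheets X_compact f_holo f_deg cx.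
  by exists (t^~ (cinv a x)).
have [e eP] := choice fib.
apply: (sigma_descends X_compact f_holo f_deg (prime_gt0 d_prime) crsP sigma_real).
apply: (map_sigma_fiber X_compact f_holo f_deg critval_distinct crsP sigma_real
  crit_real a_gen b_gen bsP eP) => //.
- by rewrite map_inj_uniq //; exact: inv_inj.
- by rewrite size_map.
- exact: finmap.fset_uniq.
- by rewrite crs_size; exact: critical_count.
Qed.
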